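(* Let $G$ be the tetrahedral, octahedral or icosahedral reflection group with invariants $P,Q,R$ and semi-invariant $S$ as in the context, and let $SG=G\cap SO(3)$. Let $r,t\in\mathbb{C}$ with $r\ne 0$, such that the cubic polynomial $R\mapsto F(r,t,R)$ (with $F$ as in the context) has non-zero discriminant. Let $C_{r,t}\subset\mathbb{P}^3(\mathbb{C})$ be the projective closure of $\{(x,y,z)\in\mathbb{C}^3: P=r,\ Q=t\}$. Then the quotient of the curve $C_{r,t}$ by the rotation group $SG$ is the elliptic curve $E_{r,t}$ defined in the $(S,R)$-plane by the equation $$E_{r,t}:\ S^2=F(r,t,R).$$
   Context: $G\subset O(3)$ is the full symmetry group of the regular tetrahedron, octahedron or icosahedron (orders $24,48,120$), in the coordinates in which the following polynomials are $G$-invariant ($P,Q,R$), respectively multiplied by $-1$ by every reflection of $G$ ($S$). Always $P=x^2+y^2+z^2$. Tetrahedron: $Q=xyz$, $R=x^2y^2+y^2z^2+x^2z^2$, $S=(x^2-y^2)(y^2-z^2)(z^2-x^2)$, and $$F(P,Q,R)=-4R^3+P^2R^2+18PQ^2R-(4P^3+27Q^2)Q^2.$$ Octahedron: $Q=x^2y^2+y^2z^2+x^2z^2$, $R=x^2y^2z^2$, $S=xyz(x^2-y^2)(y^2-z^2)(z^2-x^2)$, and $$F(P,Q,R)=-27R^3+P(18Q-4P^2)R^2+Q^2(P^2-4Q)R.$$ Icosahedron: $Q=z(-5z^3(x^2+y^2)+5z(x^2+y^2)^2-2x(x^4-10x^2y^2+5y^4)+z^5)$, $R=(4x^2+6xz+z^2)(x^4+8x^3z-10x^2y^2+14x^2z^2-8xz^3+5y^4-10y^2z^2+z^4)(x^4-2x^3z-10x^2y^2-x^2z^2+30xy^2z+2xz^3+5y^4-25y^2z^2+z^4)$,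 $S=8y(5x^4-10x^2y^2+y^4)(x^2-xz-z^2)(x^4-10x^2y^2+5y^4-12x^3z+20xy^2z+44x^2z^2-20y^2z^2-48xz^3+16z^4)(x^4-10x^2y^2+5y^4+8x^3z-40xy^2z+24x^2z^2-40y^2z^2+32xz^3+16z^4)$, and $$\begin{aligned}F(P,Q,R)={}&-R^3+P^2(4P^3-65Q)R^2+PQ(720Q^2+200P^6-795P^3Q)R\\&+500P^9Q^2-2275P^6Q^3+3440P^3Q^4-1728Q^5.\end{aligned}$$ In each case the relation $S^2=F(P,Q,R)$ holds. The group $SG$ acts linearly on $\mathbb{C}^3$, hence on $\mathbb{P}^3\supset\mathbb{C}^3$ and on $C_{r,t}$; the elliptic curve $E_{r,t}$ is the smooth projective model of the affine curve with the displayed equation. *)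

(* Defs.v *)
From HB Require Import structures.
From mathcomp Require Import all_boot all_order all_algebra complex.
From mathcomp Require Import mpoly.
From mathcomp Require Import classical_sets reals trigo.

Set Implicit Arguments.
Unset Strict Implicit.
Unset Printing Implicit Defensive.

Import Order.TTheory GRing.Theory Num.Theory.

Local Open Scope classical_set_scope.
Local Open Scope ring_scope.

(* P^n(K) is the set of lines of K^(n+1), so that equality of points is *)
(* Leibniz equality. *)
Definition proj (K : fieldType) (n : nat) : Type :=
  {V : {vspace 'cV[K]_n.+1} | \dim V == 1%N}.

Definition hcoord (K : fieldType) n (x : proj K n) (v : 'cV[K]_n.+1) : Prop :=
  v != 0 /\ v \in sval x.

Definition aeval (K : fieldType) n (p : {mpoly K[n]}) (v : 'cV[K]_n) : K :=
  p.@[fun i => v i 0].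

Lemma dim_affine_line (K : fieldType) n (u : 'cV[K]_n) :
  \dim <[col_mx 1%:M u : 'cV[K]_n.+1]>%VS == 1%N.
Proof.
rewrite dim_vline; suff -> : (col_mx 1%:M u : 'cV[K]_n.+1) != 0 by [].
apply/eqP => /(congr1 (fun v : 'cV[K]_(1 + n) => usubmx v 0 0)) /eqP.
by rewrite col_mxKu !mxE oner_eq0.
Qed.

(* The standard embedding K^n -> P^n(K), u |-> [1 : u_0 : ... : u_(n-1)]; *)
(* the hyperplane at infinity is the vanishing locus of the coordinate 0. *)
Definition affine_pt (K : fieldType) n (u : 'cV[K]_n) : proj K n :=
  exist _ <[col_mx 1%:M u : 'cV[K]_n.+1]>%VS (dim_affine_line u).

Definition vanishes_at (K : fieldType) n (p : {mpoly K[n.+1]}) (x : proj K n) :=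
  forall v, hcoord x v -> aeval p v = 0.

Definition homogeneous (K : fieldType) n (p : {mpoly K[n]}) : Prop :=
  exists d : nat, p \is d.-homog.

Definition zclosed (K : fieldType) n (A : set (proj K n)) : Prop :=
  exists2 I : set {mpoly K[n.+1]}, I `<=` @homogeneous K n.+1 &
    A = [set x | forall p, I p -> vanishes_at p x].

Definition zopen_in (K : fieldType) n (X U : set (proj K n)) : Prop :=
  exists2 A, zclosed A & U = X `\` A.

Definition zclosure (K : fieldType) n (A : set (proj K n)) : set (proj K n) :=
  smallest (@zclosed K n) A.

Definition irreducible (K : fieldType) n (X : set (proj K n)) : Prop :=
  X !=set0 /\ forall A B, zclosed A -> zclosed B ->
    X `<=` A `|` B -> X `<=` A \/ X `<=` B.

(* Only the values of f on U matter. *)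
Definition regular_on (K : fieldType) n (U : set (proj K n))
    (f : proj K n -> K) : Prop :=
  forall x, U x -> exists2 W, zopen_in U W /\ W x &
    exists d (a b : {mpoly K[n.+1]}), [/\ a \is d.-homog, b \is d.-homog &
      forall y v, W y -> hcoord y v ->
        aeval b v != 0 /\ f y = aeval a v / aeval b v].

Definition morphism_on (K : fieldType) m n (X : set (proj K m))
    (Y : set (proj K n)) (phi : proj K m -> proj K n) : Prop :=
  [/\ forall x, X x -> Y (phi x),
      forall V, zopen_in Y V -> zopen_in X (X `&` phi @^-1` V) &
      forall V f, zopen_in Y V -> regular_on V f ->
        regular_on (X `&` phi @^-1` V) (f \o phi)].

Definition isomorphic (K : fieldType) m n (X : set (proj K m))
    (Y : set (proj K n)) : Prop :=
  exists phi psi, [/\ morphism_on X Y phi, morphism_on Y X psi,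
    forall x, X x -> psi (phi x) = x & forall y, Y y -> phi (psi y) = y].

Definition dense_open (K : fieldType) n (X U : set (proj K n)) : Prop :=
  zopen_in X U /\ X `<=` zclosure U.

Definition birational (K : fieldType) m n (X : set (proj K m))
    (Y : set (proj K n)) : Prop :=
  exists U V, [/\ dense_open X U, dense_open Y V & isomorphic U V].

(* Krull dimension 1: a maximal chain of irreducible closed subsets of an *)
(* irreducible X has the form {x} < X. *)
Definition projective_curve (K : fieldType) n (X : set (proj K n)) : Prop :=
  [/\ zclosed X, irreducible X, forall x, X <> [set x] &
      forall Z, zclosed Z -> irreducible Z -> Z `<=` X ->
        Z = X \/ exists x, Z = [set x]].

(* Linear subspace of K^(n+1) underlying the embedded tangent space of X at x; *)
(* its dimension is 1 more than that of the Zariski tangent space. *)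
Definition affine_tangent_space (K : fieldType) n (X : set (proj K n))
    (x : proj K n) : set 'cV[K]_n.+1 :=
  [set u | forall p, homogeneous p -> (forall y, X y -> vanishes_at p y) ->
     forall v, hcoord x v -> \sum_i aeval p^`M(i) v * u i 0 = 0].

Definition smooth_projective_curve (K : fieldType) n (X : set (proj K n)) :=
  projective_curve X /\
  forall x, X x -> exists2 U : {vspace 'cV[K]_n.+1},
    (forall u, u \in U <-> affine_tangent_space X x u) & \dim U = 2%N.

Definition smooth_projective_model (K : fieldType) m n
    (A : set (proj K m)) (E : set (proj K n)) : Prop :=
  smooth_projective_curve E /\ birational A E.

Definition nonsingular_plane_cubic (K : fieldType) (E : set (proj K 2)) :=
  exists p : {mpoly K[3]}, [/\ p \is 3.-homog,
    E = [set x | vanishes_at p x] &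
    forall x v, E x -> hcoord x v -> exists i, aeval p^`M(i) v != 0].

Definition same_orbit (K : fieldType) n (Gam : set 'M[K]_n.+1)
    (x y : proj K n) : Prop :=
  exists2 g, Gam g &
    sval y = (linfun (mulmx g) @: sval x)%VS.

(* Geometric quotient: the fibres of phi are the orbits, Y has the quotient *)
(* topology, and O_Y(V) is the ring of invariants of O_X(phi^-1 V). *)
Definition geometric_quotient (K : fieldType) m n (Gam : set 'M[K]_m.+1)
    (X : set (proj K m)) (Y : set (proj K n)) (phi : proj K m -> proj K n) :=
  [/\ morphism_on X Y phi,
      phi @` X = Y,
      forall x y, X x -> X y -> phi x = phi y <-> same_orbit Gam x y,
      forall V, V `<=` Y -> zopen_in X (X `&` phi @^-1` V) -> zopen_in Y V &
      forall V g, zopen_in Y V -> regular_on (X `&` phi @^-1` V) g ->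
        (forall x y, (X `&` phi @^-1` V) x -> (X `&` phi @^-1` V) y ->
           same_orbit Gam x y -> g x = g y) ->
        exists2 f, regular_on V f &
          forall x, (X `&` phi @^-1` V) x -> g x = f (phi x)].

Inductive polyhedron := Tetrahedron | Octahedron | Icosahedron.

Definition invP (A : comNzRingType) (x y z : A) : A := x ^+ 2 + y ^+ 2 + z ^+ 2.

Definition invQ (A : comNzRingType) (T : polyhedron) (x y z : A) : A :=
  match T with
  | Tetrahedron => x * y * z
  | Octahedron => x ^+ 2 * y ^+ 2 + y ^+ 2 * z ^+ 2 + x ^+ 2 * z ^+ 2
  | Icosahedron =>
      z * (- 5 * z ^+ 3 * (x ^+ 2 + y ^+ 2) + 5 * z * (x ^+ 2 + y ^+ 2) ^+ 2
           - 2 * x * (x ^+ 4 - 10 * x ^+ 2 * y ^+ 2 + 5 * y ^+ 4) + z ^+ 5)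
  end.

Definition invR (A : comNzRingType) (T : polyhedron) (x y z : A) : A :=
  match T with
  | Tetrahedron => x ^+ 2 * y ^+ 2 + y ^+ 2 * z ^+ 2 + x ^+ 2 * z ^+ 2
  | Octahedron => x ^+ 2 * y ^+ 2 * z ^+ 2
  | Icosahedron =>
      (4 * x ^+ 2 + 6 * x * z + z ^+ 2)
      * (x ^+ 4 + 8 * x ^+ 3 * z - 10 * x ^+ 2 * y ^+ 2
         + 14 * x ^+ 2 * z ^+ 2 - 8 * x * z ^+ 3 + 5 * y ^+ 4
         - 10 * y ^+ 2 * z ^+ 2 + z ^+ 4)
      * (x ^+ 4 - 2 * x ^+ 3 * z - 10 * x ^+ 2 * y ^+ 2 - x ^+ 2 * z ^+ 2
         + 30 * x * y ^+ 2 * z + 2 * x * z ^+ 3 + 5 * y ^+ 4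
         - 25 * y ^+ 2 * z ^+ 2 + z ^+ 4)
  end.

Definition invS (A : comNzRingType) (T : polyhedron) (x y z : A) : A :=
  match T with
  | Tetrahedron =>
      (x ^+ 2 - y ^+ 2) * (y ^+ 2 - z ^+ 2) * (z ^+ 2 - x ^+ 2)
  | Octahedron =>
      x * y * z * (x ^+ 2 - y ^+ 2) * (y ^+ 2 - z ^+ 2) * (z ^+ 2 - x ^+ 2)
  | Icosahedron =>
      8 * y * (5 * x ^+ 4 - 10 * x ^+ 2 * y ^+ 2 + y ^+ 4)
      * (x ^+ 2 - x * z - z ^+ 2)
      * (x ^+ 4 - 10 * x ^+ 2 * y ^+ 2 + 5 * y ^+ 4 - 12 * x ^+ 3 * z
         + 20 * x * y ^+ 2 * z + 44 * x ^+ 2 * z ^+ 2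
         - 20 * y ^+ 2 * z ^+ 2 - 48 * x * z ^+ 3 + 16 * z ^+ 4)
      * (x ^+ 4 - 10 * x ^+ 2 * y ^+ 2 + 5 * y ^+ 4 + 8 * x ^+ 3 * z
         - 40 * x * y ^+ 2 * z + 24 * x ^+ 2 * z ^+ 2
         - 40 * y ^+ 2 * z ^+ 2 + 32 * x * z ^+ 3 + 16 * z ^+ 4)
  end.

Definition relF (A : comNzRingType) (T : polyhedron) (P Q R : A) : A :=
  match T with
  | Tetrahedron =>
      - 4 * R ^+ 3 + P ^+ 2 * R ^+ 2 + 18 * P * Q ^+ 2 * R
      - (4 * P ^+ 3 + 27 * Q ^+ 2) * Q ^+ 2
  | Octahedron =>
      - 27 * R ^+ 3 + P * (18 * Q - 4 * P ^+ 2) * R ^+ 2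
      + Q ^+ 2 * (P ^+ 2 - 4 * Q) * R
  | Icosahedron =>
      - R ^+ 3 + P ^+ 2 * (4 * P ^+ 3 - 65 * Q) * R ^+ 2
      + P * Q * (720 * Q ^+ 2 + 200 * P ^+ 6 - 795 * P ^+ 3 * Q) * R
      + 500 * P ^+ 9 * Q ^+ 2 - 2275 * P ^+ 6 * Q ^+ 3
      + 3440 * P ^+ 3 * Q ^+ 4 - 1728 * Q ^+ 5
  end.

(* Valid when size p^`() = (size p).-1, e.g. in characteristic 0. *)
Definition discriminant (K : fieldType) (p : {poly K}) : K :=
  (-1) ^+ 'C((size p).-1, 2%N) * resultant p p^`() / lead_coef p.

Definition col3 (A : nzRingType) (a b c : A) : 'cV[A]_3 :=
  \col_(i < 3) [:: a; b; c]`_i.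

Definition col2 (A : nzRingType) (a b : A) : 'cV[A]_2 :=
  \col_(i < 2) [:: a; b]`_i.

(* Up to sign, the linear factors of the icosahedral invariant Q are z and *)
(* 2 cos(2 k pi / 5) x + 2 sin(2 k pi / 5) y - z for k < 5; their coefficient *)
(* vectors span the six axes through opposite vertices (the first one has to *)
(* be rescaled by sqrt 5). *)
Definition vertices (R : realType) (T : polyhedron) : seq 'cV[R]_3 :=
  match T with
  | Tetrahedron =>
      [:: col3 1 1 1; col3 1 (-1) (-1); col3 (-1) 1 (-1); col3 (-1) (-1) 1]
  | Octahedron =>
      [:: col3 1 0 0; col3 (-1) 0 0; col3 0 1 0; col3 0 (-1) 0;
          col3 0 0 1; col3 0 0 (-1)]
  | Icosahedron =>
      let half := col3 0 0 (Num.sqrt 5)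
        :: [seq col3 (2 * cos (2 * k%:R * pi / 5))
                     (2 * sin (2 * k%:R * pi / 5)) (-1) | k <- iota 0 5] in
      half ++ [seq - v | v <- half]
  end.

Definition symmetry_group (R : realType) (T : polyhedron) : set 'M[R]_3 :=
  [set g | g^T *m g = 1%:M /\
           [seq g *m v | v <- vertices R T] =i vertices R T].

Definition rotation_group (R : realType) (T : polyhedron) : set 'M[R]_3 :=
  symmetry_group T `&` [set g | \det g = 1].

(* The rotation group acting on P^3(C), whose coordinate 0 it fixes. *)
Definition proj_rotation_group (R : realType) (T : polyhedron) :
    set 'M[R[i]]_4 :=
  [set (block_mx 1%:M 0 0 (map_mx (real_complex R) g) : 'M_(1 + 3))
     | g in @rotation_group R T].

Definition affineC (K : fieldType) (T : polyhedron) (r t : K) :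
    set 'cV[K]_3 :=
  [set u | invP (u 0 0) (u 1 0) (u 2 0) = r /\
           invQ T (u 0 0) (u 1 0) (u 2 0) = t].

Definition curveC (K : fieldType) (T : polyhedron) (r t : K) :
    set (proj K 3) :=
  zclosure [set affine_pt u | u in affineC T r t].

(* The coordinates of the plane are (S, R), in this order. *)
Definition affineE (K : fieldType) (T : polyhedron) (r t : K) :
    set 'cV[K]_2 :=
  [set w | w 0 0 ^+ 2 = relF T r t (w 1 0)].

Definition curveE (K : fieldType) (T : polyhedron) (r t : K) :
    set (proj K 2) :=
  zclosure [set affine_pt u | u in affineE T r t].

Definition quotient_coords (K : fieldType) (T : polyhedron) (u : 'cV[K]_3) :
    'cV[K]_2 :=
  col2 (invS T (u 0 0) (u 1 0) (u 2 0)) (invR T (u 0 0) (u 1 0) (u 2 0)).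

(* Main.v *)
Require Import Defs.
From HB Require Import structures.
From mathcomp Require Import all_boot all_order all_algebra complex.
From mathcomp Require Import mpoly.
From mathcomp Require Import classical_sets reals trigo.
From mathcomp Require Import boolp separable ring lra zify.

Set Implicit Arguments.
Unset Strict Implicit.
Unset Printing Implicit Defensive.

Import Order.TTheory GRing.Theory Num.Theory.

Local Open Scope classical_set_scope.
Local Open Scope ring_scope.

(* Let Phi = [w^(3m) : S : R w^m], with m = 2, 3, 5, on the cone P = r w^2, Q = t w^(m+1) over
   C_{r,t}. S vanishes to first order on the mirrors of G, so G-skew polynomials are divisible by S,
   and a Chevalley argument with the Jacobian of (P, Q, R), a multiple of S, shows that the
   averages over SG of polynomials are polynomials in P, Q, R, S. On the cone the relation
   S^2 = F lets one rewrite an average of a form of degree 3mn as a form of degree n in the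
   coordinates of Phi. Applied to the powers of a form f, this expresses the power sums of the
   values of f on an orbit, which vanish simultaneously only if f vanishes on the orbit. The
   closure of the affine curve, the fibres of Phi, the quotient topology and the descent of
   invariant regular functions all follow; surjectivity amounts to solving the equations P = r,
   Q = t, R = s by radicals and one root of a polynomial in z^2. *)

(** * Polynomials in several variables *)

(** The degrees of P, Q, R, S are 2, m + 1, 2m, 3m. On the cone, w^m, R, S thus have degrees in the
    ratio 1 : 2 : 3, the relation becomes a Weierstrass equation in these weights, and the entries
    of Phi are exactly the monomials of weight 3. The obstacle is that C_{r,t} is given only as a
    closure: neither its ideal nor its irreducibility is at hand. Questions about forms on it are
    therefore moved by orbit sums to the plane cubic, and only the ideal of the cubic is computed.
    Phi sends every point at infinity to [0 : 1 : 0], so these points must form a single orbit.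
    There the relation degenerates to S^2 = c3 R^3, and a rescaling equates the invariants of any
    two of them. The group is defined by the vertices, not by generators. Power sums of the linear
    forms attached to the vertices give the invariance of P, Q, R; explicit matrices serve only to
    carry one mirror of each orbit to all the others. The condition r != 0 provides, for the
    icosahedron, a point with z != 0 in every affine fibre. *)

Section MpolyGeneral.

Lemma mpoly_ring_ind (K : fieldType) n (Q : {mpoly K[n]} -> Prop) :
  (forall c, Q c%:MP) -> (forall i, Q 'X_i) ->
  (forall p q, Q p -> Q q -> Q (p + q)) ->
  (forall p q, Q p -> Q q -> Q (p * q)) -> forall p, Q p.
Proof.
move=> QC QX QD QM; apply: mpolyind; first by rewrite -mpolyC0; exact: QC.
move=> c m p _ _ Qp; apply: (QD _ _ _ Qp); rewrite -mul_mpolyC; apply: (QM _ _ (QC c)).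
rewrite mpolyXE_id; apply: (big_ind Q) => [||i _]; [by rewrite -mpolyC1|exact: QM|].
elim: (m i) => [|k IH]; first by rewrite expr0 -mpolyC1.
by rewrite exprS; apply: QM.
Qed.

(** In characteristic 0 the product [p * g] vanishes at all natural numbers, more points than its
    size allows. The factor g stands for finitely many excluded arguments. *)
Lemma poly_eval0 (K : numFieldType) (p g : {poly K}) : g != 0 ->
  (forall x, g.[x] != 0 -> p.[x] = 0) -> p = 0.
Proof.
move=> g0 H; suff /eqP : p * g = 0 by rewrite mulf_eq0 (negbTE g0) orbF => /eqP.
apply/eqP/negPn/negP => pg0.
pose rs := [seq n%:R : K | n <- iota 0 (size (p * g))].
have := @max_poly_roots _ (p * g) rs pg0; rewrite size_map size_iota ltnn.
move=> H'; suff : false by []; apply: H'.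
  apply/allP => x _; rewrite rootE hornerM mulf_eq0.
  by have [_|/H ->] := eqVneq g.[x] 0; rewrite ?eqxx ?orbT.
by rewrite map_inj_uniq ?iota_uniq // => i j /eqP; rewrite eqr_nat => /eqP.
Qed.

Lemma meval_muni (K : fieldType) n (p : {mpoly K[n.+1]}) (v : 'I_n.+1 -> K) :
  p.@[v] = (map_poly (meval (fun i => v (widen_ord (leqnSn n) i))) (muni p)).[v ord_max].
Proof.
rewrite muniE rmorph_sum /= horner_sum mevalE; apply: eq_bigr => m _.
rewrite map_polyZ hornerZ map_polyXn hornerXn /= mevalZ mevalX.
by rewrite big_ord_recr /= mulrA; congr (_ * _ * _); apply: eq_bigr => i _; rewrite mnmE.
Qed.

Lemma muniK (K : fieldType) n (p : {mpoly K[n.+1]}) :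
  (map_poly (@mwiden n K) (muni p)).['X_ord_max] = p.
Proof.
rewrite {2}(mpolyE p) muniE rmorph_sum /= horner_sum; apply: eq_bigr => m _.
rewrite map_polyZ hornerZ map_polyXn hornerXn /= mwidenZ mwidenX -scalerAl; congr (_ *: _).
rewrite !mpolyXE_id big_ord_recr /= mnmwiden_ordmax expr0 mulr1 [RHS]big_ord_recr /=.
rewrite -mpolyXE_id; congr (_ * _).
by apply: eq_bigr => i _; rewrite mnmwiden_widen mnmE.
Qed.

Lemma mpoly_eval0 (K : numFieldType) n (p : {mpoly K[n]}) : (forall v, p.@[v] = 0) -> p = 0.
Proof.
elim: n p => [|n IH] p H.
  have pC : p = (p@_0%MM)%:MP.
    by apply/mpolyP => m; rewrite mcoeffC (_ : m = 0%MM) ?eqxx ?mulr1 //; apply/mnmP => -[].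
  by have := H (fun=> 0); rewrite pC mevalC => ->; rewrite mpolyC0.
rewrite -(muniK p) (_ : muni p = 0) ?raddf0 ?horner0 //.
apply/polyP => k; rewrite coef0; apply: IH => v'.
rewrite -coef_map; set q := map_poly _ _; suff -> : q = 0 by rewrite coef0.
apply: (@poly_eval0 _ _ 1) => [|x _]; first exact: oner_neq0.
pose v (i : 'I_n.+1) := if insub (val i) is Some j then v' j else x.
have := H v; rewrite meval_muni.
have -> : v ord_max = x by rewrite /v insubF //= ltnn.
move=> <-; congr (_.[_]); apply: eq_map_poly => r; apply: meval_eq => i.
by rewrite /v /= insubT //= => lt_i; congr v'; apply: val_inj.
Qed.

Lemma mpoly_eqfun (K : numFieldType) n (p q : {mpoly K[n]}) : (forall v, aeval p v = aeval q v) -> p = q.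
Proof.
move=> H; apply/eqP; rewrite -subr_eq0; apply/eqP/mpoly_eval0 => v.
have := H (\col_i v i); rewrite /aeval !(@meval_eq _ _ (fun i => _) v) => [e|i|i]; rewrite ?mxE //.
by rewrite mevalB e subrr.
Qed.

Lemma aeval_ext (K : fieldType) n (p : {mpoly K[n]}) (v : 'I_n -> K) : p.@[v] = aeval p (\col_i v i).
Proof. by apply: meval_eq => i; rewrite mxE. Qed.

Lemma dhomog_comp (K : fieldType) m n (p : {mpoly K[n]}) (lq : n.-tuple {mpoly K[m]}) d e :
  p \is d.-homog -> (forall i, tnth lq i \is e.-homog) -> p \mPo lq \is (d * e).-homog.
Proof.
move=> /dhomogP hp hq; rewrite comp_mpolyEX rpred_sum // => k _.
have [kp|] := boolP (k \in msupp p); last by rewrite -mcoeff_eq0 => /eqP ->; rewrite scale0r rpred0.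
rewrite rpredZ // comp_mpolyX.
have -> : (d * e = \sum_(i < n) e * k i)%N by rewrite -big_distrr /= -mdegE hp // mulnC.
by apply: (big_ind2 (fun (q : {mpoly K[m]}) c => q \is c.-homog)) => [|q c q' c' h h'|i _]; [exact: dhomog1|exact: dhomogM|exact: dhomogMn].
Qed.

Lemma dhomog_eval (K : fieldType) n (p : {mpoly K[n]}) d c (v : 'cV[K]_n) :
  p \is d.-homog -> aeval p (c *: v) = c ^+ d * aeval p v.
Proof.
move=> /dhomogP hp; rewrite /aeval !mevalE big_distrr /=; apply: eq_big_seq => m mp.
rewrite mulrCA; congr (_ * _); have /= <- := hp _ mp; rewrite mdegE -prodrXr -big_split /=.
by apply: eq_bigr => i _; rewrite mxE exprMn.
Qed.

(** Since p is homogeneous, the part of degree d + k of [p * q] is p times the part of degree k of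
    q. Hence all parts of q vanish except the one with d + k = e. *)
Lemma dhomog_cofactor (K : fieldType) n (p q : {mpoly K[n]}) d e :
  p != 0 -> q != 0 -> p \is d.-homog -> p * q \is e.-homog ->
  (d <= e)%N /\ q \is (e - d).-homog.
Proof.
move=> p0 q0 hp hpq.
have E k : (d + k)%N != e -> pihomog mdeg k q = 0.
  move=> dke; apply/eqP; suff : p * pihomog mdeg k q == 0 by rewrite mulf_eq0 (negbTE p0).
  have <- : pihomog mdeg (d + k) (p * q) = p * pihomog mdeg k q.
    rewrite {1}(@pihomog_partitionE _ _ mdeg (maxn (msize q) k.+1) q) ?leq_maxl // big_distrr /= raddf_sum /=.
    have lt_k : (k < maxn (msize q) k.+1)%N by rewrite leq_max ltnS leqnn orbT.
    rewrite (bigD1 (Ordinal lt_k)) //= pihomog_dE ?dhomogM ?pihomogP //.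
    rewrite big1 ?addr0 // => i; rewrite -val_eqE /= => ik.
    apply: (pihomog_ne0 (d := (d + i)%N)); last by rewrite dhomogM ?pihomogP.
    by rewrite eqn_add2l.
  by apply/eqP/(pihomog_ne0 (d := e)) => //; rewrite eq_sym.
have qE : q = \sum_(k < msize q) pihomog mdeg k q by apply: pihomog_partitionE.
have de : (d <= e)%N.
  rewrite leqNgt; apply/negP => ed; case/eqP: q0; rewrite qE big1 // => k _; apply: E.
  by rewrite gtn_eqF // (leq_trans ed) ?leq_addr.
split=> //; rewrite qE rpred_sum // => k _.
have [/E -> |] := boolP (d + k != e)%N; first by rewrite rpred0.
by rewrite negbK => /eqP <-; rewrite addKn pihomogP.
Qed.

Lemma subm_self n (m : 'X_{1..n}) : (m - m = 0)%MM.
Proof. by apply/mnmP => i; rewrite mnmBE mnm0E subnn. Qed.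

Definition mact (K : fieldType) n (M : 'M[K]_n) (p : {mpoly K[n]}) : {mpoly K[n]} :=
  p \mPo [tuple \sum_j M i j *: 'X_j | i < n].

Lemma aeval_mact (K : fieldType) n (M : 'M[K]_n) p u : aeval (mact M p) u = aeval p (M *m u).
Proof.
rewrite /aeval /mact comp_mpoly_meval; apply: meval_eq => i.
by rewrite tnth_mktuple rmorph_sum mxE; apply: eq_bigr => j _; rewrite /= mevalZ mevalXU.
Qed.

Lemma dhomog_mact (K : fieldType) n (M : 'M[K]_n) p d : p \is d.-homog -> mact M p \is d.-homog.
Proof.
move=> hp; rewrite -[d]muln1; apply: dhomog_comp => // i; rewrite tnth_mktuple rpred_sum // => j _.
by rewrite rpredZ // dhomogX; apply/eqP/mdeg1.
Qed.

Lemma mderiv_mact (K : fieldType) n (M : 'M[K]_n) p j :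
  (mact M p)^`M(j) = \sum_i M i j *: mact M p^`M(i).
Proof.
elim/mpoly_ring_ind: p => [c|k|p q IHp IHq|p q IHp IHq].
- rewrite /mact comp_mpolyC mderivC big1 // => i _.
  by rewrite mderivC comp_mpoly0 scaler0.
- rewrite /mact comp_mpolyXU -tnth_nth tnth_mktuple raddf_sum /= (bigD1 j) //= mderivZ mderivX mnm1E eqxx scale1r subm_self mpolyX0.
  rewrite big1 => [|i ij]; last by rewrite mderivZ mderivX mnm1E (negbTE ij) scale0r scaler0.
  rewrite addr0 (bigD1 k) //= mderivX mnm1E eqxx scale1r subm_self mpolyX0 comp_mpoly1 big1 ?addr0 // => i ik.
  by rewrite mderivX mnm1E eq_sym (negbTE ik) scale0r comp_mpoly0 scaler0.
- rewrite /mact !raddfD /= IHp IHq -big_split /=; apply: eq_bigr => i _.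
  by rewrite mderivD comp_mpolyD scalerDr.
- rewrite /mact rmorphM /= mderivM IHp IHq big_distrl big_distrr /= -big_split /=; apply: eq_bigr => i _.
  by rewrite mderivM rmorphD !rmorphM /= scalerDr scalerAl scalerAr.
Qed.

Definition lform (K : fieldType) n (a : 'cV[K]_n) : {mpoly K[n]} := \sum_i a i 0 *: 'X_i.

Lemma aeval_lform (K : fieldType) n (a u : 'cV[K]_n) : aeval (lform a) u = (a^T *m u) 0 0.
Proof.
rewrite /aeval /lform rmorph_sum mxE; apply: eq_bigr => i _.
by rewrite /= mevalZ mevalXU mxE.
Qed.

(** The substitution [tau] projects onto the hyperplane a = 0 along a coordinate axis [i0] with a
    nonzero entry of a. It thus serves as restriction to the hyperplane. *)
Lemma lform_section (K : numFieldType) n (a : 'cV[K]_n) : a != 0 ->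
  exists tau : n.-tuple {mpoly K[n]},
  [/\ forall p, exists q, p - (p \mPo tau) = lform a * q,
      forall v, aeval (lform a \mPo tau) v = 0 &
      forall p u, aeval (lform a) u = 0 -> aeval (p \mPo tau) u = aeval p u].
Proof.
move=> /cV0Pn [i0 a0].
pose tau := [tuple if i == i0 then 'X_i0 - (a i0 0)^-1 *: lform a else 'X_i | i < n].
exists tau; split=> [p|v|p u au].
- elim/mpoly_ring_ind: p => [c|i|p p' [q e] [q' e']|p p' [q e] [q' e']].
  + by exists 0; rewrite comp_mpolyC subrr mulr0.
  + rewrite comp_mpolyXU -tnth_nth tnth_mktuple; case: eqP => [->|_]; last by exists 0; rewrite subrr mulr0.
    by exists ((a i0 0)^-1)%:MP; rewrite opprB addrC subrK mulrC mul_mpolyC.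
  + by exists (q + q'); rewrite mulrDr -e -e' comp_mpolyD opprD addrACA.
  + exists (p * q' + q * (p' \mPo tau)); rewrite rmorphM /= mulrDr mulrCA -e' mulrA -e; ring.
- rewrite /aeval comp_mpoly_meval /lform rmorph_sum /= (bigD1 i0) //= mevalZ mevalXU tnth_mktuple eqxx mevalB mevalXU mevalZ mulrBr mulVKf //.
  rewrite /lform rmorph_sum /= [X in _ - X + _](bigD1 i0) //= mevalZ mevalXU opprD addNKr addrC; apply/eqP; rewrite subr_eq0; apply/eqP.
  by apply: eq_bigr => i ii0; rewrite !mevalZ !mevalXU tnth_mktuple (negbTE ii0) mevalXU.
- rewrite /aeval comp_mpoly_meval; apply: meval_eq => i.
  rewrite tnth_mktuple; case: eqP => [->|_]; last by rewrite mevalXU.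
  by move: au; rewrite mevalB mevalXU mevalZ /aeval => ->; rewrite mulr0 subr0.
Qed.

Lemma lform_div (K : numFieldType) n (a : 'cV[K]_n) h : a != 0 ->
  (forall u, aeval (lform a) u = 0 -> aeval h u = 0) -> exists q, h = lform a * q.
Proof.
move=> /lform_section [tau [D T0 _]] H.
have [q hq] := D h; exists q; rewrite -hq (_ : h \mPo tau = 0) ?subr0 //.
apply: mpoly_eval0 => v; rewrite comp_mpoly_meval aeval_ext; apply: H.
by rewrite -aeval_ext -comp_mpoly_meval aeval_ext T0.
Qed.

(** The condition on derivatives replaces pairwise coprimality. At u the product rule leaves only
    the derivative of [lform a] times the product of the other forms, so this product does not
    vanish identically on a = 0 and cancels after restriction by [tau]. *)
Lemma lforms_div (K : numFieldType) n (s : seq 'cV[K]_n) h :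
  (forall a, a \in s -> exists2 u, aeval (lform a) u = 0 & exists j, aeval (\prod_(b <- s) lform b)^`M(j) u != 0) ->
  (forall a u, a \in s -> aeval (lform a) u = 0 -> aeval h u = 0) ->
  exists q, h = (\prod_(b <- s) lform b) * q.
Proof.
have DM (p q : {mpoly K[n]}) j u : aeval (p * q)^`M(j) u = aeval p^`M(j) u * aeval q u + aeval p u * aeval q^`M(j) u.
  by rewrite /aeval mderivM mevalD !mevalM.
elim: s h => [|a s IH] h Hs Hh; first by exists h; rewrite big_nil mul1r.
have [|b u bs|q hq] := IH h.
- move=> b bs; have [|u bu [j]] := Hs b; first by rewrite inE bs orbT.
  rewrite big_cons DM => ju; exists u => //; exists j; apply: contra_neq ju => ->.
  rewrite mulr0 addr0 (big_rem b) //= [X in _ * X]/aeval mevalM.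
  by move: bu; rewrite /aeval => ->; rewrite mul0r mulr0.
- by apply: Hh; rewrite inE bs orbT.
have [|u au [j]] := Hs a; first by rewrite inE eqxx.
rewrite big_cons DM au mul0r addr0 mulf_eq0 negb_or => /andP [aj su].
have a0 : a != 0.
  apply: contra_neq aj => ->; rewrite /lform big1 => [|i _]; first by rewrite mderiv0 /aeval meval0.
  by rewrite mxE scale0r.
have [|q' Hq'] := @lform_div K n a q a0; last by exists q'; rewrite hq Hq' mulrCA mulrA.
move=> v av; have [tau [D T0 T1]] := lform_section a0.
rewrite -T1 // (_ : q \mPo tau = 0) ?/aeval ?meval0 //.
have /eqP : h \mPo tau = 0.
  apply: mpoly_eval0 => w; rewrite comp_mpoly_meval aeval_ext.
  by apply: (Hh a); rewrite ?inE ?eqxx // -aeval_ext -comp_mpoly_meval aeval_ext T0.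
rewrite hq rmorphM mulf_eq0 => /orP[/eqP L0|/eqP //].
by case/eqP: su; rewrite -T1 // L0 /aeval meval0.
Qed.

End MpolyGeneral.

(** * Invariants and skew invariants of a reflection group *)

Lemma det_mx22 (A : comNzRingType) (M : 'M[A]_2) : \det M = M 0 0 * M 1 1 - M 0 1 * M 1 0.
Proof.
rewrite (expand_det_row _ 0) !big_ord_recl big_ord0 /cofactor !det_mx11 !mxE /=.
have -> : lift 0 (0 : 'I_1) = 1 :> 'I_2 by apply: val_inj.
have -> : lift 1 (0 : 'I_1) = 0 :> 'I_2 by apply: val_inj.
rewrite /bump /= ?addr0 ?addn0 expr0 expr1; ring.
Qed.

Lemma det_mx33 (A : comNzRingType) (M : 'M[A]_3) :
  \det M = M 0 0 * (M 1 1 * M 2%:R 2%:R - M 1 2%:R * M 2%:R 1)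
         - M 0 1 * (M 1 0 * M 2%:R 2%:R - M 1 2%:R * M 2%:R 0)
         + M 0 2%:R * (M 1 0 * M 2%:R 1 - M 1 1 * M 2%:R 0).
Proof.
rewrite (expand_det_row _ 0) !big_ord_recl big_ord0 /cofactor !det_mx22 !mxE /=.
have -> : lift 0 (0 : 'I_2) = 1 :> 'I_3 by apply: val_inj.
have -> : lift 0 (lift 0 (0 : 'I_1)) = 2%:R :> 'I_3 by apply: val_inj.
rewrite /bump /=.
have e a b : (a = b :> nat) -> forall x y : 'I_3, val x = a -> val y = b -> x = y by move=> -> x y <- /val_inj.
have e10 : lift 1 (0 : 'I_2) = 0 :> 'I_3 by apply: val_inj.
have e11 : lift 1 (1 : 'I_2) = 2%:R :> 'I_3 by apply: val_inj.
have e20 : lift 2%:R (0 : 'I_2) = 0 :> 'I_3 by apply: val_inj.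
have e21 : lift 2%:R (1 : 'I_2) = 1 :> 'I_3 by apply: val_inj.
have e01 : lift 0 (1 : 'I_2) = 2%:R :> 'I_3 by apply: val_inj.
rewrite ?e10 ?e11 ?e20 ?e21 ?e01 /= ?addr0 ?add0n ?expr0 ?expr1 ?sqrrN ?expr1n.
ring.
Qed.

Lemma dhomog_mderiv (K : fieldType) n (p : {mpoly K[n]}) d j :
  p \is d.-homog -> p^`M(j) \is d.-1.-homog.
Proof.
move=> /dhomogP hp; apply/dhomogP => m; rewrite mcoeff_msupp mcoeff_deriv => H.
have /hp /= <- : (m + U_(j))%MM \in msupp p.
  by rewrite mcoeff_msupp; apply: contraNneq H => ->; rewrite mul0rn.
by rewrite mdegD mdeg1 addn1.
Qed.

Lemma mpoly_euler (K : fieldType) n (p : {mpoly K[n]}) d :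
  p \is d.-homog -> \sum_i 'X_i * p^`M(i) = d%:R *: p.
Proof.
move=> /dhomogP hp; apply/mpolyP => m; rewrite mcoeffZ raddf_sum /=.
have E i : ('X_i * p^`M(i))@_m = (m i)%:R * p@_m.
  have [mi|mi] := posnP (m i).
    rewrite mulrC mcoeffMr mi mul0r big1 // => k /eqP mk; rewrite mcoeffX.
    case: eqP => [Ui|_]; last by rewrite mulr0.
    by have := congr1 (fun mm : 'X_{1..n} => mm i) mk; rewrite mnmDE -Ui mnm1E eqxx mi.
  have mE : (U_(i) + (m - U_(i)) = m)%MM by rewrite addmC submK // lep1mP -lt0n.
  rewrite mulrC -{1}mE mcoeffMX mcoeff_deriv addmC mE.
  by rewrite mnmBE mnm1E eqxx subn1 prednK // mulr_natl.
rewrite (eq_bigr _ (fun i _ => E i)) -big_distrl /= -natr_sum -mdegE.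
have [mp|] := boolP (m \in msupp p); first by have /= -> := hp _ mp.
by rewrite -mcoeff_eq0 => /eqP ->; rewrite !mulr0.
Qed.

Section Invariants.
Variables (K : numFieldType) (Gs : seq 'M[K]_3) (P Q R S : {mpoly K[3]}) (c : K) (q m : nat).
Hypotheses (Gs_uniq : uniq Gs)
  (Gs_mul : forall g h, g \in Gs -> h \in Gs -> g *m h \in Gs)
  (Gs_det : forall g, g \in Gs -> \det g = 1 \/ \det g = -1)
  (P_homog : P \is 2.-homog) (Q_homog : Q \is q.-homog)
  (R_homog : R \is (2 * m).-homog) (S_homog : S \is (3 * m).-homog)
  (m_gt0 : (0 < m)%N) (qE : q = m.+1)
  (P_inv : forall g, g \in Gs -> mact g P = P)
  (Q_inv : forall g, g \in Gs -> mact g Q = Q)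
  (R_inv : forall g, g \in Gs -> mact g R = R).

Definition jac (f1 f2 f3 : {mpoly K[3]}) : {mpoly K[3]} :=
  \det (\matrix_(i < 3, j < 3) ([:: f1; f2; f3]`_i)^`M(j)).

Hypotheses (c_neq0 : c != 0) (S_neq0 : S != 0) (jacE : jac P Q R = c *: S)
  (skew_div : forall h, (forall g, g \in Gs -> mact g h = \det g *: h) -> exists h', h = S * h').

Lemma mact_mact (g h : 'M[K]_3) f : mact h (mact g f) = mact (g *m h) f.
Proof. by apply: mpoly_eqfun => u; rewrite !aeval_mact mulmxA. Qed.

(** By the chain rule the Jacobian matrix of invariant functions equals its own pullback by g times
    g. Taking determinants and using that [\det g] is its own inverse gives the claim. *)
Lemma jac_skew g f1 f2 f3 : g \in Gs -> mact g f1 = f1 -> mact g f2 = f2 -> mact g f3 = f3 ->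
  mact g (jac f1 f2 f3) = \det g *: jac f1 f2 f3.
Proof.
move=> gG e1 e2 e3.
have E : jac f1 f2 f3 = mact g (jac f1 f2 f3) * (\det g)%:MP.
  rewrite /mact -[RHS]/(_ * _) /jac -det_map_mx -[X in _ * X]det_map_mx -det_mulmx; congr (\det _).
  apply/matrixP => i j; rewrite !mxE.
  have {1}-> : [:: f1; f2; f3]`_i = mact g [:: f1; f2; f3]`_i by case: i => -[|[|[|]]].
  by rewrite mderiv_mact; apply: eq_bigr => k _; rewrite !mxE mulrC mul_mpolyC.
rewrite [in RHS]E mulrC mul_mpolyC scalerA.
suff -> : \det g * \det g = 1 by rewrite scale1r.
by case: (Gs_det gG) => ->; rewrite ?mulrNN mulr1.
Qed.

Lemma jac_homog f1 f2 f3 d1 d2 d3 : f1 \is d1.-homog -> f2 \is d2.-homog -> f3 \is d3.-homog ->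
  jac f1 f2 f3 \is (d1.-1 + d2.-1 + d3.-1).-homog.
Proof.
move=> h1 h2 h3; rewrite /jac det_mx33 !mxE /= -!addnA.
have H i j k : f1^`M(i) * (f2^`M(j) * f3^`M(k)) \is (d1.-1 + (d2.-1 + d3.-1)).-homog.
  by rewrite !dhomogM ?dhomog_mderiv.
by rewrite !mulrBr !(rpredB, rpredD) ?H.
Qed.

Lemma S_skew g : g \in Gs -> mact g S = \det g *: S.
Proof.
move=> gG; have := jac_skew gG (P_inv gG) (Q_inv gG) (R_inv gG).
rewrite jacE /mact comp_mpolyZ scalerA mulrC -scalerA => /(scalerI c_neq0).
by [].
Qed.

Lemma skew_quot h k : h \is k.-homog -> (forall g, g \in Gs -> mact g h = \det g *: h) ->
  h = 0 \/ exists h', [/\ h = S * h', (3 * m <= k)%N, h' \is (k - 3 * m).-homog &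
    forall g, g \in Gs -> mact g h' = h'].
Proof.
move=> hh hs; have [->|h0] := eqVneq h 0; [by left|right].
have [h' hE] := skew_div hs; exists h'.
have h'0 : h' != 0 by apply: contraNneq h0; rewrite hE => ->; rewrite mulr0.
have [le hh'] := dhomog_cofactor S_neq0 h'0 S_homog (etrans (congr1 (fun p => p \is k.-homog) (esym hE)) hh).
split=> // g gG; have := hs g gG; rewrite hE {1}/mact rmorphM /= -!/(mact _ _) S_skew // -scalerAl.
move/scalerI => H; have /H /(mulfI S_neq0) // : \det g != 0.
by case: (Gs_det gG) => ->; rewrite ?oppr_eq0 oner_eq0.
Qed.

(** A weighted polynomial in P, Q, R kept as a list of exponents: the degrees of the monomials are
    needed later, when powers of P and Q turn into powers of w. *)
Definition inv_rep k h := exists2 s : seq (K * (nat * nat * nat)),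
  all (fun x => let: (_, (a, b, e)) := x in (2 * a + q * b + 2 * m * e == k)%N) s &
  h = \sum_(x <- s) (let: (z, (a, b, e)) := x in z *: (P ^+ a * Q ^+ b * R ^+ e)).

Lemma inv_rep0 k : inv_rep k 0.
Proof. by exists [::]; rewrite ?big_nil. Qed.

Lemma inv_repD k h h' : inv_rep k h -> inv_rep k h' -> inv_rep k (h + h').
Proof. by move=> [s ws ->] [s' ws' ->]; exists (s ++ s'); rewrite ?all_cat ?ws ?big_cat. Qed.

Lemma inv_repM k h z a b e :
  inv_rep k h -> inv_rep (2 * a + q * b + 2 * m * e + k)%N (z *: (P ^+ a * Q ^+ b * R ^+ e) * h).
Proof.
move=> [s ws ->]; exists [seq (let: (z', (a', b', e')) := x in (z * z', (a + a', b + b', e + e')%N)) | x <- s].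
  rewrite all_map; apply: sub_all ws => -[z' [[a' b'] e']] /= /eqP <-; apply/eqP; ring.
rewrite big_map big_distrr /=; apply: eq_bigr => -[z' [[a' b'] e']] _.
rewrite !exprD -!mul_mpolyC mpolyCM; ring.
Qed.

(* Cramer's rule recovers the gradient of h from those of P, Q, R; the Jacobian minors are skew, that
   is, S times invariants of smaller degree, and Euler's identity then gives h itself. *)
Lemma inv_chevalley k h : h \is k.-homog -> (forall g, g \in Gs -> mact g h = h) -> inv_rep k h.
Proof.
elim/ltn_ind: k h => k IH h hh hinv; have [k0|k0] := posnP k.
  exists [:: (h@_0%MM, (0, 0, 0)%N)]; first by rewrite /= k0 !muln0.
  rewrite big_seq1 /= !expr0 !mulr1; apply/mpolyP => n; rewrite mcoeffZ mcoeff1.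
  have [->|n0] := eqVneq n 0%MM; first by rewrite mulr1.
  by rewrite mulr0 (dhomog_nemf_coeff hh) // k0 mdeg_eq0.
have B1 := skew_quot (jac_homog hh Q_homog R_homog) (fun g gG => jac_skew gG (hinv g gG) (Q_inv gG) (R_inv gG)).
have B2 := skew_quot (jac_homog P_homog hh R_homog) (fun g gG => jac_skew gG (P_inv gG) (hinv g gG) (R_inv gG)).
have B3 := skew_quot (jac_homog P_homog Q_homog hh) (fun g gG => jac_skew gG (P_inv gG) (Q_inv gG) (hinv g gG)).
have E : (c * k%:R) *: (S * h) = 2%:R *: (P * jac h Q R) + q%:R *: (Q * jac P h R) + (2 * m)%:R *: (R * jac P Q h).
  have D j : jac P Q R * h^`M(j) = jac h Q R * P^`M(j) + jac P h R * Q^`M(j) + jac P Q h * R^`M(j).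
    rewrite /jac !det_mx33 !mxE /=; case: j => -[|[|[|//]]] j3.
    + rewrite (_ : Ordinal j3 = 0); [ring|exact: val_inj].
    + rewrite (_ : Ordinal j3 = 1); [ring|exact: val_inj].
    + rewrite (_ : Ordinal j3 = 2%:R); [ring|exact: val_inj].
  transitivity (jac P Q R * (k%:R *: h)).
    by rewrite jacE -scalerAl -scalerAr scalerA.
  rewrite -(mpoly_euler hh) ![_ *: (_ * jac _ _ _)]scalerAl -(mpoly_euler P_homog) -(mpoly_euler Q_homog) -(mpoly_euler R_homog).
  rewrite big_distrr !big_distrl -!big_split /=; apply: eq_bigr => j _.
  rewrite mulrCA D; ring.
(* [jac h Q R] has degree k + 3m - 2, so its quotient by S has degree k - 2; the quotients of the
   other two minors have degrees k - q and k - 2m. These are the values of w below, all smaller than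
   k. *)
have rep d e f w (B : {mpoly K[3]}) : (0 < 2 * d + q * e + 2 * m * f <= k)%N ->
   (w = k - (2 * d + q * e + 2 * m * f))%N -> B \is w.-homog -> (forall g, g \in Gs -> mact g B = B) ->
   forall z, inv_rep k (z *: (P ^+ d * Q ^+ e * R ^+ f) * B).
  move=> /andP[w0 wk] wE hB iB z; rewrite -{1}(subnKC wk) -wE; apply: inv_repM; apply: IH => //.
  by rewrite -subn_gt0 wE subKn.
have fin (C1 C2 C3 : {mpoly K[3]}) : jac h Q R = S * C1 -> jac P h R = S * C2 -> jac P Q h = S * C3 ->
   inv_rep k (2%:R *: P * C1) -> inv_rep k (q%:R *: Q * C2) -> inv_rep k ((2 * m)%:R *: R * C3) -> inv_rep k h.
  move=> e1 e2 e3 r1 r2 r3.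
  have ck : c * k%:R != 0 by rewrite mulf_neq0 // pnatr_eq0 -lt0n.
  have -> : h = (c * k%:R)^-1 *: (P ^+ 0 * Q ^+ 0 * R ^+ 0) * (2%:R *: P * C1 + q%:R *: Q * C2 + (2 * m)%:R *: R * C3).
    apply: (mulfI S_neq0); apply: (scalerI ck); rewrite E e1 e2 e3 !expr0 !mulr1 -scalerAl mul1r -scalerAr scalerA mulfV // scale1r.
    rewrite -!scalerAl !mulrDr -!scalerAr; congr (_ *: _ + _ *: _ + _ *: _); ring.
  have := inv_repM (c * k%:R)^-1 0 0 0 (inv_repD (inv_repD r1 r2) r3).
  by rewrite !muln0.
have [C1 b1 r1] : exists2 C1, jac h Q R = S * C1 & inv_rep k (2%:R *: P * C1).
  case: B1 => [->|[C1 [b1 w1 h1 i1]]]; first by exists 0; rewrite mulr0 //; apply: inv_rep0.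
  exists C1 => //; have := rep 1%N 0%N 0%N _ C1 _ _ h1 i1 2%:R.
  by rewrite !expr0 expr1 !mulr1; apply; clear -k0 m_gt0 qE w1; lia.
have [C2 b2 r2] : exists2 C2, jac P h R = S * C2 & inv_rep k (q%:R *: Q * C2).
  case: B2 => [->|[C2 [b2 w2 h2 i2]]]; first by exists 0; rewrite mulr0 //; apply: inv_rep0.
  exists C2 => //; have := rep 0%N 1%N 0%N _ C2 _ _ h2 i2 q%:R.
  by rewrite !expr0 expr1 !mulr1 mul1r; apply; clear -k0 m_gt0 qE w2; lia.
have [C3 b3 r3] : exists2 C3, jac P Q h = S * C3 & inv_rep k ((2 * m)%:R *: R * C3).
  case: B3 => [->|[C3 [b3 w3 h3 i3]]]; first by exists 0; rewrite mulr0 //; apply: inv_rep0.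
  exists C3 => //; have := rep 0%N 0%N 1%N _ C3 _ _ h3 i3 (2 * m)%:R.
  by rewrite !expr0 expr1 !mul1r; apply; clear -k0 m_gt0 qE w3; lia.
exact: (fin C1 C2 C3).
Qed.

Lemma Gs_mul_perm g : g \in Gs -> perm_eq [seq h *m g | h <- Gs] Gs.
Proof.
move=> gG; have U : uniq [seq h *m g | h <- Gs].
  rewrite map_inj_in_uniq // => h h' _ _ e; have gu : g \in unitmx.
    by rewrite unitmxE unitfE; case: (Gs_det gG) => ->; rewrite ?oppr_eq0 oner_eq0.
  by rewrite -(mulmxK gu h) e mulmxK.
have [||_ e] := uniq_min_size U (s2 := Gs).
- by move=> _ /mapP [h hG ->]; apply: Gs_mul.
- by rewrite size_map.
- exact: uniq_perm.
Qed.

(* Splits an average over the rotations into a G-invariant and a G-skew part. *)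
Lemma rotation_sum_rep k f : f \is k.-homog ->
  exists2 s : seq (K * (nat * nat * nat * nat)),
    all (fun x => let: (_, (a, b, e, d)) := x in (2 * a + q * b + 2 * m * e + 3 * m * d == k)%N) s &
    \sum_(g <- Gs | \det g == 1) mact g f =
    \sum_(x <- s) (let: (z, (a, b, e, d)) := x in z *: (P ^+ a * Q ^+ b * R ^+ e * S ^+ d)).
Proof.
move=> hf; pose I := \sum_(g <- Gs) mact g f; pose D := \sum_(g <- Gs) \det g *: mact g f.
have hI : I \is k.-homog by rewrite rpred_sum // => g _; apply: dhomog_mact.
have hD : D \is k.-homog by rewrite rpred_sum // => g _; rewrite rpredZ ?dhomog_mact.
have [s ws sE] : inv_rep k I.
  apply: inv_chevalley => // g gG; rewrite /I /mact rmorph_sum /=.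
  rewrite -[RHS](perm_big _ (Gs_mul_perm gG)) big_map; apply: eq_bigr => h _.
  exact: mact_mact.
have -> : \sum_(g <- Gs | \det g == 1) mact g f = 2%:R^-1 *: (I + D).
  rewrite big_mkcond /I /D -big_split scaler_sumr /=; apply: eq_big_seq => g gG.
  have n2 : 2%:R != 0 :> K by rewrite pnatr_eq0.
  case: (Gs_det gG) => ->; last by rewrite eq_sym -subr_eq0 opprK -[1 + 1]/(2%:R) (negbTE n2) scaleN1r subrr scaler0.
  by rewrite eqxx scale1r -[X in X + X]scale1r -scalerDl scalerA mulVf ?scale1r.
have [|D0|[D' [DE mk hD' iD']]] := skew_quot hD.
- move=> g gG; rewrite /D /mact raddf_sum /= scaler_sumr.
  rewrite -[RHS](perm_big _ (Gs_mul_perm gG)) big_map; apply: eq_bigr => h _.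
  rewrite comp_mpolyZ -!/(mact _ _) mact_mact det_mulmx scalerA mulrCA.
  suff -> : \det g * \det g = 1 by rewrite mulr1.
  by case: (Gs_det gG) => ->; rewrite ?mulrNN mulr1.
- exists [seq (let: (z, (a, b, e)) := x in (2%:R^-1 * z, (a, b, e, 0%N))) | x <- s].
    by rewrite all_map; apply: sub_all ws => -[z [[a b] e]] /=; rewrite muln0 addn0.
  rewrite D0 addr0 sE big_map scaler_sumr; apply: eq_bigr => -[z [[a b] e]] _.
  by rewrite expr0 mulr1 scalerA.
have [s' ws' sE'] := inv_chevalley hD' iD'.
exists ([seq (let: (z, (a, b, e)) := x in (2%:R^-1 * z, (a, b, e, 0%N))) | x <- s] ++
        [seq (let: (z, (a, b, e)) := x in (2%:R^-1 * z, (a, b, e, 1%N))) | x <- s']).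
  rewrite all_cat !all_map; apply/andP; split.
    by apply: sub_all ws => -[z [[a b] e]] /=; rewrite muln0 addn0.
  by apply: sub_all ws' => -[z [[a b] e]] /= /eqP ->; rewrite muln1 subnK.
rewrite big_cat !big_map scalerDr; congr (_ + _).
  rewrite sE scaler_sumr; apply: eq_bigr => -[z [[a b] e]] _.
  by rewrite expr0 mulr1 scalerA.
rewrite DE sE' big_distrr scaler_sumr; apply: eq_bigr => -[z [[a b] e]] _.
by rewrite /= expr1 mulrC -scalerAl scalerA.
Qed.

End Invariants.

(* Invariants of the dihedral symmetry around the fivefold axis z: with
   rho = x^2 + y^2, c = Re (x + iy)^5 and e = Im (x + iy)^5, one has
   rho^5 = c^2 + e^2, and P, Q, R, S / e are polynomials in z, rho, c. *)
Definition re5 (A : comNzRingType) (x y : A) : A := x * (x ^+ 4 - 10 * x ^+ 2 * y ^+ 2 + 5 * y ^+ 4).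
Definition im5 (A : comNzRingType) (x y : A) : A := y * (5 * x ^+ 4 - 10 * x ^+ 2 * y ^+ 2 + y ^+ 4).
Definition icoQ (A : comNzRingType) (z rho c : A) : A :=
  z * (- 5 * z ^+ 3 * rho + 5 * z * rho ^+ 2 - 2 * c + z ^+ 5).
Definition icoR (A : comNzRingType) (z rho c : A) : A :=
  z ^+ 10 - 35 * z ^+ 8 * rho + 260 * z ^+ 6 * rho ^+ 2 - 175 * z ^+ 4 * rho ^+ 3
  + 25 * z ^+ 2 * rho ^+ 4 + 246 * z ^+ 5 * c - 180 * z ^+ 3 * rho * c + 30 * z * rho ^+ 2 * c + 4 * c ^+ 2.
Definition icoW (A : comNzRingType) (z rho c : A) : A :=
  - 256 * z ^+ 10 + 960 * z ^+ 8 * rho - 960 * z ^+ 6 * rho ^+ 2 + 300 * z ^+ 4 * rho ^+ 3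
  - 25 * z ^+ 2 * rho ^+ 4 - 176 * z ^+ 5 * c + 80 * z ^+ 3 * rho * c - 5 * z * rho ^+ 2 * c + c ^+ 2.

Lemma re5_im5 (A : comNzRingType) (x y : A) : im5 x y ^+ 2 = (x ^+ 2 + y ^+ 2) ^+ 5 - re5 x y ^+ 2.
Proof. rewrite /im5 /re5; ring. Qed.

Lemma icoQE (A : comNzRingType) (x y z : A) :
  invQ Icosahedron x y z = icoQ z (x ^+ 2 + y ^+ 2) (re5 x y).
Proof. rewrite /invQ /icoQ /re5; ring. Qed.

Lemma icoRE (A : comNzRingType) (x y z : A) :
  invR Icosahedron x y z = icoR z (x ^+ 2 + y ^+ 2) (re5 x y).
Proof. rewrite /invR /icoR /re5; ring. Qed.

Lemma icoSE (A : comNzRingType) (x y z : A) :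
  invS Icosahedron x y z = 8 * im5 x y * icoW z (x ^+ 2 + y ^+ 2) (re5 x y).
Proof. rewrite /invS /im5 -!mulrA; congr (_ * (_ * (_ * _))); rewrite /icoW /re5; ring. Qed.

(** For the icosahedron the identity of degree 30 is checked in z, rho and c, once the square of
    [im5] has been eliminated by [re5_im5]. This keeps the expansion small. *)
Lemma invS_sqr (A : comNzRingType) T (x y z : A) :
  invS T x y z ^+ 2 = relF T (invP x y z) (invQ T x y z) (invR T x y z).
Proof.
case: T; [rewrite /invS /relF /invP /invQ /invR; ring..|].
rewrite icoSE icoQE icoRE exprMn exprMn re5_im5 /invP.
move: (x ^+ 2 + y ^+ 2) (re5 x y) => rho c; rewrite /relF /icoQ /icoR /icoW; ring.
Qed.

(** * Degrees and Jacobian of the four polynomials *)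

Section PolyInvariants.
Variable K : numFieldType.
Implicit Type T : polyhedron.

Definition mP : {mpoly K[3]} := invP 'X_0 'X_1 'X_2.
Definition mQ T : {mpoly K[3]} := invQ T 'X_0 'X_1 'X_2.
Definition mR T : {mpoly K[3]} := invR T 'X_0 'X_1 'X_2.
Definition mS T : {mpoly K[3]} := invS T 'X_0 'X_1 'X_2.

Lemma invP_rmorph (A B : comNzRingType) (f : {rmorphism A -> B}) x y z :
  f (invP x y z) = invP (f x) (f y) (f z).
Proof. by rewrite /invP !rmorphD !rmorphXn. Qed.

Lemma invQ_rmorph (A B : comNzRingType) (f : {rmorphism A -> B}) T x y z :
  f (invQ T x y z) = invQ T (f x) (f y) (f z).
Proof. by case: T; rewrite /invQ ?(rmorph_nat, rmorphB, rmorphD, rmorphM, rmorphN, rmorphXn). Qed.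

Lemma invR_rmorph (A B : comNzRingType) (f : {rmorphism A -> B}) T x y z :
  f (invR T x y z) = invR T (f x) (f y) (f z).
Proof. by case: T; rewrite /invR ?(rmorph_nat, rmorphB, rmorphD, rmorphM, rmorphN, rmorphXn). Qed.

Lemma invS_rmorph (A B : comNzRingType) (f : {rmorphism A -> B}) T x y z :
  f (invS T x y z) = invS T (f x) (f y) (f z).
Proof. by case: T; rewrite /invS ?(rmorph_nat, rmorphB, rmorphD, rmorphM, rmorphN, rmorphXn). Qed.

Lemma aeval_mP u : aeval mP u = invP (u 0 0) (u 1 0) (u 2 0).
Proof. by rewrite /aeval /mP invP_rmorph /= !mevalXU. Qed.

Lemma aeval_mQ T u : aeval (mQ T) u = invQ T (u 0 0) (u 1 0) (u 2 0).
Proof. by rewrite /aeval /mQ invQ_rmorph /= !mevalXU. Qed.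

Lemma aeval_mR T u : aeval (mR T) u = invR T (u 0 0) (u 1 0) (u 2 0).
Proof. by rewrite /aeval /mR invR_rmorph /= !mevalXU. Qed.

Lemma aeval_mS T u : aeval (mS T) u = invS T (u 0 0) (u 1 0) (u 2 0).
Proof. by rewrite /aeval /mS invS_rmorph /= !mevalXU. Qed.

Lemma dhomog_nat n k : (k%:R : {mpoly K[n]}) \is 0.-homog.
Proof. by rewrite -mpolyC_nat -[k%:R%:MP]mulr1 mul_mpolyC rpredZ ?dhomog1. Qed.

Lemma dhomog_var n (i : 'I_n) : ('X_i : {mpoly K[n]}) \is 1.-homog.
Proof. by rewrite dhomogX; apply/eqP/mdeg1. Qed.

Lemma dhomogDD n (p p' : {mpoly K[n]}) d d' :
  p \is d.-homog -> p' \is d'.-homog -> d' = d -> p + p' \is d.-homog.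
Proof. by move=> hp hp' e; rewrite rpredD // -e. Qed.

Lemma dhomogNN n (p : {mpoly K[n]}) d : p \is d.-homog -> - p \is d.-homog.
Proof. by rewrite rpredN. Qed.

Lemma dhomog_cast n (p : {mpoly K[n]}) d d' : p \is d.-homog -> d = d' -> p \is d'.-homog.
Proof. by move=> h <-. Qed.

(** The degrees are existential variables, filled while descending through the expression and
    compared by computation at the end. *)
Ltac prove_homog := eapply dhomog_cast; [repeat lazymatch goal with
  | |- is_true (_ + _ \in _) => eapply dhomogDD
  | |- is_true (- _ \in _) => eapply dhomogNN
  | |- is_true (_ * _ \in _) => eapply dhomogM
  | |- is_true (_ ^+ _ \in _) => eapply dhomogMn
  | |- is_true (_%:R \in _) => eapply dhomog_nat
  | |- is_true ('X__ \in _) => eapply dhomog_var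
  end; reflexivity | reflexivity].

(** The number m for which P, Q, R, S have degrees 2, m + 1, 2m, 3m. It lets the three groups be
    treated uniformly; 3m is the number of mirrors. *)
Definition degm T : nat := match T with Tetrahedron => 2 | Octahedron => 3 | Icosahedron => 5 end.

Lemma mP_homog : mP \is 2.-homog.
Proof. rewrite /mP /invP; prove_homog. Qed.

Lemma mQ_homog T : mQ T \is (degm T).+1.-homog.
Proof. case: T; rewrite /mQ /=; prove_homog. Qed.

Lemma mR_homog T : mR T \is (2 * degm T).-homog.
Proof. case: T; rewrite /mR /=; prove_homog. Qed.

Lemma mS_homog T : mS T \is (3 * degm T).-homog.
Proof. case: T; rewrite /mS /=; prove_homog. Qed.

Lemma mderiv_exp n (p : {mpoly K[n]}) k i : (p ^+ k)^`M(i) = k%:R * p ^+ k.-1 * p^`M(i).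
Proof.
elim: k => [|k IH]; first by rewrite expr0 -mpolyC1 mderivC !mul0r.
rewrite exprS mderivM IH /=; case: k {IH} => [|k]; last by rewrite /= exprS -natr1; ring.
rewrite /=; ring.
Qed.

Lemma mderiv_var n (i j : 'I_n) : ('X_j : {mpoly K[n]})^`M(i) = (j == i)%:R.
Proof.
rewrite mderivX mnm1E; case: eqP => [->|_]; last by rewrite scale0r.
by rewrite scale1r subm_self mpolyX0.
Qed.

Lemma mderiv_nat n k (i : 'I_n) : (k%:R : {mpoly K[n]})^`M(i) = 0.
Proof. by rewrite -mpolyC_nat mderivC. Qed.

Definition jac_const T : K := match T with Tetrahedron => 4 | Octahedron => -8 | Icosahedron => -20 end.

Lemma jac_mPQR T : jac mP (mQ T) (mR T) = jac_const T *: mS T.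
Proof.
have cE (k : nat) (p : {mpoly K[3]}) : k%:R *: p = k%:R * p by rewrite scaler_nat mulr_natl.
have e0 : ((0 : 'I_3) == 1 = false) * ((0 : 'I_3) == 2 = false) * ((1 : 'I_3) == 0 = false)
  * ((1 : 'I_3) == 2 = false) * ((2 : 'I_3) == 0 = false) * ((2 : 'I_3) == 1 = false) by [].
have dE := (mderiv_var, mderiv_nat, mderiv_exp, mderivD, mderivN, mderivM, e0, eqxx).
case: T.
- rewrite /jac det_mx33 !mxE /= /mP /mQ /mR /mS /invP /invQ /invR /invS ?scaleNr ?cE !dE /=.
  set x := 'X_0; set y := 'X_1; set z := 'X_2; ring.
- rewrite /jac det_mx33 !mxE /= /mP /mQ /mR /mS /invP /invQ /invR /invS ?scaleNr ?cE !dE /=.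
  set x := 'X_0; set y := 'X_1; set z := 'X_2; ring.
rewrite /mP /mQ /mR /mS icoQE icoRE icoSE /invP /jac det_mx33 !mxE /= scaleNr cE.
have dr : (('X_0 ^+ 2 + 'X_1 ^+ 2 : {mpoly K[3]})^`M(0) = 2 * 'X_0) *
     (('X_0 ^+ 2 + 'X_1 ^+ 2 : {mpoly K[3]})^`M(1) = 2 * 'X_1) *
     (('X_0 ^+ 2 + 'X_1 ^+ 2 : {mpoly K[3]})^`M(2) = 0) by rewrite !dE /=; split; [split|]; ring.
have dc : ((re5 'X_0 'X_1 : {mpoly K[3]})^`M(0) = 5 * 'X_0 ^+ 4 - 30 * 'X_0 ^+ 2 * 'X_1 ^+ 2 + 5 * 'X_1 ^+ 4) *
     ((re5 'X_0 'X_1 : {mpoly K[3]})^`M(1) = - 20 * 'X_0 ^+ 3 * 'X_1 + 20 * 'X_0 * 'X_1 ^+ 3) *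
     ((re5 'X_0 'X_1 : {mpoly K[3]})^`M(2) = 0) by rewrite /re5 !dE /=; split; [split|]; ring.
set rho := ('X_0 ^+ 2 + 'X_1 ^+ 2) in dr *; set c := re5 'X_0 'X_1 in dc *.
(* Chain rule through (rho, c, z): the Jacobian of P, Q, R in these variables is 16 [icoW], that of
   rho and c in x and y is -10 [im5]. As S = 8 [im5] [icoW], the constant is -160 / 8 = -20. *)
transitivity ((rho^`M(0) * c^`M(1) - rho^`M(1) * c^`M(0)) * (16 * icoW 'X_2 rho c)).
  case: dr => _; case: dc => _; clearbody rho c => dc dr.
  have dQ i : (icoQ 'X_2 rho c)^`M(i) =
      (- 20 * 'X_2 ^+ 3 * rho + 10 * 'X_2 * rho ^+ 2 - 2 * c + 6 * 'X_2 ^+ 5) * (2 == i)%:R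
      + (- 5 * 'X_2 ^+ 4 + 10 * 'X_2 ^+ 2 * rho) * rho^`M(i) - 2 * 'X_2 * c^`M(i).
    rewrite /icoQ !dE /=; ring.
  have dR i : (icoR 'X_2 rho c)^`M(i) =
      (10 * 'X_2 ^+ 9 - 280 * 'X_2 ^+ 7 * rho + 1560 * 'X_2 ^+ 5 * rho ^+ 2
       - 700 * 'X_2 ^+ 3 * rho ^+ 3 + 50 * 'X_2 * rho ^+ 4 + 1230 * 'X_2 ^+ 4 * c
       - 540 * 'X_2 ^+ 2 * rho * c + 30 * rho ^+ 2 * c) * (2 == i)%:R
      + (- 35 * 'X_2 ^+ 8 + 520 * 'X_2 ^+ 6 * rho - 525 * 'X_2 ^+ 4 * rho ^+ 2
         + 100 * 'X_2 ^+ 2 * rho ^+ 3 - 180 * 'X_2 ^+ 3 * c + 60 * 'X_2 * rho * c) * rho^`M(i)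
      + (246 * 'X_2 ^+ 5 - 180 * 'X_2 ^+ 3 * rho + 30 * 'X_2 * rho ^+ 2 + 8 * c) * c^`M(i).
    rewrite /icoR !dE /=; ring.
  rewrite !dQ !dR !dE dr dc /icoW /=; set x := 'X_2; ring.
rewrite !dr !dc /im5; set x := 'X_0; set y := 'X_1; clearbody rho c; move: (icoW _ _ _) => W; ring.
Qed.

End PolyInvariants.

(** * Symmetries of the polyhedra *)

Section Vertices.
Variable R : realType.

Definition mx3 (A : nzRingType) (s : seq (seq A)) : 'M[A]_3 := \matrix_(i < 3, j < 3) (nth [::] s i)`_j.

Lemma mx3_col3 (A : nzRingType) (a b c d e f g h k x y z : A) :
  mx3 [:: [:: a; b; c]; [:: d; e; f]; [:: g; h; k]] *m col3 x y z =
  col3 (a * x + b * y + c * z) (d * x + e * y + f * z) (g * x + h * y + k * z).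
Proof.
apply/colP => i; rewrite mxE !big_ord_recl big_ord0 !mxE /= addr0 addrA.
by case: i => -[|[|[|]]].
Qed.

Lemma col3_eqE (A : nzRingType) (a b c d e f : A) :
  (col3 a b c == col3 d e f) = [&& a == d, b == e & c == f].
Proof.
apply/eqP/idP => [/colP H|/and3P[/eqP -> /eqP -> /eqP ->] //].
by move: (H 0) (H 1) (H 2); rewrite !mxE /= => -> -> ->; rewrite !eqxx.
Qed.

Lemma mx3_tr_mul (A : comNzRingType) (a b c d e f g h k : A) :
  let M := mx3 [:: [:: a; b; c]; [:: d; e; f]; [:: g; h; k]] in
  a * a + d * d + g * g = 1 -> b * b + e * e + h * h = 1 -> c * c + f * f + k * k = 1 ->
  a * b + d * e + g * h = 0 -> a * c + d * f + g * k = 0 -> b * c + e * f + h * k = 0 ->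
  M^T *m M = 1%:M.
Proof.
move=> M h1 h2 h3 h4 h5 h6; apply/matrixP => i j; rewrite mxE !big_ord_recl big_ord0 !mxE /= addr0 addrA.
case: i => -[|[|[|//]]] i3; case: j => -[|[|[|//]]] j3 //=.
- by rewrite [b * a]mulrC [e * d]mulrC [h * g]mulrC.
- by rewrite [c * a]mulrC [f * d]mulrC [k * g]mulrC.
- by rewrite [c * b]mulrC [f * e]mulrC [k * h]mulrC.
Qed.

(** The inverse of the golden ratio, (sqrt 5 - 1) / 2. Locking makes it an atom for the algebraic
    tactics, which only need the relations [alpha_sqr] and [beta_sqr]. *)
Definition alpha : R := locked (2 * cos (2 * pi / 5)).
Definition beta : R := locked (2 * sin (2 * pi / 5)).

Lemma theta_bounds : (0 < (2 * pi / 5 : R)) && (2 * pi / 5 < (pi / 2 : R)).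
Proof. by have := pi_gt0 R => p0; apply/andP; split; lra. Qed.

Lemma cos_2piB (x : R) : cos (2 * pi - x) = cos x.
Proof. by rewrite mulr_natl -cosN opprB -(cosD2pi (_ - _)) subrK. Qed.

Lemma sin_2piB (x : R) : sin (2 * pi - x) = - sin x.
Proof. by rewrite mulr_natl -sinN -(sinD2pi (- x)) addrC. Qed.

(** With t = 2 pi / 5, the equality cos (2t) = cos (3t) reads (c - 1)(4 c^2 + 2 c - 1) = 0 for c =
    cos t, and c = 1 is excluded by sin t > 0. *)
Lemma alpha_sqr : alpha ^+ 2 = 1 - alpha.
Proof.
rewrite /alpha -lock; have /andP[t0 t1] := theta_bounds; set t := 2 * pi / 5 in t0 t1 *.
have s0 : 0 < sin t by apply: sin_gt0_pi; have := pi_gt0 R; lra.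
have c1 : cos t != 1.
  by apply/eqP => c1; have := cos2Dsin2 t; rewrite c1 => e; nra.
have e : cos (t + t) = cos (t + t + t).
  have -> : t + t + t = 2 * pi - (t + t) by rewrite /t; field.
  by rewrite cos_2piB.
have := cos2Dsin2 t; move: e; rewrite !cosD !sinD => e1 e2.
have e3 : (cos t - 1) * (4 * cos t ^+ 2 + 2 * cos t - 1) = 0 by nra.
move/eqP: e3; rewrite mulf_eq0 subr_eq0 (negbTE c1) /= => /eqP; lra.
Qed.

Lemma alpha_gt0 : 0 < alpha.
Proof. by rewrite /alpha -lock mulr_gt0 // cos_gt0_pihalf //; have /andP[? ?] := theta_bounds; have := pi_gt0 R; lra. Qed.

Lemma beta_gt0 : 0 < beta.
Proof. by rewrite /beta -lock mulr_gt0 // sin_gt0_pi //; have /andP[? ?] := theta_bounds; have := pi_gt0 R; lra. Qed.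

Lemma beta_sqr : beta ^+ 2 = 3 + alpha.
Proof.
have := alpha_sqr; have := cos2Dsin2 (2 * pi / 5 : R); rewrite /beta /alpha -!lock; lra.
Qed.

Lemma sqrt5E : Num.sqrt 5 = 2 * alpha + 1 :> R.
Proof.
have -> : 5 = (2 * alpha + 1) ^+ 2 by have := alpha_sqr; lra.
by rewrite sqrtr_sqr ger0_norm //; have := alpha_gt0; lra.
Qed.

(** The trigonometric vertices rewritten algebraically: 2 cos (4 pi / 5) = -1 - alpha and 2 sin (4
    pi / 5) = alpha beta, while k = 3, 4 are the mirror images of k = 2, 1. *)
Definition ico_half : seq 'cV[R]_3 :=
  [:: col3 0 0 (2 * alpha + 1); col3 2 0 (-1); col3 alpha beta (-1);
      col3 (-1 - alpha) (alpha * beta) (-1); col3 (-1 - alpha) (- (alpha * beta)) (-1);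
      col3 alpha (- beta) (-1)].

Definition ico_half_opp : seq 'cV[R]_3 :=
  [:: col3 0 0 (- (2 * alpha + 1)); col3 (-2) 0 1; col3 (- alpha) (- beta) 1;
      col3 (1 + alpha) (- (alpha * beta)) 1; col3 (1 + alpha) (alpha * beta) 1;
      col3 (- alpha) beta 1].

Lemma col3N (A : nzRingType) (a b c : A) : - col3 a b c = col3 (- a) (- b) (- c).
Proof. by apply/colP => -[[|[|[|]]]] // i3; rewrite !mxE. Qed.

Lemma ico_half_oppE : [seq - v | v <- ico_half] = ico_half_opp.
Proof.
rewrite /ico_half /ico_half_opp /= !col3N.
rewrite oppr0 opprB opprK [alpha + 1]addrC.
by rewrite !opprK.
Qed.

Lemma vertices_ico : vertices R Icosahedron = ico_half ++ ico_half_opp.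
Proof.
pose t : R := 2 * pi / 5.
have ca : cos t = alpha / 2 by rewrite /alpha -lock; field.
have sa : sin t = beta / 2 by rewrite /beta -lock; field.
have c2 : cos (t + t) = (-1 - alpha) / 2.
  by rewrite cosD ca sa; have := alpha_sqr; have := beta_sqr; lra.
have s2 : sin (t + t) = alpha * beta / 2 by rewrite sinD ca sa; field.
have -> : vertices R Icosahedron = ico_half ++ [seq - v | v <- ico_half].
  rewrite /vertices sqrt5E /=.
  have -> : 2 * 0 * pi / 5 = 0 :> R by field.
  have -> : 2 * 1 * pi / 5 = t by rewrite /t; field.
  have -> : 2 * 2 * pi / 5 = t + t by rewrite /t; field.
  have -> : 2 * 3 * pi / 5 = 2 * pi - (t + t) by rewrite /t; field.
  have -> : 2 * 4 * pi / 5 = 2 * pi - t by rewrite /t; field.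
  have h2 (x : R) : 2 * (x / 2) = x by field.
  by rewrite !cos_2piB !sin_2piB cos0 sin0 ca sa c2 s2 !mulrN !h2 mulr1 mulr0.
by rewrite ico_half_oppE.
Qed.

(** [symmetry_group] only says that the set of vertices is preserved. Without repetitions in the
    list, a symmetry permutes it and leaves sums over it unchanged. *)
Lemma vertices_uniq T : uniq (vertices R T).
Proof.
case: T; last first.
  rewrite vertices_ico; have a0 := alpha_gt0; have b0 := beta_gt0.
  have ab0 : 0 < alpha * beta by rewrite mulr_gt0.
  rewrite /ico_half /ico_half_opp; move: (alpha * beta) ab0 => g g0.
  rewrite /= !inE !negb_or !col3_eqE.
  by repeat (apply/andP; split => //); apply/negP => /and3P[/eqP h1 /eqP h2 /eqP h3]; lra.
all: rewrite /= !inE !negb_or !col3_eqE.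
all: by repeat (apply/andP; split => //); apply/negP => /and3P[/eqP h1 /eqP h2 /eqP h3]; lra.
Qed.

(** The vertices span the space, so a symmetry is determined by its values on them; this yields the
    finiteness of the group. The proof writes the standard basis as combinations of vertices. *)
Lemma vertices_span T (M : 'M[R]_3) : {in vertices R T, forall v, M *m v = 0} -> M = 0.
Proof.
move=> H; suff E : [/\ M *m col3 1 0 0 = 0, M *m col3 0 1 0 = 0 & M *m col3 0 0 1 = 0].
  apply/matrixP => i j; case: E => /colP/(_ i) + /colP/(_ i) + /colP/(_ i).
  rewrite !mxE !big_ord_recl !big_ord0 !mxE /= !(mulr0, mulr1, addr0, add0r).
  case: j => -[|[|[|//]]] j3 e1 e2 e3; [rewrite -e1|rewrite -e2|rewrite -e3]; congr (M _ _); exact: val_inj.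
have L (s : seq (R * 'cV[R]_3)) : all (fun x => x.2 \in vertices R T) s -> M *m (\sum_(x <- s) x.1 *: x.2) = 0.
  by move=> /allP sV; rewrite mulmx_sumr big1_seq // => x /sV /H e; rewrite -scalemxAr e scaler0.
have eqc (a b c d e f : R) : a = d -> b = e -> c = f -> col3 a b c = col3 d e f by move=> -> -> ->.
have Z (c : R) (a b e : R) : c *: col3 a b e = col3 (c * a) (c * b) (c * e).
  by apply/colP => -[[|[|[|]]]] // i3; rewrite !mxE.
have D (a b c d e f : R) : col3 a b c + col3 d e f = col3 (a + d) (b + e) (c + f).
  by apply/colP => -[[|[|[|]]]] // i3; rewrite !mxE.
case: T H L => H L.
- split.
  + have := L [:: (2^-1, col3 1 1 1); (2^-1, col3 1 (-1) (-1))]; rewrite !big_cons big_nil addr0 /= !Z D !inE !eqxx /= ?orbT => /(_ isT) <-.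
    by congr (M *m _); apply: eqc; field.
  + have := L [:: (2^-1, col3 1 1 1); (2^-1, col3 (-1) 1 (-1))]; rewrite !big_cons big_nil addr0 /= !Z D !inE !eqxx /= ?orbT => /(_ isT) <-.
    by congr (M *m _); apply: eqc; field.
  + have := L [:: (2^-1, col3 1 1 1); (2^-1, col3 (-1) (-1) 1)]; rewrite !big_cons big_nil addr0 /= !Z D !inE !eqxx /= ?orbT => /(_ isT) <-.
    by congr (M *m _); apply: eqc; field.
- by split; apply: H; rewrite !inE eqxx ?orbT.
- have a0 := alpha_gt0; have b0 := beta_gt0; have Ve := vertices_ico; rewrite Ve in H L.
  have e3 : M *m col3 0 0 1 = 0.
    have := L [:: ((2 * alpha + 1)^-1, col3 0 0 (2 * alpha + 1))]; rewrite !big_cons big_nil addr0 /= !Z !inE !eqxx /= ?orbT => /(_ isT) <-.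
    by congr (M *m _); apply: eqc; field; lra.
  have e1 : M *m col3 1 0 0 = 0.
    have := L [:: (2^-1, col3 2 0 (-1)); ((2 * (2 * alpha + 1))^-1, col3 0 0 (2 * alpha + 1))]; rewrite !big_cons big_nil addr0 /= !Z D !inE !eqxx /= ?orbT => /(_ isT) <-.
    by congr (M *m _); apply: eqc; field; lra.
  split=> //.
  have := H (col3 alpha beta (-1)); rewrite !inE !eqxx /= ?orbT => /(_ isT).
  have -> : col3 alpha beta (-1) = alpha *: col3 1 0 0 + beta *: col3 0 1 0 + (-1) *: col3 0 0 1.
    by rewrite !Z !D; apply: eqc; ring.
  rewrite !mulmxDr -!scalemxAr e1 e3 !scaler0 addr0 add0r => /eqP.
  by rewrite scaler_eq0 gt_eqF //= => /eqP.
Qed.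

End Vertices.

(** * The symmetry group: finiteness, and invariance of P, Q, R *)

Section SymmetryGroup.
Variable R : realType.
Implicit Type T : polyhedron.
Local Notation K := R[i].
Local Notation rc := (real_complex R).
Local Notation G T := (@symmetry_group R T).

Lemma sym_mul T g h : G T g -> G T h -> G T (g *m h).
Proof.
move=> [og vg] [oh vh]; split.
  by rewrite trmx_mul -mulmxA [g^T *m _]mulmxA og mul1mx oh.
move=> u; rewrite (eq_map (fun v => esym (mulmxA g h v))) (map_comp (mulmx g) (mulmx h)).
by rewrite (eq_mem_map (mulmx g) vh) vg.
Qed.

Lemma sym_orth T g : G T g -> g *m g^T = 1%:M.
Proof. by case=> og _; apply: mulmx1C. Qed.

Lemma sym_tr T g : G T g -> G T g^T.
Proof.
move=> gG; have og' := sym_orth gG; case: gG => og vg; split; first by rewrite trmxK.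
move=> u; apply/mapP/idP => [[v vV ->]|uV].
  have /mapP [w wV ->] : v \in [seq g *m v | v <- vertices R T] by rewrite vg.
  by rewrite mulmxA og mul1mx.
exists (g *m u); last by rewrite mulmxA og mul1mx.
by rewrite -vg map_f.
Qed.

Lemma sym_det T g : G T g -> \det g = 1 \/ \det g = -1.
Proof.
case=> og _; have := congr1 determinant og; rewrite det_mulmx det_tr det1 -expr2 => /eqP.
by rewrite sqrf_eq1 => /orP[] /eqP; [left|right].
Qed.

Lemma sym_1 T : G T 1%:M.
Proof.
split; first by rewrite trmx1 mulmx1.
by move=> u; rewrite (eq_map (@mul1mx _ _ _)) map_id.
Qed.

(** A symmetry is determined by the map that it induces on the indices of the vertices. For each
    such map, [pick] chooses a symmetry inducing it if there is one, and uniqueness shows that none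
    is missed. *)
Lemma sym_finite T : exists2 Gs : seq 'M[R]_3, uniq Gs & forall g, g \in Gs <-> G T g.
Proof.
pose V := vertices R T; pose v (i : 'I_(size V)) := V`_i.
pose pick (f : {ffun 'I_(size V) -> 'I_(size V)}) : option 'M[R]_3 :=
  if pselect (exists g, G T g /\ forall i, g *m v i = v (f i)) is left p then Some (projT1 (cid p)) else None.
exists (undup (pmap pick (enum {ffun 'I_(size V) -> 'I_(size V)}))); first exact: undup_uniq.
move=> g; rewrite mem_undup mem_pmap; split.
  move=> /mapP [f _]; rewrite /pick; case: pselect => // p [->].
  by case: (cid p) => g' [].
move=> gG; have gV i : g *m v i \in V.
  by case: gG => _ <-; rewrite map_f // mem_nth.
have lt_i i : (index (g *m v i) V < size V)%N by rewrite index_mem.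
apply/mapP; exists [ffun i => Ordinal (lt_i i)]; first by rewrite mem_enum.
rewrite /pick; case: pselect => [p|[]]; last first.
  by exists g; split=> // i; rewrite ffunE /v /= nth_index ?gV.
case: (cid p) => g' [g'G] /= H; congr Some; apply/eqP; rewrite -subr_eq0; apply/eqP.
apply: (@vertices_span R T) => w wV; rewrite mulmxBl.
have lt_w : (index w V < size V)%N by rewrite index_mem.
have -> : w = v (Ordinal lt_w) by rewrite /v /= nth_index.
have vf i : v (Ordinal (lt_i i)) = g *m v i by rewrite {1}/v /= nth_index // gV.
by rewrite H ffunE vf subrr.
Qed.

Definition lin (v : 'cV[R]_3) (u : 'cV[K]_3) : K := ((map_mx rc v)^T *m u) 0 0.
(** These sums are invariant under all symmetries at once. In the degrees of Q and R they determine
    Q and R in terms of P. *)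
Definition psum T k (u : 'cV[K]_3) : K := \sum_(v <- vertices R T) lin v u ^+ k.

Lemma lin_col3 (a b c : R) u : lin (col3 a b c) u = rc a * u 0 0 + rc b * u 1 0 + rc c * u 2 0.
Proof.
rewrite /lin mxE !big_ord_recl big_ord0 !mxE /= addr0 addrA.
by congr (_ + _ + _); congr (_ * u _ _); apply: val_inj.
Qed.

Lemma map_orth T g : G T g -> (map_mx rc g)^T *m map_mx rc g = 1%:M.
Proof. by case=> og _; rewrite map_trmx -map_mxM og map_mx1. Qed.

(** Orthogonality gives [lin (g *m v) (g *m u) = lin v u], and g permutes the vertices. *)
Lemma psum_inv T k g u : G T g -> psum T k (map_mx rc g *m u) = psum T k u.
Proof.
move=> gG; have og := map_orth gG; case: (gG) => og' vg.
have P : perm_eq [seq g *m v | v <- vertices R T] (vertices R T).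
  apply: uniq_perm => //; rewrite ?vertices_uniq // map_inj_uniq ?vertices_uniq //.
  by move=> x y e; rewrite -[x]mul1mx -og' -mulmxA e mulmxA og' mul1mx.
rewrite /psum -(perm_big _ P) big_map; apply: eq_bigr => v _; congr (_ ^+ _).
by rewrite /lin map_mxM trmx_mul -mulmxA (mulmxA (_ ^T) _ u) og mul1mx.
Qed.

Lemma invP_inv T g (u u' : 'cV[K]_3) : G T g -> u' = map_mx rc g *m u ->
  invP (u' 0 0) (u' 1 0) (u' 2 0) = invP (u 0 0) (u 1 0) (u 2 0).
Proof.
have E (w : 'cV[K]_3) : invP (w 0 0) (w 1 0) (w 2 0) = (w^T *m w) 0 0.
  rewrite mxE !big_ord_recl big_ord0 !mxE /= addr0 addrA /invP !expr2.
  by congr (_ + _ + _); congr (w _ _ * w _ _); apply: val_inj.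
move=> gG ->; rewrite !E trmx_mul -mulmxA (mulmxA (_ ^T) _ u) (map_orth gG) mul1mx //.
Qed.

Lemma psum_tetra (u : 'cV[K]_3) : let x := u 0 0 in let y := u 1 0 in let z := u 2 0 in
  psum Tetrahedron 3 u = 24 * invQ Tetrahedron x y z /\
  psum Tetrahedron 4 u = 4 * invP x y z ^+ 2 + 16 * invR Tetrahedron x y z.
Proof.
move=> x y z; rewrite /psum /vertices !big_cons !big_nil !lin_col3 !rmorphN !rmorph1 /invP /invQ /invR -/x -/y -/z.
by split; ring.
Qed.

Lemma psum_octa (u : 'cV[K]_3) : let x := u 0 0 in let y := u 1 0 in let z := u 2 0 in
  psum Octahedron 4 u = 2 * invP x y z ^+ 2 - 4 * invQ Octahedron x y z /\
  psum Octahedron 6 u = 2 * invP x y z ^+ 3 - 6 * invP x y z * invQ Octahedron x y z + 6 * invR Octahedron x y z.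
Proof.
move=> x y z; rewrite /psum /vertices !big_cons !big_nil !lin_col3 !rmorphN !rmorph1 !rmorph0 /invP /invQ /invR -/x -/y -/z.
by split; ring.
Qed.

Lemma lin_opp v u k : lin (- v) u ^+ (2 * k) = lin v u ^+ (2 * k).
Proof.
suff -> : lin (- v) u = - lin v u by rewrite !exprM sqrrN.
by rewrite /lin map_mxN linearN /= mulNmx mxE.
Qed.

Lemma psum_ico (u : 'cV[K]_3) : let x := u 0 0 in let y := u 1 0 in let z := u 2 0 in
  psum Icosahedron 6 u = 200 * invP x y z ^+ 3 + 60 * invQ Icosahedron x y z /\
  psum Icosahedron 10 u = 2500 * invP x y z ^+ 5 + 3750 * invP x y z ^+ 2 * invQ Icosahedron x y z
     + 10 * invR Icosahedron x y z.
Proof.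
(* Opposite vertices contribute equally to sums of even powers, so half of them suffice. *)
move=> x0 y0 z0; have E k : psum Icosahedron (2 * k) u = 2 * \sum_(v <- ico_half R) lin v u ^+ (2 * k).
  rewrite /psum (_ : vertices R Icosahedron = ico_half R ++ [seq - v | v <- ico_half R]).
    rewrite big_cat big_map mulr_natl mulr2n; congr (_ + _); apply: eq_bigr => v _; exact: lin_opp.
  by rewrite vertices_ico ico_half_oppE.
rewrite (E 3%N) (E 5%N) /ico_half !big_cons !big_nil !lin_col3 -/x0 -/y0 -/z0 icoQE icoRE.
have := alpha_sqr R; have := beta_sqr R.
move: (alpha R) (beta R) x0 y0 z0 => al be x y z /(congr1 rc) Hb /(congr1 rc) Ha.
move: Ha Hb; rewrite !(rmorphXn, rmorphN, rmorphB, rmorphD, rmorphM, rmorph1, rmorph0, rmorph_nat) /=.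
move: (rc al) (rc be) => a b Ha Hb; rewrite /invP /re5 /icoQ /icoR.
split.
  by ring: Ha Hb.
by ring: Ha Hb.
Qed.

(** P is invariant by orthogonality. The power sums of degree deg Q and deg R are polynomials in P,
    Q, R in which Q, respectively R, has a nonzero constant as coefficient, so the invariance passes
    to Q and then to R. *)
Lemma mact_invariants T g : G T g ->
  [/\ mact (map_mx rc g) (mP _) = mP _, mact (map_mx rc g) (mQ _ T) = mQ _ T & mact (map_mx rc g) (mR _ T) = mR _ T].
Proof.
move=> gG.
suff H (u : 'cV[K]_3) (u' := map_mx rc g *m u) : [/\ invP (u' 0 0) (u' 1 0) (u' 2 0) = invP (u 0 0) (u 1 0) (u 2 0),
   invQ T (u' 0 0) (u' 1 0) (u' 2 0) = invQ T (u 0 0) (u 1 0) (u 2 0) &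
   invR T (u' 0 0) (u' 1 0) (u' 2 0) = invR T (u 0 0) (u 1 0) (u 2 0)].
  split; apply: mpoly_eqfun => u; rewrite aeval_mact; have [hP hQ hR] := H u.
  - by rewrite !aeval_mP.
  - by rewrite !aeval_mQ.
  - by rewrite !aeval_mR.
have p := invP_inv gG (erefl u'); have ps k : psum T k u' = psum T k u := psum_inv k u gG.
have n0 k : k.+1%:R != 0 :> K by rewrite pnatr_eq0.
split=> //; case: T gG p ps => gG p ps.
- have := ps 3%N; rewrite (psum_tetra u).1 (psum_tetra u').1; exact: mulfI.
- have := ps 4%N; rewrite (psum_octa u).1 (psum_octa u').1 p => /addrI/oppr_inj; exact: mulfI.
- have := ps 6%N; rewrite (psum_ico u).1 (psum_ico u').1 p => /addrI; exact: mulfI.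
- have := ps 4%N; rewrite (psum_tetra u).2 (psum_tetra u').2 p => /addrI; exact: mulfI.
- have q : invQ Octahedron (u' 0 0) (u' 1 0) (u' 2 0) = invQ Octahedron (u 0 0) (u 1 0) (u 2 0).
    have := ps 4%N; rewrite (psum_octa u).1 (psum_octa u').1 p => /addrI/oppr_inj; exact: mulfI.
  have := ps 6%N; rewrite (psum_octa u).2 (psum_octa u').2 p q => /addrI; exact: mulfI.
- have q : invQ Icosahedron (u' 0 0) (u' 1 0) (u' 2 0) = invQ Icosahedron (u 0 0) (u 1 0) (u 2 0).
    have := ps 6%N; rewrite (psum_ico u).1 (psum_ico u').1 p => /addrI; exact: mulfI.
  have := ps 10%N; rewrite (psum_ico u).2 (psum_ico u').2 p q => /addrI; exact: mulfI.
Qed.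

End SymmetryGroup.

Lemma col3E (K : nzRingType) (u : 'cV[K]_3) : u = col3 (u 0 0) (u 1 0) (u 2 0).
Proof.
by apply/colP => i; rewrite mxE; case: i => -[|[|[|//]]] i3 /=; congr (u _ _); apply: val_inj.
Qed.

Lemma col3Z (K : nzRingType) (a : K) (u : 'cV[K]_3) : a *: u = col3 (a * u 0 0) (a * u 1 0) (a * u 2 0).
Proof. by rewrite [LHS]col3E !mxE. Qed.

Lemma mevalXn (K : fieldType) n (v : 'I_n -> K) (p : {mpoly K[n]}) k : (p ^+ k).@[v] = p.@[v] ^+ k.
Proof. by rewrite rmorphXn. Qed.

(** * Factorisation of S into the linear forms of the mirrors *)

Section Forms.
Variable K : numFieldType.

Lemma lform_col3 (a b c : K) : lform (col3 a b c) = a%:MP * 'X_0 + b%:MP * 'X_1 + c%:MP * 'X_2.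
Proof.
rewrite /lform !big_ord_recl big_ord0 !mxE /= addr0 addrA !mul_mpolyC.
by congr (_ *: 'X__ + _ *: 'X__ + _ *: 'X__); apply: val_inj.
Qed.

Lemma aeval_lform_col3 (a b c : K) (u : 'cV[K]_3) :
  aeval (lform (col3 a b c)) u = a * u 0 0 + b * u 1 0 + c * u 2 0.
Proof. by rewrite lform_col3 /aeval !mevalD !mevalM !mevalC !mevalXU. Qed.

Lemma mderiv_lform (a : 'cV[K]_3) j : (lform a)^`M(j) = (a j 0)%:MP.
Proof.
rewrite /lform raddf_sum (bigD1 j) //= mderivZ mderiv_var eqxx big1; last first.
  by move=> i ij; rewrite mderivZ mderiv_var (negbTE ij) scaler0.
by rewrite addr0 -mul_mpolyC mulr1.
Qed.

Lemma col3_congr (A : nzRingType) (a b c d e f : A) : a = d -> b = e -> c = f -> col3 a b c = col3 d e f.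
Proof. by move=> -> -> ->. Qed.

Lemma det_mx3 (A : comNzRingType) (a b c d e f g h k : A) :
  \det (mx3 [:: [:: a; b; c]; [:: d; e; f]; [:: g; h; k]]) =
  a * (e * k - f * h) - b * (d * k - f * g) + c * (d * h - e * g).
Proof. by rewrite det_mx33 !mxE. Qed.

(** Normals of the mirrors, with the signs that arise when one normal is moved around by the
    matrices of [simple_mirror_forms]; hence the factor -1 in [mS_forms]. The icosahedral normals
    form three orbits of the rotation by 2 pi / 5. *)
Definition mirror_forms (a b : K) T : seq 'cV[K]_3 :=
  let diag := [:: col3 1 (-1) 0; col3 (-1) (-1) 0; col3 0 1 (-1); col3 0 (-1) (-1); col3 (-1) 0 1; col3 (-1) 0 (-1)] in
  let ico c := [:: col3 2 0 c; col3 a (- b) c; col3 (-1 - a) (- (a * b)) c; col3 (-1 - a) (a * b) c; col3 a b c] in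
  match T with
  | Tetrahedron => diag
  | Octahedron => [:: col3 1 0 0; col3 0 1 0; col3 0 0 1] ++ diag
  | Icosahedron => [:: col3 0 2 0; col3 b a 0; col3 (a * b) (-1 - a) 0; col3 (- (a * b)) (-1 - a) 0; col3 (- b) a 0]
                   ++ ico (-2 - 2 * a) ++ ico (2 * a)
  end.

Lemma aeval_lforms (s : seq 'cV[K]_3) u : aeval (\prod_(b <- s) lform b) u = \prod_(b <- s) aeval (lform b) u.
Proof. by rewrite /aeval rmorph_prod. Qed.

(** The right side has the literal shape in which the product over [mirror_forms] unfolds. *)
Lemma tetra_factors (A : comNzRingType) (x y z : A) : invS Tetrahedron x y z =
  -1 * ((1 * x + -1 * y + 0 * z) * ((-1 * x + -1 * y + 0 * z) * ((0 * x + 1 * y + -1 * z) *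
  ((0 * x + -1 * y + -1 * z) * ((-1 * x + 0 * y + 1 * z) * ((-1 * x + 0 * y + -1 * z) * 1)))))).
Proof. rewrite /invS; ring. Qed.

Lemma octa_factors (A : comNzRingType) (x y z : A) : invS Octahedron x y z =
  -1 * ((1 * x + 0 * y + 0 * z) * ((0 * x + 1 * y + 0 * z) * ((0 * x + 0 * y + 1 * z) *
  ((1 * x + -1 * y + 0 * z) * ((-1 * x + -1 * y + 0 * z) * ((0 * x + 1 * y + -1 * z) *
  ((0 * x + -1 * y + -1 * z) * ((-1 * x + 0 * y + 1 * z) * ((-1 * x + 0 * y + -1 * z) * 1))))))))).
Proof. rewrite /invS; ring. Qed.

Lemma mS_forms (a b : K) T : a ^+ 2 = 1 - a -> b ^+ 2 = 3 + a ->
  mS K T = (if T is Icosahedron then 1 else -1) *: \prod_(v <- mirror_forms a b T) lform v.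
Proof.
move=> Ha Hb; apply: mpoly_eqfun => u; rewrite aeval_mS [RHS]mevalZ -/(aeval _ _) aeval_lforms; case: T.
- by rewrite /mirror_forms !big_cons big_nil !aeval_lform_col3 tetra_factors.
- by rewrite /mirror_forms !big_cons big_nil !aeval_lform_col3 octa_factors.
rewrite icoSE /mirror_forms; move: (u 0 0) (u 1 0) (u 2 0) (fun a b c => aeval_lform_col3 a b c u) => x y z E.
(* Half the product of the five forms obtained by rotating 2x + 2gz about the z axis: the
   homogenised Chebyshev polynomial 16 X^5 - 20 X^3 + 5 X at X = g z, plus [re5]. The values g = a
   and g = -1 - a are the roots of X^2 + X - 1. *)
pose D (g : K) := 16 * g ^+ 5 * z ^+ 5 - 20 * g ^+ 3 * z ^+ 3 * (x ^+ 2 + y ^+ 2) + 5 * g * z * (x ^+ 2 + y ^+ 2) ^+ 2 + re5 x y.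
have H0 : \prod_(v <- [:: col3 0 2 0; col3 b a 0; col3 (a * b) (-1 - a) 0; col3 (- (a * b)) (-1 - a) 0; col3 (- b) a 0])
      aeval (lform v) u = 2 * im5 x y.
  rewrite !big_cons big_nil !E /im5; ring: Ha Hb.
have H1 g : \prod_(v <- [:: col3 2 0 (2 * g); col3 a (- b) (2 * g); col3 (-1 - a) (- (a * b)) (2 * g); col3 (-1 - a) (a * b) (2 * g); col3 a b (2 * g)])
      aeval (lform v) u = 2 * D g.
  rewrite !big_cons big_nil !E /D /re5; ring: Ha Hb.
have W : D (-1 - a) * D a = icoW z (x ^+ 2 + y ^+ 2) (re5 x y).
  rewrite /D /icoW; move: (x ^+ 2 + y ^+ 2) (re5 x y) => rho c; ring: Ha.
have -> : -2 - 2 * a = 2 * (-1 - a) by ring.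
transitivity ((2 * im5 x y) * ((2 * D (-1 - a)) * (2 * D a))); first by rewrite -W; ring.
rewrite -H0 -(H1 a) -(H1 (-1 - a)) mul1r /= !big_cons !big_nil !mulr1.
by rewrite -!mulrA.
Qed.

Lemma meval_natr (v : 'I_3 -> K) k : (k%:R : {mpoly K[3]}).@[v] = k%:R.
Proof. by rewrite rmorph_nat. Qed.

(** One such factorisation is given for each orbit of mirrors: the cofactor is nonzero at a point of
    the mirror, so S vanishes there to first order only. The group carries this to the other
    mirrors. *)
Lemma mS_base_T : exists2 r, mS K Tetrahedron = lform (col3 1 (-1) 0) * r & aeval r (col3 1 1 0) != 0.
Proof.
exists (('X_0 + 'X_1) * ('X_1 ^+ 2 - 'X_2 ^+ 2) * ('X_2 ^+ 2 - 'X_0 ^+ 2)).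
  rewrite /mS /invS lform_col3 rmorphN rmorph1 rmorph0; ring.
rewrite /aeval !(mevalB, mevalD, mevalM, mevalXn, mevalXU) !mxE /=.
by rewrite (_ : _ * _ = - 2%:R) ?oppr_eq0 ?pnatr_eq0 //; ring.
Qed.

Lemma mS_base_O1 : exists2 r, mS K Octahedron = lform (col3 1 0 0) * r & aeval r (col3 0 1 2) != 0.
Proof.
exists ('X_1 * 'X_2 * ('X_0 ^+ 2 - 'X_1 ^+ 2) * ('X_1 ^+ 2 - 'X_2 ^+ 2) * ('X_2 ^+ 2 - 'X_0 ^+ 2)).
  rewrite /mS /invS lform_col3 rmorph1 rmorph0; ring.
rewrite /aeval !(mevalB, mevalD, mevalM, mevalXn, mevalXU) !mxE /=.
by rewrite (_ : _ * _ = 24%:R) ?pnatr_eq0 //; ring.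
Qed.

Lemma mS_base_O2 : exists2 r, mS K Octahedron = lform (col3 1 (-1) 0) * r & aeval r (col3 1 1 2) != 0.
Proof.
exists ('X_0 * 'X_1 * 'X_2 * ('X_0 + 'X_1) * ('X_1 ^+ 2 - 'X_2 ^+ 2) * ('X_2 ^+ 2 - 'X_0 ^+ 2)).
  rewrite /mS /invS lform_col3 rmorphN rmorph1 rmorph0; ring.
rewrite /aeval !(mevalB, mevalD, mevalM, mevalXn, mevalXU) !mxE /=.
by rewrite (_ : _ * _ = - 36%:R) ?oppr_eq0 ?pnatr_eq0 //; ring.
Qed.

Lemma mS_base_I : exists2 r, mS K Icosahedron = lform (col3 0 2 0) * r & aeval r (col3 1 0 0) != 0.
Proof.
exists (4 * (5 * 'X_0 ^+ 4 - 10 * 'X_0 ^+ 2 * 'X_1 ^+ 2 + 'X_1 ^+ 4) * icoW 'X_2 ('X_0 ^+ 2 + 'X_1 ^+ 2) (re5 'X_0 'X_1)).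
  rewrite /mS icoSE /im5 lform_col3 rmorph_nat rmorph0; move: (icoW _ _ _) => W; ring.
have mW p1 p2 p3 : (icoW p1 p2 p3).@[(col3 (1 : K) 0 0)^~ 0] =
    icoW p1.@[(col3 1 0 0)^~ 0] p2.@[(col3 1 0 0)^~ 0] p3.@[(col3 1 0 0)^~ 0].
  by rewrite /icoW !(meval_natr, mevalXn, mevalB, mevalD, mevalM, mevalN).
rewrite /aeval !mevalM mW /re5 !(mevalXU, meval_natr, mevalXn, mevalB, mevalD, mevalM, mevalN) !mxE /= /icoW.
by rewrite (_ : _ * _ = 20%:R) ?pnatr_eq0 //; ring.
Qed.

End Forms.

Lemma forall_nil (A : eqType) (Q : A -> Prop) x : x \in [::] -> Q x.
Proof. by []. Qed.

Lemma forall_cons (A : eqType) (Q : A -> Prop) (y : A) s :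
  Q y -> (forall x, x \in s -> Q x) -> forall x, x \in y :: s -> Q x.
Proof. by move=> Qy Qs x; rewrite inE => /predU1P[->|/Qs]. Qed.

(* Comparing these polynomials up to unfolding would not terminate in practice. *)
Local Opaque mP mQ mR mS.

(** * Mirrors, and divisibility of skew polynomials by S *)

Section Mirrors.
Variable R : realType.
Implicit Type T : polyhedron.
Local Notation K := R[i].
Local Notation rc := (real_complex R).
Local Notation G T := (@symmetry_group R T).

Lemma jac_const_neq0 T : jac_const K T != 0.
Proof. by case: T; rewrite /= ?oppr_eq0 pnatr_eq0. Qed.

Lemma mact_mS T g : G T g -> mact (map_mx rc g) (mS K T) = rc (\det g) *: mS K T.
Proof.
move=> gG; have [iP iQ iR] := mact_invariants gG; rewrite -det_map_mx.
have E := jac_mPQR K T.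
(* Skewness under g involves g alone, so the one-element list can play the group in [S_skew]. *)
pose Gs := [:: map_mx rc g]; have gd : forall h, h \in Gs -> \det h = 1 \/ \det h = -1.
  by move=> h; rewrite inE => /eqP ->; rewrite det_map_mx; case: (sym_det gG) => ->; rewrite ?rmorphN rmorph1; [left|right].
have iE (p : {mpoly K[3]}) : mact (map_mx rc g) p = p -> forall h, h \in Gs -> mact h p = p.
  by move=> pE h; rewrite inE => /eqP ->.
exact: (S_skew gd (iE _ iP) (iE _ iQ) (iE _ iR) (jac_const_neq0 T) E (mem_head _ _)).
Qed.

(* A plane a = 0 is a mirror of the polyhedron along which S vanishes to first order. *)
Definition simple_mirror T (a : 'cV[K]_3) :=
  (exists g, [/\ G T g, \det g = -1 & forall u, aeval (lform a) u = 0 -> map_mx rc g *m u = u]) /\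
  (exists2 u, aeval (lform a) u = 0 & exists j, aeval (mS K T)^`M(j) u != 0).

Lemma simple_mirrorZ T c a : c != 0 -> simple_mirror T a -> simple_mirror T (c *: a).
Proof.
have E u : aeval (lform (c *: a)) u = c * aeval (lform a) u.
  by rewrite !aeval_lform linearZ /= -scalemxAl mxE.
move=> c0 [[g [gG gd gu]] [u au Su]]; split.
  exists g; split=> // v; rewrite E => /eqP; rewrite mulf_eq0 (negbTE c0) => /eqP; exact: gu.
by exists u => //; rewrite E au mulr0.
Qed.

(** The reflection is conjugated by h. If all partial derivatives of S vanished at the transported
    point, the chain rule and the skewness of S would make them vanish at u as well. *)
Lemma simple_mirror_act T h a : G T h -> simple_mirror T a -> simple_mirror T ((map_mx rc h)^T *m a).
Proof.
move=> hG; have oh := map_orth hG; have oh' := mulmx1C oh.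
have E u : aeval (lform ((map_mx rc h)^T *m a)) u = aeval (lform a) (map_mx rc h *m u).
  by rewrite !aeval_lform trmx_mul trmxK mulmxA.
move=> [[g [gG gd gu]] [u au [j Su]]]; split.
  exists (h^T *m g *m h); split; first by apply: sym_mul => //; apply: sym_mul => //; apply: sym_tr.
    rewrite !det_mulmx det_tr gd mulrN1 mulNr.
    by case: (sym_det hG) => ->; rewrite ?mulrNN mulr1.
  move=> v; rewrite E => /gu e; rewrite !map_mxM -!mulmxA e mulmxA -map_trmx oh mul1mx //.
exists ((map_mx rc h)^T *m u); first by rewrite E mulmxA oh' mul1mx.
have [i Hi|H] := pickP (fun i => aeval (mS K T)^`M(i) ((map_mx rc h)^T *m u) != 0); first by exists i.
case/negP: Su; have := mact_mS (sym_tr hG); rewrite -map_trmx => /(congr1 (mderiv j)).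
rewrite mderiv_mact mderivZ => /(congr1 (fun p => aeval p u)).
rewrite /aeval mevalZ rmorph_sum /= big1 => [/esym/eqP|i _]; last first.
  rewrite mevalZ -/(aeval _ _) aeval_mact; have /negbT := H i; rewrite negbK => /eqP ->; exact: mulr0.
rewrite mulf_eq0 fmorph_eq0 det_tr => /orP[|//].
by case: (sym_det hG) => ->; rewrite ?oppr_eq0 oner_eq0.
Qed.

Lemma simple_mirrorP T g a b c x y z (j : 'I_3) : G T g -> \det g = -1 ->
  (forall x y z, a * x + b * y + c * z = 0 -> map_mx rc g *m col3 x y z = col3 x y z) ->
  a * x + b * y + c * z = 0 -> col3 a b c j 0 != 0 ->
  (exists2 r, mS K T = lform (col3 a b c) * r & aeval r (col3 x y z) != 0) ->
  simple_mirror T (col3 a b c).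
Proof.
move=> gG gd gu u0 aj [r SE r0]; split.
  by exists g; split=> // u; rewrite aeval_lform_col3 [u]col3E !mxE /= => /gu.
exists (col3 x y z); first by rewrite aeval_lform_col3 !mxE.
exists j; rewrite SE /aeval mderivM mevalD !mevalM -!/(aeval _ _) [aeval (lform _) _]aeval_lform_col3 !mxE u0 mul0r addr0.
rewrite mderiv_lform {1}/aeval mevalC; apply: mulf_neq0; [exact: aj|exact: r0].
Qed.

(** Membership is certified by the list s of the indices to which the vertices are sent; the lists
    given to the tactics below are these certificates. *)
Lemma sym_of_perm T (g : 'M[R]_3) (s : seq nat) : g^T *m g = 1%:M ->
  perm_eq s (iota 0 (size (vertices R T))) ->
  [seq g *m v | v <- vertices R T] = [seq (vertices R T)`_i | i <- s] -> G T g.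
Proof.
move=> og sp e; split=> // u; rewrite e (perm_mem (perm_map _ sp)).
have -> : [seq (vertices R T)`_i | i <- iota 0 (size (vertices R T))] = vertices R T; last by [].
by apply: (@eq_from_nth _ 0); rewrite size_map size_iota // => i lt_i; rewrite (nth_map 0%N) ?size_iota // nth_iota.
Qed.

Lemma map_mx3_col3 (a b c d e f g h k : R) (x y z : K) :
  map_mx rc (mx3 [:: [:: a; b; c]; [:: d; e; f]; [:: g; h; k]]) *m col3 x y z =
  col3 (rc a * x + rc b * y + rc c * z) (rc d * x + rc e * y + rc f * z) (rc g * x + rc h * y + rc k * z).
Proof.
rewrite -mx3_col3; congr (_ *m _); apply/matrixP => i j; rewrite !mxE.
by case: i => -[|[|[|//]]] i3; case: j => -[|[|[|//]]] j3.
Qed.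

Lemma map_mx3_tr_col3 (a b c d e f g h k : R) (x y z : K) :
  (map_mx rc (mx3 [:: [:: a; b; c]; [:: d; e; f]; [:: g; h; k]]))^T *m col3 x y z =
  col3 (rc a * x + rc d * y + rc g * z) (rc b * x + rc e * y + rc h * z) (rc c * x + rc f * y + rc k * z).
Proof.
rewrite -map_mx3_col3; congr (_ *m _); apply/matrixP => i j; rewrite !mxE.
by case: i => -[|[|[|//]]] i3; case: j => -[|[|[|//]]] j3.
Qed.

(** The reflections in the base mirrors, and just enough symmetries to carry these mirrors to all
    others. *)
Let swap : 'M[R]_3 := mx3 [:: [:: 0; 1; 0]; [:: 1; 0; 0]; [:: 0; 0; 1]].
Let cyc : 'M[R]_3 := mx3 [:: [:: 0; 1; 0]; [:: 0; 0; 1]; [:: 1; 0; 0]].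
Let flip13 : 'M[R]_3 := mx3 [:: [:: -1; 0; 0]; [:: 0; 1; 0]; [:: 0; 0; -1]].
Let flip1 : 'M[R]_3 := mx3 [:: [:: -1; 0; 0]; [:: 0; 1; 0]; [:: 0; 0; 1]].
Let flip2 : 'M[R]_3 := mx3 [:: [:: 1; 0; 0]; [:: 0; -1; 0]; [:: 0; 0; 1]].
Let rot5 : 'M[R]_3 := mx3 [:: [:: alpha R / 2; - (beta R / 2); 0]; [:: beta R / 2; alpha R / 2; 0]; [:: 0; 0; 1]].
(* Order 3, permutes the twofold axes (0,1,0), (1,0,-1-alpha), (1+alpha,0,1). *)
Let rot3 : 'M[R]_3 :=
  let a := alpha R in let b := beta R in let k := (2 - a) / 5 in let f := (1 + 2 * a) / 5 in
  mx3 [:: [:: f; b * k; - ((3 + a) / 5)]; [:: b * f; 0; b * k]; [:: k; - (b * f); - f]].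

Ltac sym_tac s := apply: (@sym_of_perm _ _ s);
  [by apply: mx3_tr_mul; ring | by [] |
   rewrite /vertices /= !mx3_col3; congr [:: _; _; _; _]; by apply: col3_congr; ring].

Lemma swap_T : G Tetrahedron swap.
Proof. sym_tac [:: 0; 2; 1; 3]%N. Qed.

Lemma cyc_T : G Tetrahedron cyc.
Proof. sym_tac [:: 0; 3; 1; 2]%N. Qed.

Lemma flip13_T : G Tetrahedron flip13.
Proof. sym_tac [:: 2; 3; 0; 1]%N. Qed.

Ltac sym_tac6 s := apply: (@sym_of_perm _ _ s);
  [by apply: mx3_tr_mul; ring | by [] |
   rewrite /vertices /= !mx3_col3; congr [:: _; _; _; _; _; _]; by apply: col3_congr; ring].

Lemma swap_O : G Octahedron swap.
Proof. sym_tac6 [:: 2; 3; 0; 1; 4; 5]%N. Qed.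

Lemma cyc_O : G Octahedron cyc.
Proof. sym_tac6 [:: 4; 5; 0; 1; 2; 3]%N. Qed.

Lemma flip1_O : G Octahedron flip1.
Proof. sym_tac6 [:: 1; 0; 2; 3; 4; 5]%N. Qed.

Ltac sym_tac12 s ha hb := apply: (@sym_of_perm _ _ s);
  [apply: mx3_tr_mul; by [field: ha hb | ring: ha hb] | by rewrite vertices_ico |
   rewrite vertices_ico /= !mx3_col3; congr [:: _; _; _; _; _; _; _; _; _; _; _; _]; by apply: col3_congr; field: ha hb].

Lemma flip2_I : G Icosahedron flip2.
Proof.
have ha := alpha_sqr R; have hb := beta_sqr R.
sym_tac12 [:: 0; 1; 5; 4; 3; 2; 6; 7; 11; 10; 9; 8]%N ha hb.
Qed.

Lemma rot5_I : G Icosahedron rot5.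
Proof.
have ha := alpha_sqr R; have hb := beta_sqr R.
sym_tac12 [:: 0; 2; 3; 4; 5; 1; 6; 8; 9; 10; 11; 7]%N ha hb.
Qed.

Lemma rot3_I : G Icosahedron rot3.
Proof.
have ha := alpha_sqr R; have hb := beta_sqr R.
sym_tac12 [:: 3; 10; 1; 5; 8; 0; 9; 4; 7; 11; 2; 6]%N ha hb.
Qed.

Lemma simple_mirror_forms T a : a \in mirror_forms (rc (alpha R)) (rc (beta R)) T -> simple_mirror T a.
Proof.
have act h p q s p' q' s' : G T h -> simple_mirror T (col3 p q s) ->
  (map_mx rc h)^T *m col3 p q s = col3 p' q' s' -> simple_mirror T (col3 p' q' s').
  by move=> hG gd <-; apply: simple_mirror_act.
have sc c p q s p' q' s' : c != 0 -> simple_mirror T (col3 p q s) -> c * p = p' -> c * q = q' -> c * s = s' ->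
   simple_mirror T (col3 p' q' s').
  move=> c0 H <- <- <-; have := simple_mirrorZ c0 H; congr (simple_mirror T _).
  by apply/colP => -[[|[|[|]]]] // i3; rewrite !mxE.
have rE := (rmorphN, rmorphM, rmorphD, fmorphV, rmorph1, rmorph0, rmorph_nat).
have n2 : 2 != 0 :> K by rewrite pnatr_eq0.
have solve (x y : K) e : e = 0 -> x - y = e -> x = y by move=> -> /eqP; rewrite subr_eq0 => /eqP.
case: T act sc => act sc.
- have g1 : simple_mirror Tetrahedron (col3 1 (-1) 0).
    apply: (@simple_mirrorP Tetrahedron swap 1 (-1) 0 1 1 0 0); [exact: swap_T|..|exact: mS_base_T].
    + rewrite det_mx3; ring.
    + move=> x y z; rewrite map_mx3_col3 ?rE => H.
      have -> : x = y by apply: (solve _ _ _ H); ring.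
      by apply: col3_congr; ring.
    + ring.
    + by rewrite mxE oner_eq0.
  have g2 : simple_mirror Tetrahedron (col3 0 1 (-1)).
    by apply: (act _ _ _ _ _ _ _ cyc_T g1); rewrite map_mx3_tr_col3 ?rE; apply: col3_congr; ring.
  have g3 : simple_mirror Tetrahedron (col3 (-1) 0 1).
    by apply: (act _ _ _ _ _ _ _ cyc_T g2); rewrite map_mx3_tr_col3 ?rE; apply: col3_congr; ring.
  have h1 : simple_mirror Tetrahedron (col3 (-1) (-1) 0).
    by apply: (act _ _ _ _ _ _ _ flip13_T g1); rewrite map_mx3_tr_col3 ?rE; apply: col3_congr; ring.
  have h2 : simple_mirror Tetrahedron (col3 0 (-1) (-1)).
    by apply: (act _ _ _ _ _ _ _ cyc_T h1); rewrite map_mx3_tr_col3 ?rE; apply: col3_congr; ring.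
  have h3 : simple_mirror Tetrahedron (col3 (-1) 0 (-1)).
    by apply: (act _ _ _ _ _ _ _ cyc_T h2); rewrite map_mx3_tr_col3 ?rE; apply: col3_congr; ring.
  move: a; rewrite /mirror_forms; apply: forall_cons; [exact: g1|apply: forall_cons; [exact: h1|apply: forall_cons; [exact: g2|apply: forall_cons; [exact: h2|apply: forall_cons; [exact: g3|apply: forall_cons; [exact: h3|exact: forall_nil]]]]]].
- have k1 : simple_mirror Octahedron (col3 1 0 0).
    apply: (@simple_mirrorP Octahedron flip1 1 0 0 0 1 2 0); [exact: flip1_O|..|exact: mS_base_O1].
    + rewrite det_mx3; ring.
    + move=> x y z; rewrite map_mx3_col3 ?rE => H.
      have -> : x = 0 by apply: (solve _ _ _ H); ring.
      by apply: col3_congr; ring.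
    + ring.
    + by rewrite mxE oner_eq0.
  have k2 : simple_mirror Octahedron (col3 0 1 0).
    by apply: (act _ _ _ _ _ _ _ cyc_O k1); rewrite map_mx3_tr_col3 ?rE; apply: col3_congr; ring.
  have k3 : simple_mirror Octahedron (col3 0 0 1).
    by apply: (act _ _ _ _ _ _ _ cyc_O k2); rewrite map_mx3_tr_col3 ?rE; apply: col3_congr; ring.
  have g1 : simple_mirror Octahedron (col3 1 (-1) 0).
    apply: (@simple_mirrorP Octahedron swap 1 (-1) 0 1 1 2 0); [exact: swap_O|..|exact: mS_base_O2].
    + rewrite det_mx3; ring.
    + move=> x y z; rewrite map_mx3_col3 ?rE => H.
      have -> : x = y by apply: (solve _ _ _ H); ring.
      by apply: col3_congr; ring.
    + ring.
    + by rewrite mxE oner_eq0.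
  have g2 : simple_mirror Octahedron (col3 0 1 (-1)).
    by apply: (act _ _ _ _ _ _ _ cyc_O g1); rewrite map_mx3_tr_col3 ?rE; apply: col3_congr; ring.
  have g3 : simple_mirror Octahedron (col3 (-1) 0 1).
    by apply: (act _ _ _ _ _ _ _ cyc_O g2); rewrite map_mx3_tr_col3 ?rE; apply: col3_congr; ring.
  have h1 : simple_mirror Octahedron (col3 (-1) (-1) 0).
    by apply: (act _ _ _ _ _ _ _ flip1_O g1); rewrite map_mx3_tr_col3 ?rE; apply: col3_congr; ring.
  have h2 : simple_mirror Octahedron (col3 0 (-1) (-1)).
    by apply: (act _ _ _ _ _ _ _ cyc_O h1); rewrite map_mx3_tr_col3 ?rE; apply: col3_congr; ring.
  have h3 : simple_mirror Octahedron (col3 (-1) 0 (-1)).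
    by apply: (act _ _ _ _ _ _ _ cyc_O h2); rewrite map_mx3_tr_col3 ?rE; apply: col3_congr; ring.
  move: a; rewrite /mirror_forms /=; apply: forall_cons; [exact: k1|apply: forall_cons; [exact: k2|apply: forall_cons; [exact: k3|apply: forall_cons; [exact: g1|apply: forall_cons; [exact: h1|apply: forall_cons; [exact: g2|apply: forall_cons; [exact: h2|apply: forall_cons; [exact: g3|apply: forall_cons; [exact: h3|exact: forall_nil]]]]]]]]].
have Hb : rc (beta R) ^+ 2 = 3 + rc (alpha R) by rewrite -rmorphXn beta_sqr !rE.
have Ha : rc (alpha R) ^+ 2 = 1 - rc (alpha R) by rewrite -rmorphXn alpha_sqr !rE.
have a0 : rc (alpha R) != 0 by rewrite fmorph_eq0 gt_eqF ?alpha_gt0.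
have b0 : rc (beta R) != 0 by rewrite fmorph_eq0 gt_eqF ?beta_gt0.
have r5 p q s : simple_mirror Icosahedron (col3 p q s) ->
  simple_mirror Icosahedron (col3 ((rc (alpha R) * p + rc (beta R) * q) / 2) ((rc (alpha R) * q - rc (beta R) * p) / 2) s).
  move=> H; apply: (act _ _ _ _ _ _ _ rot5_I H); rewrite map_mx3_tr_col3 ?rE.
  by apply: col3_congr; field.
have y0 : simple_mirror Icosahedron (col3 0 2 0).
  apply: (@simple_mirrorP Icosahedron flip2 0 2 0 1 0 0 1); [exact: flip2_I|..|exact: mS_base_I].
  + rewrite det_mx3; ring.
  + move=> x y z; rewrite map_mx3_col3 ?rE => H.
    have -> : y = 0 by apply: (mulfI n2); apply: (solve _ _ _ H); ring.
    by apply: col3_congr; ring.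
  + ring.
  + by rewrite mxE.
have fiveP p q s : simple_mirror Icosahedron (col3 p q s) -> forall p1 q1 p2 q2 p3 q3 p4 q4,
  (rc (alpha R) * p + rc (beta R) * q) / 2 = p1 -> (rc (alpha R) * q - rc (beta R) * p) / 2 = q1 ->
  (rc (alpha R) * p1 + rc (beta R) * q1) / 2 = p2 -> (rc (alpha R) * q1 - rc (beta R) * p1) / 2 = q2 ->
  (rc (alpha R) * p2 + rc (beta R) * q2) / 2 = p3 -> (rc (alpha R) * q2 - rc (beta R) * p2) / 2 = q3 ->
  (rc (alpha R) * p3 + rc (beta R) * q3) / 2 = p4 -> (rc (alpha R) * q3 - rc (beta R) * p3) / 2 = q4 ->
  forall v, v \in [:: col3 p q s; col3 p1 q1 s; col3 p2 q2 s; col3 p3 q3 s; col3 p4 q4 s] -> simple_mirror Icosahedron v.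
  move=> H0 p1 q1 p2 q2 p3 q3 p4 q4 e1 f1 e2 f2 e3 f3 e4 f4.
  have H1 := r5 _ _ _ H0; rewrite e1 f1 in H1; have H2 := r5 _ _ _ H1; rewrite e2 f2 in H2.
  have H3 := r5 _ _ _ H2; rewrite e3 f3 in H3; have H4 := r5 _ _ _ H3; rewrite e4 f4 in H4.
  apply: forall_cons; [exact: H0|apply: forall_cons; [exact: H1|apply: forall_cons; [exact: H2|apply: forall_cons; [exact: H3|apply: forall_cons; [exact: H4|exact: forall_nil]]]]].
(* [rot3] and its inverse carry the mirror y = 0 into the two blocks of mirrors that do not contain
   the z axis. The factors beta here and alpha beta below rescale the resulting normals to the
   listed ones. *)
have z1 : simple_mirror Icosahedron (col3 2 0 (-2 - 2 * rc (alpha R))).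
  have := simple_mirror_act (sym_tr rot3_I) y0; rewrite -map_trmx trmxK map_mx3_col3 ?rE => H.
  by apply: (sc (rc (beta R)) _ _ _ _ _ _ b0 H); field: Ha Hb.
have z2 : simple_mirror Icosahedron (col3 2 0 (2 * rc (alpha R))).
  have := simple_mirror_act rot3_I y0; rewrite map_mx3_tr_col3 ?rE => H.
  by apply: (sc (rc (alpha R) * rc (beta R)) _ _ _ _ _ _ (mulf_neq0 a0 b0) H); field: Ha Hb.
rewrite /mirror_forms !mem_cat => /or3P[].
- by apply: (fiveP _ _ _ y0); field: Ha Hb.
- by apply: (fiveP _ _ _ z1); field: Ha Hb.
- by apply: (fiveP _ _ _ z2); field: Ha Hb.
Qed.

(** At a point u fixed by a reflection, skewness gives h(u) = - h(u), so h vanishes on every mirror.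
    The mirrors are simple zeros of S, so [lforms_div] applies. *)
Lemma skew_div T (h : {mpoly K[3]}) :
  (forall g, G T g -> mact (map_mx rc g) h = rc (\det g) *: h) -> exists h', h = mS K T * h'.
Proof.
move=> hs.
have Hb : rc (beta R) ^+ 2 = 3 + rc (alpha R) by rewrite -rmorphXn beta_sqr rmorphD rmorph_nat.
have Ha : rc (alpha R) ^+ 2 = 1 - rc (alpha R) by rewrite -rmorphXn alpha_sqr rmorphB rmorph1.
have SE := mS_forms T Ha Hb; set c := (X in X *: _) in SE.
have c0 : c != 0 by rewrite /c; case: (T); rewrite ?oppr_eq0 oner_eq0.
have [a aT|a u aT au|q hq] := @lforms_div K 3 (mirror_forms (rc (alpha R)) (rc (beta R)) T) h.
- have [_ [u au [j Su]]] := simple_mirror_forms aT; exists u => //; exists j.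
  by apply: contra_neq Su => e; rewrite SE mderivZ /aeval mevalZ -/(aeval _ _) e mulr0.
- have [[g [gG gd gu]] _] := simple_mirror_forms aT.
  have := congr1 (fun p => aeval p u) (hs g gG); rewrite /= aeval_mact gu // gd rmorphN1 scaleN1r /aeval mevalN => /eqP.
  by rewrite -addr_eq0 -mulr2n mulrn_eq0 => /eqP.
- exists (c^-1 *: q); rewrite SE -scalerAl -scalerAr scalerA mulfV // scale1r //.
Qed.

End Mirrors.

(** * Projective space *)

Section ProjectiveSpace.
Variable K : numFieldType.
Implicit Type n : nat.

Lemma proj_ext n (x y : proj K n) : sval x = sval y -> x = y.
Proof. by case: x => V hV; case: y => W hW /= e; case: _ / e hW => hW; congr exist; apply: eq_irrelevance. Qed.

Lemma hcoordP n (x : proj K n) v : hcoord x v <-> v != 0 /\ sval x = <[v]>%VS.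
Proof.
rewrite /hcoord; split=> [[v0 vx]|[v0 ->]]; last by split=> //; apply: memv_line.
split=> //; apply/esym/eqP; rewrite eqEdim -memvE vx /=.
by have /eqP -> := svalP x; rewrite dim_vline v0.
Qed.

Lemma hcoord_ex n (x : proj K n) : exists v, hcoord x v.
Proof.
exists (vpick (sval x)); split; last exact: memv_pick.
rewrite vpick0 -dimv_eq0; by have /eqP -> := svalP x.
Qed.

Lemma hcoord_scale n (x : proj K n) v v' : hcoord x v -> hcoord x v' -> exists2 c, c != 0 & v' = c *: v.
Proof.
move=> /hcoordP [v0 xE]; rewrite /hcoord xE => -[v'0 /vlineP [c e]]; exists c => //.
by apply: contra_neq v'0 => c0; rewrite e c0 scale0r.
Qed.

Lemma hcoordZ n (x : proj K n) v c : c != 0 -> hcoord x v -> hcoord x (c *: v).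
Proof. by move=> c0 [v0 vx]; split; [rewrite scaler_eq0 negb_or c0|rewrite memvZ]. Qed.

Lemma hcoord_inj n (x y : proj K n) v : hcoord x v -> hcoord y v -> x = y.
Proof. by move=> /hcoordP [_ ex] /hcoordP [_ ey]; apply: proj_ext; rewrite ex ey. Qed.

(** The default [affine_pt 0] is taken only for v = 0. *)
Definition mkproj n (v : 'cV[K]_n.+1) : proj K n :=
  insubd (affine_pt 0 : {V : {vspace 'cV[K]_n.+1} | \dim V == 1%N}) <[v]>%VS.

Lemma hcoord_mkproj n (v : 'cV[K]_n.+1) : v != 0 -> hcoord (mkproj v) v.
Proof.
move=> v0; apply/hcoordP; split=> //.
by rewrite /mkproj -[sval _]/(val _) insubdK // unfold_in dim_vline v0.
Qed.

Lemma hcoord_affine n (u : 'cV[K]_n) : hcoord (affine_pt u) (col_mx 1%:M u).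
Proof.
by apply/hcoordP; split=> //; have := dim_affine_line u; rewrite dim_vline; case: (_ == 0).
Qed.

Lemma vanishesP n (p : {mpoly K[n.+1]}) x v : homogeneous p -> hcoord x v ->
  vanishes_at p x <-> aeval p v = 0.
Proof.
move=> [d hp] xv; split=> [/(_ _ xv) //|pv v' /(hcoord_scale xv) [c _ ->]].
by rewrite (dhomog_eval _ _ hp) pv mulr0.
Qed.

(** Closed sets are intersections of hypersurfaces, so the closure can be tested on one form at a
    time. *)
Lemma zclosureP n (A : set (proj K n)) x : zclosure A x <->
  forall p, homogeneous p -> (forall y, A y -> vanishes_at p y) -> vanishes_at p x.
Proof.
split=> [H p hp pA|H B [[I hI ->] AB]].
  have := H [set y | vanishes_at p y]; apply; split; last by move=> y /pA.
  exists [set p]; first by move=> _ ->.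
  by apply/seteqP; split=> y /= => [h _ -> //|]; apply.
by move=> p Ip; apply: H => [|y /AB]; [exact: hI|exact].
Qed.

Lemma zclosure_sub n (A : set (proj K n)) : A `<=` zclosure A.
Proof. by move=> x Ax; apply/zclosureP => p _; apply. Qed.

Lemma zclosure_min n (A B : set (proj K n)) : zclosed B -> A `<=` B -> zclosure A `<=` B.
Proof. by move=> cB AB x; apply. Qed.

Lemma homogeneous1 n : homogeneous (1 : {mpoly K[n]}).
Proof. by exists 0%N; apply: dhomog1. Qed.

Lemma zclosed0 n : zclosed (set0 : set (proj K n)).
Proof.
exists [set 1]; first by move=> _ ->; apply: homogeneous1.
apply/seteqP; split=> x //= /(_ _ erefl); have [v xv] := hcoord_ex x.
by move=> /(_ _ xv); rewrite /aeval meval1 => /eqP; rewrite oner_eq0.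
Qed.

Lemma zclosed_hyper n (p : {mpoly K[n.+1]}) : homogeneous p -> zclosed [set x | vanishes_at p x].
Proof.
move=> hp; exists [set p]; first by move=> _ ->.
by apply/seteqP; split=> y /= => [h _ -> //|]; apply.
Qed.

Lemma homogeneousM n (p q : {mpoly K[n]}) : homogeneous p -> homogeneous q -> homogeneous (p * q).
Proof. by move=> [d hp] [e hq]; exists (d + e)%N; apply: dhomogM. Qed.

Lemma vanishes_atM n (p q : {mpoly K[n.+1]}) x : homogeneous p -> homogeneous q ->
  vanishes_at (p * q) x -> vanishes_at p x \/ vanishes_at q x.
Proof.
move=> hp hq; have [v xv] := hcoord_ex x.
move=> /(_ _ xv) /eqP; rewrite /aeval mevalM mulf_eq0 => /orP[]/eqP; [left|right]; exact/(vanishesP _ xv).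
Qed.

Lemma vanishes_atMl n (p q : {mpoly K[n.+1]}) x : vanishes_at p x -> vanishes_at (p * q) x.
Proof. by move=> H v /H; rewrite /aeval mevalM => ->; rewrite mul0r. Qed.

Lemma vanishes_atMr n (p q : {mpoly K[n.+1]}) x : vanishes_at q x -> vanishes_at (p * q) x.
Proof. by rewrite mulrC; apply: vanishes_atMl. Qed.

Lemma zclosedU n (A B : set (proj K n)) : zclosed A -> zclosed B -> zclosed (A `|` B).
Proof.
move=> [I hI ->] [J hJ ->]; exists [set f | exists p q, [/\ I p, J q & f = p * q]].
  by move=> _ [p [q [Ip Jq ->]]]; apply: homogeneousM; [exact: hI|exact: hJ].
apply/seteqP; split=> x /=.
  by move=> [H|H] _ [p [q [Ip Jq ->]]]; [apply/vanishes_atMl/H|apply/vanishes_atMr/H].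
move=> H; have [h|/existsNP [p /not_implyP [Ip np]]] := pselect (forall p, I p -> vanishes_at p x); first by left.
right=> q Jq; case: (@vanishes_atM n p q x) => //; [exact: hI|exact: hJ|].
by apply: H; exists p, q.
Qed.

(** The equations are the 2 by 2 minors of a coordinate vector of the point against the
    variables. *)
Lemma zclosed_point n (x : proj K n) : zclosed [set x].
Proof.
have [v xv] := hcoord_ex x.
exists [set p | exists i j, p = v i 0 *: 'X_j - v j 0 *: 'X_i].
  by move=> _ [i [j ->]]; exists 1%N; rewrite rpredB // rpredZ // dhomog_var.
apply/seteqP; split=> y /=.
  move=> -> _ [i [j ->]] v' /(hcoord_scale xv) [c _ ->].
  by rewrite /aeval mevalB !mevalZ !mevalXU !mxE mulrCA [v j 0 * _]mulrCA [v j 0 * _]mulrC subrr.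
move=> H; have [v' yv'] := hcoord_ex y.
have [/cV0Pn [i vi] _] := xv; apply/esym/(hcoord_inj xv).
have E j : v i 0 * v' j 0 = v j 0 * v' i 0.
  apply/eqP; rewrite -subr_eq0; apply/eqP.
  have := H _ (ex_intro _ i (ex_intro _ j erefl)) _ yv'.
  by rewrite /aeval mevalB !mevalZ !mevalXU.
have v'E : v' = (v' i 0 / v i 0) *: v.
  by apply/colP => j; rewrite mxE mulrAC [v' i 0 * _]mulrC -E mulrAC mulfV // mul1r.
have c0 : v' i 0 / v i 0 != 0.
  by case: yv' => v'0 _; apply: contra_neq v'0 => e; rewrite v'E e scale0r.
have := yv'; rewrite v'E => /(hcoordZ (invr_neq0 c0)); by rewrite scalerA mulVf // scale1r.
Qed.

Lemma zclosed_list n (s : seq (proj K n)) : zclosed [set y | List.In y s].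
Proof.
elim: s => [|x s IH]; first by have := @zclosed0 n; congr zclosed; apply/seteqP; split.
have := zclosedU (zclosed_point x) IH; congr zclosed.
by apply/seteqP; split=> y /= [] ?; [left|right|left|right].
Qed.

Lemma irreducible_list n (Z : set (proj K n)) s : irreducible Z -> Z `<=` [set y | List.In y s] -> exists x, Z = [set x].
Proof.
move=> [[z Zz] irr]; elim: s => [|x s IH] H; first by have := H _ Zz.
case: (irr [set x] [set y | List.In y s]).
- exact: zclosed_point.
- exact: zclosed_list.
- by move=> y /H /= [->|]; [left|right].
- move=> Zx; exists x; apply/seteqP; split=> // y /= ->; by rewrite -(Zx _ Zz).
- exact: IH.
Qed.

Lemma affine_pt_inj n : injective (@affine_pt K n).
Proof.
move=> u u' e; have h := hcoord_affine u; have h' := hcoord_affine u'; rewrite -e in h'.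
have [c _ ec] := hcoord_scale h h'.
have : (col_mx 1%:M u' : 'cV_(1 + n)) = c *: (col_mx 1%:M u : 'cV_(1 + n)) by exact: ec.
rewrite scale_col_mx => /eq_col_mx [/colP/(_ 0)].
by rewrite !mxE eqxx mulr1 => <-; rewrite scale1r.
Qed.

Lemma zopen_in_self n (X : set (proj K n)) : zopen_in X X.
Proof. by exists set0; [exact: zclosed0|rewrite setD0]. Qed.

Lemma isomorphic_refl n (X : set (proj K n)) : isomorphic X X.
Proof.
have M : morphism_on X X id.
  have E V : zopen_in X V -> X `&` id @^-1` V = V.
    by move=> [A _ ->]; apply/seteqP; split=> [x [] //|x []].
  split=> // [V oV|V f oV rf]; rewrite E //.
by exists id, id; split.
Qed.

Lemma birational_affine n (A : set (proj K n)) : zopen_in (zclosure A) A -> birational A (zclosure A).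
Proof.
move=> oA; exists A, A; split; last exact: isomorphic_refl.
  by split; [exact: zopen_in_self|exact: zclosure_sub].
by split.
Qed.

End ProjectiveSpace.

(** * Nonsingular plane cubics in Weierstrass form *)

Section PlaneCubic.
Variables (K : numClosedFieldType) (c3 c2 c1 c0 : K).
Hypothesis c3_neq0 : c3 != 0.

Definition wf : {poly K} := c3 *: 'X^3 + c2 *: 'X^2 + c1 *: 'X + c0%:P.

Hypothesis wf_sep : forall x, wf.[x] = 0 -> wf^`().[x] != 0.

Lemma wfE x : wf.[x] = c3 * x ^+ 3 + c2 * x ^+ 2 + c1 * x + c0.
Proof. by rewrite /wf !hornerE. Qed.

Lemma wf'E x : wf^`().[x] = 3 * c3 * x ^+ 2 + 2 * c2 * x + c1.
Proof. rewrite /wf !derivE !hornerE /=; ring. Qed.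

Lemma size_wf : size wf = 4%N.
Proof.
rewrite /wf -!addrA size_polyDl size_scale ?size_polyXn //.
rewrite (leq_ltn_trans (size_polyD _ _)) // gtn_max (leq_ltn_trans (size_scale_leq _ _)) ?size_polyXn //=.
rewrite (leq_ltn_trans (size_polyD _ _)) // gtn_max (leq_ltn_trans (size_scale_leq _ _)) ?size_polyX //=.
by rewrite (leq_ltn_trans (size_polyC_leq1 _)).
Qed.

(** Homogenisation of S^2 = wf(R), with X_0 = 0 at infinity, X_1 = S and X_2 = R. *)
Definition cubic : {mpoly K[3]} :=
  'X_0 * 'X_1 ^+ 2 - (c3 *: 'X_2 ^+ 3 + c2 *: ('X_0 * 'X_2 ^+ 2) + c1 *: ('X_0 ^+ 2 * 'X_2) + c0 *: 'X_0 ^+ 3).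

Definition cubicE (v : 'cV[K]_3) : Prop := v 0 0 * v 1 0 ^+ 2 =
  c3 * v 2 0 ^+ 3 + c2 * (v 0 0 * v 2 0 ^+ 2) + c1 * (v 0 0 ^+ 2 * v 2 0) + c0 * v 0 0 ^+ 3.

Lemma aeval_cubic v : aeval cubic v = 0 <-> cubicE v.
Proof.
rewrite /aeval /cubic !(mevalB, mevalXU, mevalXn, mevalD, mevalZ, mevalM).
by split=> [/eqP|->]; rewrite ?subrr // subr_eq0 => /eqP.
Qed.

Lemma cubic_homog : cubic \is 3.-homog.
Proof.
have X i : ('X_i : {mpoly K[3]}) \is 1.-homog by exact: dhomog_var.
rewrite /cubic rpredB //; first by apply: (dhomogM (d := 1%N) (e := 2%N)); rewrite ?(dhomogMn 2 (X _)).
rewrite !rpredD // rpredZ //.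
- exact: (dhomogMn 3 (X _)).
- by apply: (dhomogM (d := 1%N) (e := 2%N)); rewrite ?(dhomogMn 2 (X _)).
- by apply: (dhomogM (d := 2%N) (e := 1%N)); rewrite ?(dhomogMn 2 (X _)).
- exact: (dhomogMn 3 (X _)).
Qed.

Lemma homogeneous_cubic : homogeneous cubic.
Proof. by exists 3%N; apply: cubic_homog. Qed.

Definition affineW : set 'cV[K]_2 := [set w | w 0 0 ^+ 2 = wf.[w 1 0]].
Definition ptsW : set (proj K 2) := [set affine_pt w | w in affineW].
Definition curveW : set (proj K 2) := [set x | vanishes_at cubic x].

Lemma curveWP x v : hcoord x v -> curveW x <-> cubicE v.
Proof. by move=> xv; rewrite -aeval_cubic; apply: vanishesP => //; apply: homogeneous_cubic. Qed.

Lemma col_mx_col3 (w : 'cV[K]_2) : col_mx 1%:M w = col3 1 (w 0 0) (w 1 0) :> 'cV[K]_(1 + 2).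
Proof.
apply/colP => i; rewrite !mxE; case: splitP => j ij; last first.
  rewrite ij /=; case: j {ij} => -[|[|//]] j2 /=; congr (w _ _); exact: val_inj.
by rewrite ij [j]ord1 !mxE eqxx.
Qed.

Lemma hcoord_aff (w : 'cV[K]_2) : hcoord (affine_pt w) (col3 1 (w 0 0) (w 1 0) : 'cV[K]_3).
Proof. by have := hcoord_affine w; rewrite col_mx_col3. Qed.

Lemma hcoord_aff2 (a b : K) : hcoord (affine_pt (\col_(i < 2) [:: a; b]`_i)) (col3 1 a b : 'cV[K]_3).
Proof. by have := hcoord_aff (\col_(i < 2) [:: a; b]`_i); rewrite !mxE. Qed.

Lemma col3_eq0 (v : 'cV[K]_3) : (v == 0) = [&& v 0 0 == 0, v 1 0 == 0 & v 2 0 == 0].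
Proof.
apply/eqP/and3P => [->|[/eqP a /eqP b /eqP c]]; first by rewrite !mxE eqxx.
by rewrite [v]col3E a b c; apply/colP => -[[|[|[|]]]] // i3; rewrite !mxE.
Qed.

Lemma ptsW_curveW : ptsW `<=` curveW.
Proof.
move=> _ [w /= we <-]; apply/(curveWP (hcoord_aff w)); rewrite /cubicE !mxE /= we wfE; ring.
Qed.

(** On X_0 = 0 the equation reduces to c3 X_2^3 = 0, which leaves one point at infinity. *)
Lemma curveW_cases x : curveW x -> ptsW x \/ hcoord x (col3 0 1 0).
Proof.
move=> Ex; have [v xv] := hcoord_ex x; have := Ex; move/(curveWP xv); rewrite /cubicE.
have [v0|v0 ve] := eqVneq (v 0 0) 0; last first.
  left; have h := hcoordZ (invr_neq0 v0) xv.
  have e : (v 0 0)^-1 *: v = col3 1 ((v 0 0)^-1 * v 1 0) ((v 0 0)^-1 * v 2 0).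
    by rewrite col3Z mulVf.
  exists (\col_(i < 2) [:: (v 0 0)^-1 * v 1 0; (v 0 0)^-1 * v 2 0]`_i); last first.
    by apply: hcoord_inj (hcoord_aff2 _ _) _; rewrite -e.
  rewrite /affineW /= !mxE /= wfE; apply: (mulfI v0).
  have -> : v 0 0 * ((v 0 0)^-1 * v 1 0) ^+ 2 = (v 0 0)^-1 ^+ 2 * (v 0 0 * v 1 0 ^+ 2) by field.
  rewrite ve; field; exact: v0.
rewrite v0 !expr0n /= !(mul0r, mulr0, addr0) => /esym/eqP.
rewrite mulf_eq0 (negbTE c3_neq0) /= expf_eq0 /= => /eqP v2; right.
have v1 : v 1 0 != 0 by case: xv => + _; rewrite col3_eq0 v0 v2 eqxx andbT.
by have := hcoordZ (invr_neq0 v1) xv; rewrite col3Z v0 v2 !mulr0 mulVf.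
Qed.

(** Multiplying by one variable at a time means that a normal form has to be restored after a single
    multiplication only. *)
Lemma mpoly_gen_ind n (Q : {mpoly K[n]} -> Prop) :
  (forall c, Q c%:MP) -> (forall p q, Q p -> Q q -> Q (p + q)) ->
  (forall i p, Q p -> Q ('X_i * p)) -> forall p, Q p.
Proof.
move=> QC QD QX; apply: mpolyind; first by rewrite -mpolyC0; exact: QC.
move=> c m p _ _ Qp; apply: (QD _ _ _ Qp); rewrite -mul_mpolyC mpolyXE_id mulrC.
apply: (big_rec (fun r => Q (r * c%:MP))) => [|i r _ Qr]; first by rewrite mul1r.
elim: (m i) => [|k IH]; first by rewrite expr0 mul1r.
by rewrite exprS -!mulrA; apply: QX; rewrite mulrA.
Qed.

Definition emb2 (a : {mpoly K[2]}) : {mpoly K[3]} := a \mPo [tuple 'X_0; 'X_1].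

Lemma aeval_emb2 a v : aeval (emb2 a) v = a.@[fun i => [:: v 0 0; v 1 0]`_i].
Proof.
rewrite /aeval /emb2 comp_mpoly_meval; apply: meval_eq => i.
by rewrite (tnth_nth 0); case: i => -[|[|//]] i2 /=; rewrite mevalXU.
Qed.

(* The cubic is monic in X_2 up to a constant, so one can divide by it. *)
Lemma cubic_div p : exists q a b c, p = cubic * q + (emb2 a + emb2 b * 'X_2 + emb2 c * 'X_2 ^+ 2).
Proof.
have eM a b : emb2 (a * b) = emb2 a * emb2 b by rewrite /emb2 rmorphM.
have eD a b : emb2 (a + b) = emb2 a + emb2 b by rewrite /emb2 rmorphD.
have eC k : emb2 k%:MP = k%:MP by rewrite /emb2 comp_mpolyC.
have eX0 : emb2 'X_0 = 'X_0 by rewrite /emb2 comp_mpolyXU.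
have eX1 : emb2 'X_1 = 'X_1 by rewrite /emb2 comp_mpolyXU.
have e0 : emb2 0 = 0 by rewrite /emb2 comp_mpoly0.
elim/mpoly_gen_ind: p => [k|p p' [q [a [b [c ->]]]] [q' [a' [b' [c' ->]]]]|i p [q [a [b [c ->]]]]].
- by exists 0, k%:MP, 0, 0; rewrite eC e0; ring.
- by exists (q + q'), (a + a'), (b + b'), (c + c'); rewrite !eD; ring.
case: i => -[|[|[|//]]] i3.
- exists ('X_0 * q), ('X_0 * a), ('X_0 * b), ('X_0 * c); rewrite !eM eX0.
  by rewrite (_ : Ordinal i3 = 0) ?[LHS]mulrDr; [ring|exact: val_inj].
- exists ('X_1 * q), ('X_1 * a), ('X_1 * b), ('X_1 * c); rewrite !eM eX1.
  by rewrite (_ : Ordinal i3 = 1); [ring|exact: val_inj].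
rewrite (_ : Ordinal i3 = 2); last exact: val_inj.
pose k := c3^-1.
(* Multiplication by X_2 creates a term [emb2 c * 'X_2 ^+ 3]. Its factor c3 X_2^3 is replaced by the
   other monomials of the cubic minus [cubic], which changes the quotient by - c / c3. *)
exists ('X_2 * q - k%:MP * emb2 c), (k%:MP * c * ('X_0 * 'X_1 ^+ 2 - c0%:MP * 'X_0 ^+ 3)),
  (a - k%:MP * c * (c1%:MP * 'X_0 ^+ 2)), (b - k%:MP * c * (c2%:MP * 'X_0)).
have eN a' : emb2 (- a') = - emb2 a' by rewrite /emb2 rmorphN.
rewrite !(eM, eD, eN, eC, expr2, exprS, expr0, mulr1, eX0, eX1).
have ck : k%:MP * c3%:MP = 1 :> {mpoly K[3]} by rewrite -mpolyCM mulVf ?mpolyC1.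
transitivity (cubic * ('X_2 * q) + (emb2 a * 'X_2 + emb2 b * 'X_2 ^+ 2 + (k%:MP * c3%:MP) * emb2 c * 'X_2 ^+ 3)).
  rewrite ck; ring.
rewrite /cubic -!mul_mpolyC; ring.
Qed.

Lemma quadratic0 (a b c : K) (rs : seq K) : uniq rs -> (2 < size rs)%N ->
  (forall x, x \in rs -> a + b * x + c * x ^+ 2 = 0) -> [/\ a = 0, b = 0 & c = 0].
Proof.
move=> urs srs H; pose p : {poly K} := Poly [:: a; b; c].
have p0 : p = 0.
  apply/eqP/negPn/negP => pn0; have := max_poly_roots pn0 _ urs.
  have sp : (size p <= 3)%N by apply: size_Poly.
  move=> /(_ _)/(leq_trans _) => M; have : (size rs < size p)%N.
    apply: max_poly_roots => //; apply/allP => x xrs; rewrite rootE; apply/eqP; rewrite -[RHS](H x xrs).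
    rewrite /p horner_Poly /=; ring.
  by move=> /leq_trans/(_ sp); rewrite ltnNge srs.
have E i : p`_i = [:: a; b; c]`_i by rewrite coef_Poly.
by have := (E 0%N, E 1%N, E 2%N); rewrite p0 !coef0 /= => -[[<- <-] <-].
Qed.

(** If y is not a critical value, wf - y is coprime to its derivative and so has three distinct
    roots. *)
Lemma wf_fibre y : (forall x, wf^`().[x] = 0 -> wf.[x] != y) ->
  exists rs : seq K, [/\ uniq rs, size rs = 3%N & forall x, x \in rs -> wf.[x] = y].
Proof.
move=> H; pose p := wf - y%:P.
have sp : size p = 4%N.
  by rewrite /p size_polyDl size_wf // size_polyN (leq_ltn_trans (size_polyC_leq1 _)).
have [rs pE] := closed_field_poly_normal p.
have p0 : p != 0 by rewrite -size_poly_gt0 sp.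
have lp : lead_coef p != 0 by rewrite lead_coef_eq0.
have rp x : root p x = (x \in rs) by rewrite pE rootZ // root_prod_XsubC.
have px x : root p x -> wf.[x] = y.
  by rewrite rootE /p !hornerE subr_eq0 => /eqP.
exists rs; split.
- rewrite -separable_prod_XsubC -(eqp_separable (eqp_scale _ lp)) -pE separable_poly.unlock.
  apply/Pdiv.ClosedField.coprimepP => x /px e; rewrite /p derivB derivC subr0.
  by apply/negP => /eqP /H; rewrite e eqxx.
- by move: sp; rewrite pE size_scale // size_prod_XsubC => -[].
- by move=> x; rewrite -rp => /px.
Qed.

Lemma wf'_neq0 : wf^`() != 0.
Proof.
apply/eqP => e; have := congr1 (fun p : {poly K} => p`_2) e.
rewrite coef_deriv coef0 /wf !coefD !coefZ !coefXn !coefX coefC /= !mulr0 !addr0 mulr1 => /eqP.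
by rewrite mulrn_eq0 (negbTE c3_neq0).
Qed.

(* For fixed (w, s) outside a curve, the cubic has three distinct points over
   (w : s), so the remainder of p, of degree at most 2 in X_2, vanishes. *)
Lemma cubic_ideal p : homogeneous p -> (forall y, ptsW y -> vanishes_at p y) -> exists q, p = cubic * q.
Proof.
move=> hp pv; have [q [a [b [c pE]]]] := cubic_div p.
have key w s : w != 0 -> (forall x, wf^`().[x] = 0 -> wf.[x] != s ^+ 2) ->
    let e := fun i : 'I_2 => [:: w; w * s]`_i in [/\ a.@[e] = 0, b.@[e] = 0 & c.@[e] = 0].
  move=> w0 /wf_fibre [rs [urs srs rsP]] e.
  suff [ea /eqP eb /eqP ec] : [/\ a.@[e] = 0, b.@[e] * w = 0 & c.@[e] * w ^+ 2 = 0].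
    by move: eb ec; rewrite mulf_eq0 (negbTE w0) orbF mulf_eq0 expf_eq0 (negbTE w0) orbF => /eqP eb /eqP ec.
  apply: (quadratic0 urs); first by rewrite srs.
  move=> x /rsP xs; pose v := col3 1 s x.
  have pt : ptsW (affine_pt (\col_(i < 2) [:: s; x]`_i)).
    by exists (\col_(i < 2) [:: s; x]`_i) => //; rewrite /affineW /= !mxE /= xs.
  have hv := hcoordZ w0 (hcoord_aff2 s x).
  have cv : aeval cubic (w *: col3 1 s x) = 0.
    by apply/aeval_cubic/(curveWP hv)/ptsW_curveW.
  have := pv _ pt _ hv; rewrite pE /aeval mevalD mevalM; move: cv; rewrite {1}/aeval => ->; rewrite mul0r add0r.
  rewrite !(mevalD, mevalM, mevalXn, mevalXU) -!/(aeval _ _) !aeval_emb2 !mxE /= mulr1 => <-.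
  ring.
have [rs dE] := closed_field_poly_normal wf^`().
have rsP x : root wf^`() x = (x \in rs).
  by rewrite dE rootZ ?root_prod_XsubC // lead_coef_eq0 wf'_neq0.
(* G is nonzero and vanishes wherever [key] does not apply: on w = 0 and where (s / w)^2 is a
   critical value of [wf]. So each coefficient times G vanishes everywhere. *)
pose G : {mpoly K[2]} := 'X_0 * \prod_(x <- rs) ('X_1 ^+ 2 - wf.[x] *: 'X_0 ^+ 2).
have G0 : G != 0.
  rewrite mulf_neq0 //.
    apply/eqP => /(congr1 (meval (fun _ : 'I_2 => 1 : K))); rewrite mevalXU meval0 => /eqP.
    by rewrite oner_eq0.
  rewrite prodf_seq_neq0; apply/allP => x _ /=.
  apply/eqP => /(congr1 (meval (fun i : 'I_2 => i%:R : K))).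
  rewrite meval0 mevalB mevalZ !mevalXn !mevalXU expr1n expr0n mulr0 subr0 => /eqP.
  by rewrite oner_eq0.
have kill (g : {mpoly K[2]}) : (forall w s, w != 0 -> (forall x, wf^`().[x] = 0 -> wf.[x] != s ^+ 2) ->
    g.@[fun i : 'I_2 => [:: w; w * s]`_i] = 0) -> g = 0.
  move=> H; suff /eqP : g * G = 0 by rewrite mulf_eq0 (negbTE G0) orbF => /eqP.
  apply: mpoly_eval0 => v; rewrite mevalM; apply/eqP; rewrite mulf_eq0.
  have [//|Gv] := eqVneq (G.@[v]) 0; rewrite ?orbT // orbF.
  move: Gv; rewrite /G mevalM mevalXU mulf_eq0 negb_or rmorph_prod prodf_seq_neq0 => /andP[v0 /allP vr].
  rewrite -(H (v 0) (v 1 / v 0) v0) => [|x x0].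
    apply/eqP/meval_eq => i; case: i => -[|[|//]] i2 /=; rewrite ?[v 0 * _]mulrC ?divfK //; congr (v _); exact: val_inj.
  have /vr /= : x \in rs by rewrite -rsP rootE x0.
  rewrite mevalB mevalZ !mevalXn !mevalXU subr_eq0; apply: contraNneq => ->.
  by rewrite -exprMn divfK.
have a0 : a = 0 by apply: kill => w s w0 /(key w s w0) [].
have b0 : b = 0 by apply: kill => w s w0 /(key w s w0) [].
have e0 : c = 0 by apply: kill => w s w0 /(key w s w0) [].
by exists q; rewrite pE a0 b0 e0 /emb2 comp_mpoly0 !mul0r !addr0.
Qed.

Lemma ptsW_curveW_vanishes p : homogeneous p -> (forall y, ptsW y -> vanishes_at p y) ->
  forall y, curveW y -> vanishes_at p y.
Proof. by move=> hp pv y Ey; have [q ->] := cubic_ideal hp pv; apply: vanishes_atMl. Qed.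

Lemma zclosure_ptsW : zclosure ptsW = curveW.
Proof.
apply/seteqP; split; first by apply: zclosure_min; [apply: zclosed_hyper homogeneous_cubic|exact: ptsW_curveW].
by move=> x Ex; apply/zclosureP => p hp pv; apply: ptsW_curveW_vanishes Ex.
Qed.

Lemma affine_reduce p : exists A B : {poly K}, forall s x, s ^+ 2 = wf.[x] ->
  aeval p (col3 1 s x) = A.[x] + s * B.[x].
Proof.
elim/mpoly_gen_ind: p => [k|p p' [A [B H]] [A' [B' H']]|i p [A [B H]]].
- by exists k%:P, 0 => s x _; rewrite /aeval mevalC !hornerE.
- by exists (A + A'), (B + B') => s x e; rewrite /aeval mevalD -!/(aeval _ _) (H _ _ e) (H' _ _ e) !hornerD; ring.
case: i => -[|[|[|//]]] i3.
- by exists A, B => s x e; rewrite /aeval mevalM mevalXU !mxE mul1r -!/(aeval _ _) H.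
- by exists (wf * B), A => s x e; rewrite /aeval mevalM mevalXU !mxE -!/(aeval _ _) H // !hornerM -e /=; ring.
- by exists ('X * A), ('X * B) => s x e; rewrite /aeval mevalM mevalXU !mxE -!/(aeval _ _) H // !hornerM hornerX /=; ring.
Qed.

(** On the affine curve the form is A(x) + s B(x), with norm N = A^2 - wf B^2. As wf has odd degree,
    N = 0 forces A = B = 0. Otherwise the affine zeros lie over the finitely many roots of N, and
    infinity adds one point. *)
Lemma finite_zeros p : homogeneous p -> (forall y, curveW y -> vanishes_at p y) \/
  exists s, forall y, curveW y -> vanishes_at p y -> List.In y s.
Proof.
move=> hp; have [A [B H]] := affine_reduce p; pose N := A ^+ 2 - wf * B ^+ 2.
have [N0|N0] := eqVneq N 0; [left|right].
  have e : A ^+ 2 = wf * B ^+ 2 by apply/eqP; rewrite -subr_eq0 -/N N0.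
  have w0 : wf != 0 by rewrite -size_poly_gt0 size_wf.
  have B0 : B = 0.
    apply/eqP/negPn/negP => B0; have A0 : A != 0.
      by apply: contraNneq B0 => A0; move/esym/eqP: e; rewrite A0 expr0n /= mulf_eq0 (negbTE w0) expf_eq0.
    have := congr1 (fun p : {poly K} => size p) e; rewrite !expr2 !size_mul ?mulf_neq0 // size_wf.
    by move: A0 B0; rewrite -!size_poly_gt0; move: (size A) (size B) => a b; lia.
  have A0 : A = 0 by move/eqP: e; rewrite B0 expr0n /= mulr0 expf_eq0 => /eqP.
  apply: ptsW_curveW_vanishes => // _ [w we <-]; apply/(vanishesP hp (hcoord_aff w)).
  by rewrite H // A0 B0 !horner0 mulr0 addr0.
have [rs NE] := closed_field_poly_normal N.
pose pt a b : proj K 2 := affine_pt (\col_(i < 2) [:: a; b]`_i).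
exists (mkproj (col3 0 1 0) :: List.flat_map (fun x => [:: pt (sqrtC wf.[x]) x; pt (- sqrtC wf.[x]) x]) rs).
move=> y /curveW_cases [[w /= we <-] pw|yh _]; last first.
  left; apply/esym/(hcoord_inj yh)/hcoord_mkproj.
  by rewrite col3_eq0 !mxE /= oner_eq0 andbF.
right; apply/List.in_flat_map; exists (w 1 0).
have wE : w = \col_(i < 2) [:: w 0 0; w 1 0]`_i.
  by apply/colP => i; rewrite mxE; case: i => -[|[|//]] i2 /=; congr (w _ _); apply: val_inj.
split; last first.
  have : w 0 0 ^+ 2 == sqrtC wf.[w 1 0] ^+ 2 by rewrite sqrtCK we.
  by rewrite eqf_sqr /pt => /orP[]/eqP e; [left|right; left]; rewrite [in RHS]wE e.
have : w 1 0 \in rs.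
  rewrite -root_prod_XsubC -(rootZ _ _ (_ : lead_coef N != 0)) ?lead_coef_eq0 // -NE rootE.
  have := pw _ (hcoord_aff w); rewrite H // => /eqP; rewrite addr_eq0 => /eqP e.
  have we' : w 0 0 ^+ 2 = wf.[w 1 0] := we.
  rewrite /N hornerD hornerN !expr2 !hornerM e -we'; apply/eqP; ring.
elim: (rs) => //= x s IH; rewrite inE => /predU1P [->|/IH]; [by left|by right].
Qed.

Lemma curveW_infinite s : exists2 y, curveW y & ~ List.In y s.
Proof.
have [g g0 H] : exists2 g : {poly K}, g != 0 & forall w, List.In (affine_pt w) s -> g.[w 1 0] = 0.
  elim: s => [|x s [g g0 H]]; first by exists 1 => //; apply: oner_neq0.
  have [[w xE]|nx] := pselect (exists w, x = affine_pt w).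
    exists (('X - (w 1 0)%:P) * g); first by rewrite mulf_neq0 ?polyXsubC_eq0.
    move=> w' /= [|/H e]; rewrite hornerM; last by rewrite e mulr0.
    by rewrite xE => /affine_pt_inj ->; rewrite hornerXsubC subrr mul0r.
  exists g => // w /= [xE|/H //]; by case: nx; exists w.
have [x gx] : exists x, g.[x] != 0.
  apply: contrapT => /forallNP nx; case/eqP: (oner_neq0 {poly K}).
  by apply: (poly_eval0 g0) => x /nx.
exists (affine_pt (\col_(i < 2) [:: sqrtC wf.[x]; x]`_i)).
  by apply: ptsW_curveW; exists (\col_(i < 2) [:: sqrtC wf.[x]; x]`_i) => //; rewrite /affineW /= !mxE sqrtCK.
by move/H; rewrite mxE /= => /eqP; rewrite (negbTE gx).
Qed.

(** A form that is not zero on the whole curve has finitely many zeros there, and the curve is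
    infinite. *)
Lemma curveW_irreducible : irreducible curveW.
Proof.
split; first by have [y Ey _] := curveW_infinite [::]; exists y.
move=> A B [I hI ->] [J hJ ->] H.
have [h|/existsNP [p /not_implyP [Ip np]]] :=
  pselect (forall p, I p -> forall y, curveW y -> vanishes_at p y); first by left=> y Ey p /h; apply.
have [h|/existsNP [q /not_implyP [Jq nq]]] :=
  pselect (forall q, J q -> forall y, curveW y -> vanishes_at q y); first by right=> y Ey q /h; apply.
have [//|[s sP]] := finite_zeros (hI _ Ip); have [//|[s' sP']] := finite_zeros (hJ _ Jq).
have [y Ey] := curveW_infinite (List.app s s'); case; apply/List.in_or_app.
by case: (H y Ey) => h; [left; apply: sP|right; apply: sP'] => //; apply: h.
Qed.

Lemma curveW_projective : projective_curve curveW.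
Proof.
split; [exact: zclosed_hyper homogeneous_cubic|exact: curveW_irreducible| |].
  move=> x e; have [y Ey] := curveW_infinite [:: x]; case; left.
  by move: Ey; rewrite e.
move=> Z [I hI ZE] irr ZW.
have [h|/existsNP [p /not_implyP [Ip np]]] :=
  pselect (forall p, I p -> forall y, curveW y -> vanishes_at p y).
  by left; apply/seteqP; split=> // y Ey; rewrite ZE => p /h; apply.
right; have [//|[s sP]] := finite_zeros (hI _ Ip).
apply: (irreducible_list irr (s := s)) => y Zy; apply: sP; first exact: ZW.
by move: Zy; rewrite ZE; apply.
Qed.

(** An affine singular point has s = 0 and is a common root of wf and its derivative; at infinity
    the derivative in X_0 is X_1^2, which is nonzero. *)
Lemma curveW_nonsingular x v : curveW x -> hcoord x v -> exists i, aeval cubic^`M(i) v != 0.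
Proof.
move=> Ex xv; apply: contrapT => /forallNP H.
have {}H i : aeval cubic^`M(i) v = 0 by apply/eqP/negPn/negP; apply: H.
have dX (i j : 'I_3) : ('X_j : {mpoly K[3]})^`M(i) = (j == i)%:R.
  rewrite mderivX mnm1E; case: eqP => [->|_]; last by rewrite scale0r.
  by rewrite scale1r subm_self mpolyX0.
have e0 : ((0 : 'I_3) == 1 = false) * ((0 : 'I_3) == 2 = false) * ((1 : 'I_3) == 0 = false)
  * ((1 : 'I_3) == 2 = false) * ((2 : 'I_3) == 0 = false) * ((2 : 'I_3) == 1 = false) by [].
have dE := (dX, mderivB, mderivD, mderivZ, mderivM, expr2, exprS, expr0, mulr1, e0, eqxx).
have E0 : v 1 0 ^+ 2 = c2 * v 2 0 ^+ 2 + 2 * c1 * v 0 0 * v 2 0 + 3 * c0 * v 0 0 ^+ 2.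
  have := H 0; rewrite /cubic !dE /aeval !(mevalB, mevalD, mevalZ, mevalM, mevalXU, meval0, meval1) => e.
  apply/eqP; rewrite -subr_eq0 -[X in _ == X]e; apply/eqP; ring.
have E1 : 2 * v 0 0 * v 1 0 = 0.
  have := H 1; rewrite /cubic !dE /aeval !(mevalB, mevalD, mevalZ, mevalM, mevalXU, meval0, meval1) => e.
  rewrite -[RHS]e; ring.
have E2 : 3 * c3 * v 2 0 ^+ 2 + 2 * c2 * v 0 0 * v 2 0 + c1 * v 0 0 ^+ 2 = 0.
  have := H 2; rewrite /cubic !dE /aeval !(mevalB, mevalD, mevalZ, mevalM, mevalXU, meval0, meval1) => e.
  apply: oppr_inj; rewrite oppr0 -[RHS]e; ring.
have := Ex; move/(curveWP xv); rewrite /cubicE.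
have [v0|v0] := eqVneq (v 0 0) 0.
  case: xv => + _; rewrite col3_eq0 v0 eqxx /=.
  have v2 : v 2 0 = 0.
    move/eqP: E2; rewrite v0 !(mulr0, mul0r, expr0n, addr0) /= -mulrA mulf_eq0 pnatr_eq0 /=.
    by rewrite mulf_eq0 (negbTE c3_neq0) expf_eq0 => /eqP.
  move: E0; rewrite v0 v2 !(mulr0, mul0r, expr0n, addr0) /= => /eqP; rewrite expf_eq0 /= => ->.
  by rewrite eqxx.
have v1 : v 1 0 = 0.
  by move/eqP: E1; rewrite !mulf_eq0 pnatr_eq0 (negbTE v0) /= => /eqP.
rewrite v1 expr0n mulr0 => e.
have w0 : wf.[v 2 0 / v 0 0] = 0.
  rewrite wfE; apply: (mulfI (expf_neq0 3 v0)); rewrite mulr0 [RHS]e; field; exact: v0.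
case/eqP: (wf_sep w0); rewrite wf'E; apply: (mulfI (expf_neq0 2 v0)); rewrite mulr0 -[RHS]E2.
field; exact: v0.
Qed.

(** By [cubic_ideal] every form vanishing on the curve is a multiple of the cubic, so the tangent
    space is the kernel of its gradient, which is nonzero. *)
Lemma curveW_tangent x : curveW x -> exists2 U : {vspace 'cV[K]_3},
    (forall u, u \in U <-> affine_tangent_space curveW x u) & \dim U = 2%N.
Proof.
move=> Ex; have [v xv] := hcoord_ex x; have [i ci] := curveW_nonsingular Ex xv.
pose g : 'rV[K]_3 := \row_j aeval cubic^`M(j) v.
pose f : 'Hom('cV[K]_3, 'M[K]_1) := linfun (mulmx g).
exists (lker f).
  move=> u; rewrite memv_ker lfunE /=; split=> [/eqP gu p hp pE v' xv'|H].
    have [q ->] : exists q, p = cubic * q by apply: cubic_ideal => // y /ptsW_curveW; apply: pE.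
    have [c _ ->] := hcoord_scale xv xv'.
    have cv : aeval cubic (c *: v) = 0.
      by rewrite (dhomog_eval _ _ cubic_homog) (aeval_cubic v).2 ?mulr0 //; apply/(curveWP xv).
    transitivity (aeval q (c *: v) * c ^+ 2 * \sum_j aeval cubic^`M(j) v * u j 0).
      rewrite big_distrr /=; apply: eq_bigr => j _.
      rewrite /aeval mderivM mevalD !mevalM -!/(aeval _ _) cv mul0r addr0.
      have hd : cubic^`M(j) \is 2.-homog.
        have /dhomogP h3 := cubic_homog; apply/dhomogP => m; rewrite mcoeff_msupp mcoeff_deriv => Hm.
        have : (m + U_(j))%MM \in msupp cubic by rewrite mcoeff_msupp; apply: contraNneq Hm => ->; rewrite mul0rn.
        by move/h3 => /=; rewrite mdegD mdeg1 addn1 => -[].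
      by rewrite (dhomog_eval _ _ hd); ring.
    have /matrixP/(_ 0 0) := gu; rewrite !mxE => gu0.
    rewrite (eq_bigr (fun j => g 0 j * u j 0)) ?gu0 ?mulr0 // => j _; by rewrite mxE.
  apply/eqP/matrixP => a b; rewrite !ord1 !mxE.
  transitivity (\sum_j aeval cubic^`M(j) v * u j 0); first by apply: eq_bigr => j _; rewrite mxE.
  exact: H homogeneous_cubic (fun y Ey => Ey) _ xv.
have := limg_ker_dim f fullv; rewrite capfv dimvf /dim /= => e.
have d1 : \dim (limg f) = 1%N.
  apply/eqP; rewrite eqn_leq; apply/andP; split; first by rewrite (leq_trans (dimvS (subvf _))) // dimvf.
  rewrite lt0n dimv_eq0; apply/eqP => f0.
  have : f (delta_mx i 0) \in limg f by rewrite memv_img ?memvf.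
  rewrite f0 memv0 lfunE /= => /eqP/matrixP/(_ 0 0); rewrite -colE !mxE => /eqP.
  by rewrite (negbTE ci).
by move: e; rewrite d1 addn1 muln1 => -[].
Qed.

End PlaneCubic.

(** * The quotient *)

Lemma sumr_count (K : nzRingType) (A : eqType) (s : seq A) (a : pred A) (F : A -> K) c :
  (forall x, x \in s -> F x = if a x then c else 0) -> \sum_(x <- s) F x = c *+ count a s.
Proof.
move=> H; rewrite (eq_big_seq _ H) -big_mkcond /= big_const_seq.
by elim: (count a s) => // k IH; rewrite iterS IH mulrS.
Qed.

(** By linearity the sum of q(z) z vanishes for every polynomial q. A q vanishing at all values
    other than z0 leaves q(z0) z0 times the multiplicity of z0, which is nonzero in characteristic
    0. *)
Lemma power_sums0 (K : numFieldType) (zs : seq K) :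
  (forall j, \sum_(z <- zs) z ^+ j.+1 = 0) -> forall z, z \in zs -> z = 0.
Proof.
move=> H z0 z0s; apply: contrapT => /eqP z0n.
have Hq (q : {poly K}) : \sum_(z <- zs) q.[z] * z = 0.
  transitivity (\sum_(z <- zs) \sum_(i < size q) q`_i * z ^+ i.+1).
    by apply: eq_bigr => z _; rewrite horner_coef big_distrl; apply: eq_bigr => i _; rewrite exprSr mulrA.
  by rewrite exchange_big big1 // => i _; rewrite -mulr_sumr H mulr0.
pose q : {poly K} := \prod_(y <- [seq y <- zs | y != z0]) ('X - y%:P).
have q0 : q.[z0] != 0.
  by rewrite /q -rootE root_prod_XsubC mem_filter eqxx.
have := Hq q; rewrite (@sumr_count _ _ _ (pred1 z0) _ (q.[z0] * z0)) => [|z zs' /=]; last first.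
  case: eqP => [->//|/eqP zn]; suff /rootP -> : root q z by rewrite mul0r.
  by rewrite /q root_prod_XsubC mem_filter zn.
by move/eqP; rewrite mulrn_eq0 !mulf_eq0 (negbTE q0) (negbTE z0n) orbF -leqn0 leqNgt -has_count has_pred1 z0s.
Qed.

Lemma separating_poly (K : fieldType) n (l : seq 'cV[K]_n) u : u \notin l ->
  exists2 f : {mpoly K[n]}, aeval f u != 0 & forall y, y \in l -> aeval f y = 0.
Proof.
elim: l => [|y l IH]; first by exists 1 => //; rewrite /aeval meval1 oner_neq0.
rewrite inE negb_or => /andP[uy /IH [f fu fl]].
have [i ui] : exists i, u i 0 != y i 0.
  by apply: contrapT => /forallNP H; case/eqP: uy; apply/colP => i; apply/eqP/negPn/negP/H.
exists (('X_i - (y i 0)%:MP) * f).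
  by rewrite /aeval mevalM mevalB mevalXU mevalC mulf_neq0 // subr_eq0.
move=> y'; rewrite inE /aeval mevalM => /predU1P [->|/fl]; last by rewrite /aeval => ->; rewrite mulr0.
by rewrite mevalB mevalXU mevalC subrr mul0r.
Qed.

Lemma dhomog_monom (K : fieldType) n (i : 'X_{1..n}) : ('X_[i] : {mpoly K[n]}) \is (mdeg i).-homog.
Proof. by rewrite dhomogX. Qed.

Section Quotient.
Variables (K : numClosedFieldType) (Gr : seq 'M[K]_3) (P Q R S : {mpoly K[3]}) (m : nat).
Variables (r t c3 c2 c1 c0 : K).
Hypothesis m_gt0 : (0 < m)%N.
Hypothesis P_homog : P \is 2.-homog.
Hypothesis Q_homog : Q \is (m.+1).-homog.
Hypothesis R_homog : R \is (2 * m).-homog.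
Hypothesis S_homog : S \is (3 * m).-homog.
Hypothesis Gr1 : 1%:M \in Gr.
Hypothesis Gr_inv : forall g, g \in Gr ->
  [/\ mact g P = P, mact g Q = Q, mact g R = R & mact g S = S].
Hypothesis Gr_rep : forall k f, f \is k.-homog ->
  exists2 s : seq (K * (nat * nat * nat * nat)),
    all (fun x => let: (_, (a, b, e, d)) := x in
      (2 * a + m.+1 * b + 2 * m * e + 3 * m * d == k)%N) s &
    \sum_(g <- Gr) mact g f =
    \sum_(x <- s) (let: (z, (a, b, e, d)) := x in z *: (P ^+ a * Q ^+ b * R ^+ e * S ^+ d)).
Hypothesis rel : forall u w, aeval P u = r * w ^+ 2 -> aeval Q u = t * w ^+ m.+1 ->
  aeval S u ^+ 2 = c3 * aeval R u ^+ 3 + c2 * (w ^+ m) ^+ 2 * aeval R u ^+ 2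
    + c1 * (w ^+ m) ^+ 4 * aeval R u + c0 * (w ^+ m) ^+ 6.
Hypothesis c3_neq0 : c3 != 0.
Hypothesis wf_sep : forall x, (wf c3 c2 c1 c0).[x] = 0 -> (wf c3 c2 c1 c0)^`().[x] != 0.
Hypothesis surj : forall s x, s ^+ 2 = (wf c3 c2 c1 c0).[x] ->
  exists u, [/\ aeval P u = r, aeval Q u = t, aeval S u = s & aeval R u = x].
Hypothesis inf : exists2 u, u != 0 & aeval P u = 0 /\ aeval Q u = 0.

(** Orbit sums are polynomials in P, Q, R, S, hence agree at u and u'. If u' were outside the orbit
    of u, some f nonzero at u' would vanish on that orbit and on the other translates of u'; its
    sums would be 0 and a positive multiple of f(u'). *)
Lemma orbit_separation u u' : aeval P u' = aeval P u -> aeval Q u' = aeval Q u ->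
  aeval R u' = aeval R u -> aeval S u' = aeval S u -> exists2 g, g \in Gr & u' = g *m u.
Proof.
move=> eP eQ eR eS; apply: contrapT => /forall2NP nG.
have avg f : \sum_(g <- Gr) aeval f (g *m u') = \sum_(g <- Gr) aeval f (g *m u).
  have E v : \sum_(g <- Gr) aeval f (g *m v) =
      \sum_(i <- msupp f) f@_i * aeval (\sum_(g <- Gr) mact g 'X_[i]) v.
    rewrite {1}[f]mpolyE (eq_bigr (fun g => \sum_(i <- msupp f) f@_i * aeval (mact g 'X_[i]) v)).
      rewrite exchange_big; apply: eq_bigr => i _; rewrite -big_distrr; congr (_ * _).
      by rewrite /aeval rmorph_sum.
    by move=> g _; rewrite {1}/aeval rmorph_sum; apply: eq_bigr => i _; rewrite /= mevalZ aeval_mact.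
  rewrite !E; apply: eq_bigr => i _; congr (_ * _).
  have [s _ ->] := @Gr_rep (mdeg i) 'X_[i] (dhomog_monom K _).
  by rewrite /aeval !rmorph_sum; apply: eq_bigr => -[z [[[a b] e] d]] _ /=;
    rewrite !mevalZ !mevalM !mevalXn -!/(aeval _ _) eP eQ eR eS.
pose l := [seq g *m u | g <- Gr] ++ [seq g *m u' | g <- Gr & g *m u' != u'].
have /separating_poly [f fu fl] : u' \notin l.
  rewrite mem_cat negb_or; apply/andP; split.
    by apply/mapP => -[g gG e]; case: (nG g).
  by apply/mapP => -[g]; rewrite mem_filter => /andP[/eqP + _] e; case.
have := avg f; rewrite [in RHS]big_seq [in RHS]big1 => [|g gG]; last first.
  by apply: fl; rewrite mem_cat (map_f (fun g => g *m u)) ?gG.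
rewrite (@sumr_count _ _ _ (fun g => g *m u' == u') _ (aeval f u')) => [/eqP|g gG]; last first.
  case: eqP => [->//|/eqP gu]; apply: fl; rewrite mem_cat; apply/orP; right.
  by apply: (map_f (fun g => g *m u')); rewrite mem_filter gu.
rewrite mulrn_eq0 (negbTE fu) orbF -leqn0 leqNgt -has_count => /negP; apply.
by apply/hasP; exists 1%:M => //; rewrite mul1mx.
Qed.

Definition dv (v : 'cV[K]_4) : 'cV[K]_3 := dsubmx (v : 'cV[K]_(1 + 3)).
Definition gact (g : 'M[K]_3) (v : 'cV[K]_4) : 'cV[K]_4 :=
  (block_mx 1%:M 0 0 g : 'M_(1 + 3)) *m v.
Definition cv (c : K) (u : 'cV[K]_3) : 'cV[K]_4 := (col_mx c%:M u : 'cV_(1 + 3)).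
Definition lift4 (p : {mpoly K[3]}) : {mpoly K[4]} := p \mPo [tuple 'X_(rshift 1 i) | i < 3].
Definition cone v := aeval P (dv v) = r * v 0 0 ^+ 2 /\ aeval Q (dv v) = t * v 0 0 ^+ m.+1.
(* (S, R) in homogeneous coordinates: the three entries have the same degree 3m. *)
Definition Phi (v : 'cV[K]_4) : 'cV[K]_3 :=
  col3 (v 0 0 ^+ (3 * m)) (aeval S (dv v)) (aeval R (dv v) * v 0 0 ^+ m).

Lemma dv_cv c u : dv (cv c u) = u.
Proof. by rewrite /dv /cv col_mxKd. Qed.

Lemma usub0 (v : 'cV[K]_4) : usubmx (v : 'cV[K]_(1 + 3)) = (v 0 0)%:M.
Proof.
apply/matrixP => i j; rewrite !ord1 !mxE eqxx mulr1n; congr (v _ _); exact: val_inj.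
Qed.

Lemma cv0 c u : cv c u 0 0 = c.
Proof. by have := usub0 (cv c u); rewrite col_mxKu => /matrixP/(_ 0 0); rewrite !mxE eqxx. Qed.

Lemma cvE (v : 'cV[K]_4) : v = cv (v 0 0) (dv v).
Proof. by rewrite /cv -usub0 /dv vsubmxK. Qed.

Lemma gact_cv g c u : gact g (cv c u) = cv c (g *m u).
Proof. by rewrite /gact /cv mul_block_col !mul0mx addr0 add0r mul1mx. Qed.

Lemma gact0 g v : gact g v 0 0 = v 0 0.
Proof. by rewrite [v]cvE gact_cv !cv0. Qed.

Lemma gact_dv g v : dv (gact g v) = g *m dv v.
Proof. by rewrite [v]cvE gact_cv !dv_cv. Qed.

Lemma aeval_lift4 p v : aeval (lift4 p) v = aeval p (dv v).
Proof.
rewrite /aeval /lift4 comp_mpoly_meval; apply: meval_eq => i.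
by rewrite tnth_mktuple mevalXU mxE.
Qed.

Lemma lift4_homog p d : p \is d.-homog -> lift4 p \is d.-homog.
Proof.
move=> hp; rewrite -[d]muln1; apply: dhomog_comp => // i.
by rewrite tnth_mktuple; apply: dhomog_var.
Qed.

Lemma aevalXm (mm : 'X_{1..4}) : exists2 mm' : 'X_{1..3}, (mm 0%R + mdeg mm' = mdeg mm)%N &
  forall v, aeval 'X_[mm] v = v 0 0 ^+ mm 0 * aeval 'X_[mm'] (dv v).
Proof.
have e : lshift 3 (0 : 'I_1) = 0 :> 'I_4 by apply: val_inj.
exists [multinom mm (rshift 1 i : 'I_4) | i < 3].
  rewrite !mdegE (@big_split_ord _ _ _ 1 3) big_ord1 e; congr addn.
  by apply: eq_bigr => i _; rewrite mnmE.
move=> v; rewrite /aeval !mevalX (@big_split_ord _ _ _ 1 3) big_ord1 e; congr (_ * _).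
by apply: eq_bigr => i _; rewrite mnmE mxE.
Qed.

Lemma cone_gact g v : g \in Gr -> cone v -> cone (gact g v).
Proof.
by move=> /Gr_inv [iP iQ _ _] [cP cQ]; rewrite /cone gact0 gact_dv -!aeval_mact iP iQ.
Qed.

Lemma Phi_gact g v : g \in Gr -> Phi (gact g v) = Phi v.
Proof. by move=> /Gr_inv [_ _ iR iS]; rewrite /Phi gact0 gact_dv -!aeval_mact iR iS. Qed.

Lemma PhiZ c v : Phi (c *: v) = c ^+ (3 * m) *: Phi v.
Proof.
have e : dv (c *: v) = c *: dv v by apply/colP => i; rewrite !mxE.
rewrite [RHS]col3Z /Phi !mxE /= e (dhomog_eval _ _ S_homog) (dhomog_eval _ _ R_homog) !exprMn.
congr col3; rewrite (_ : 3 * m = 2 * m + m)%N ?exprD; last by lia.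
by rewrite !mulrA; congr (_ * _); rewrite mulrAC.
Qed.

Lemma cone_cubic v : cone v -> cubicE c3 c2 c1 c0 (Phi v).
Proof.
move=> [cP cQ]; rewrite /cubicE !mxE /= (rel cP cQ) mulnC exprM.
move: (v 0 0 ^+ m) (aeval R (dv v)) => a b; ring.
Qed.

(** If [Phi v] were 0, then w = 0 and S = 0, so R = 0 by the relation and P = Q = 0 on the cone. All
    four invariants would then agree with those at 0, and [orbit_separation] gives v = 0. *)
Lemma Phi_neq0 v : cone v -> v != 0 -> Phi v != 0.
Proof.
move=> [cP cQ] v0; rewrite col3_eq0 !mxE /= expf_eq0 muln_gt0 m_gt0 /=.
have [w0 /=|//] := eqVneq (v 0 0) 0; apply/negP => /andP[/eqP S0 _].
have m0 : (m == 0)%N = false by rewrite eqn0Ngt m_gt0.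
have := rel cP cQ; rewrite S0 w0 !expr0n m0 !(expr0n, mul0r, mulr0, addr0) /= => /esym/eqP.
rewrite mulf_eq0 (negbTE c3_neq0) expf_eq0 /= => /eqP R0.
move: cP cQ; rewrite w0 !expr0n /= !mulr0 => P0 Q0.
have z0 (p : {mpoly K[3]}) d : p \is d.-homog -> (0 < d)%N -> aeval p (0 : 'cV_3) = 0.
  by move=> hp d0; rewrite -(scale0r 0) (dhomog_eval _ _ hp) expr0n eqn0Ngt d0 mul0r.
have [g _ e] : exists2 g, g \in Gr & dv v = g *m 0.
  apply: orbit_separation; rewrite ?P0 ?Q0 ?R0 ?S0; apply/esym.
  - by apply: (z0 _ _ P_homog).
  - by apply: (z0 _ _ Q_homog).
  - by apply: (z0 _ _ R_homog); rewrite muln_gt0.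
  - by apply: (z0 _ _ S_homog); rewrite muln_gt0.
case/eqP: v0; rewrite [v]cvE e w0 mulmx0 /cv.
by apply/colP => i; rewrite !mxE; case: splitP => j _; rewrite !mxE ?mul0rn.
Qed.

(** Functions on the cone that come from a form of degree n on the plane of the cubic. *)
Definition rep n (h : 'cV[K]_4 -> K) :=
  exists2 q : {mpoly K[3]}, q \is n.-homog & forall v, cone v -> h v = aeval q (Phi v).

Lemma rep_ext n h h' : (forall v, cone v -> h v = h' v) -> rep n h' -> rep n h.
Proof. by move=> e [q hq H]; exists q => // v cv; rewrite e // H. Qed.

Lemma repD n h h' : rep n h -> rep n h' -> rep n (fun v => h v + h' v).
Proof.
move=> [q hq H] [q' hq' H']; exists (q + q'); first exact: rpredD.
by move=> v cv; rewrite /aeval mevalD -!/(aeval _ _) H ?H'.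
Qed.

Lemma repZ n c h : rep n h -> rep n (fun v => c * h v).
Proof.
by move=> [q hq H]; exists (c *: q); [exact: rpredZ|move=> v cv; rewrite /aeval mevalZ H].
Qed.

Lemma rep_sum n (I : eqType) (s : seq I) (F : I -> 'cV[K]_4 -> K) :
  (forall i, i \in s -> rep n (F i)) -> rep n (fun v => \sum_(i <- s) F i v).
Proof.
elim: s => [|i s IH] H.
  by exists 0; [exact: dhomog0|move=> v _; rewrite big_nil /aeval meval0].
apply: (@rep_ext _ _ (fun v => F i v + \sum_(i <- s) F i v)); first by move=> v _; rewrite big_cons.
by apply: repD; [apply: H; rewrite mem_head|apply: IH => j js; apply: H; rewrite inE js orbT].
Qed.

(* When the power of X_0 is too small, R^3 is traded for terms with fewer R by the relation. *)
Lemma rep_mono n j e d : (j + 2 * e + 3 * d = 3 * n)%N ->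
  rep n (fun v => v 0 0 ^+ (m * j) * aeval R (dv v) ^+ e * aeval S (dv v) ^+ d).
Proof.
have [k] := ubnP e; elim: k j e d => // k IH j e d; rewrite ltnS => ek E.
have [je|ej] := leqP e j.
  (* Each X_2 supplies one R and uses one w^m. The j - e factors w^m left over equal 3 (n - e - d),
     that is, n - e - d copies of X_0. *)
  exists ('X_0 ^+ (n - e - d) * 'X_2 ^+ e * 'X_1 ^+ d).
    have X i k' : ('X_i ^+ k' : {mpoly K[3]}) \is k'.-homog.
      by have := dhomogMn k' (dhomog_var K i); rewrite mul1n.
    have := dhomogM (dhomogM (X 0 (n - e - d)%N) (X 2 e)) (X 1 d).
    by rewrite (_ : n - e - d + e + d = n)%N //; lia.
  move=> v _; rewrite /aeval !mevalM !mevalXn !mevalXU !mxE /=.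
  congr (_ * _); rewrite exprMn -!exprM mulrCA [RHS]mulrC -exprD; congr (_ ^+ _ * _); nia.
(* The degree equation makes e - j a multiple of 3, so e > j implies e >= 3. *)
have [i ei] : exists i, e = (i + 3)%N by exists (e - 3)%N; lia.
have [e1 e2] : (e - 1 = i + 2)%N /\ (e - 2 = i + 1)%N by lia.
apply: (@rep_ext _ _ (fun v => c3^-1 * ((v 0 0 ^+ (m * j) * aeval R (dv v) ^+ (e - 3) * aeval S (dv v) ^+ (d + 2))
   + (- c2) * (v 0 0 ^+ (m * (j + 2)) * aeval R (dv v) ^+ (e - 1) * aeval S (dv v) ^+ d)
   + (- c1) * (v 0 0 ^+ (m * (j + 4)) * aeval R (dv v) ^+ (e - 2) * aeval S (dv v) ^+ d)
   + (- c0) * (v 0 0 ^+ (m * (j + 6)) * aeval R (dv v) ^+ (e - 3) * aeval S (dv v) ^+ d)))).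
  move=> v [cP cQ]; have := rel cP cQ.
  rewrite e1 e2 ei addnK !exprM !exprD; move: (v 0 0 ^+ m) (aeval R (dv v)) (aeval S (dv v)) => a b c H.
  by rewrite H; field; exact: c3_neq0.
apply: repZ; apply: repD; [apply: repD; [apply: repD|]|]; try apply: repZ; apply: IH; lia.
Qed.

Lemma rotation_sum n f : f \is (3 * m * n).-homog ->
  rep n (fun v => \sum_(g <- Gr) aeval f (gact g v)).
Proof.
move=> /dhomogP hf.
apply: (@rep_ext _ _ (fun v => \sum_(mm <- msupp f) f@_mm * \sum_(g <- Gr) aeval 'X_[mm] (gact g v))).
  move=> v _; transitivity (\sum_(g <- Gr) \sum_(mm <- msupp f) f@_mm * aeval 'X_[mm] (gact g v)).
    apply: eq_bigr => g _; rewrite {1}[f]mpolyE /aeval rmorph_sum.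
    by apply: eq_bigr => i _; rewrite /= mevalZ.
  by rewrite exchange_big; apply: eq_bigr => i _; rewrite mulr_sumr.
apply: rep_sum => mm /hf /= mdeg_mm; apply: repZ.
have [mm' mE XE] := aevalXm mm.
have [s /allP /= ws sE] := @Gr_rep (mdeg mm') 'X_[mm'] (dhomog_monom K _).
apply: (@rep_ext _ _ (fun v => \sum_(x <- s) let: (z, (a, b, e, d)) := x in
    z * r ^+ a * t ^+ b * (v 0 0 ^+ (mm 0%R + 2 * a + m.+1 * b) * aeval R (dv v) ^+ e * aeval S (dv v) ^+ d))).
  move=> v [cP cQ].
  transitivity (v 0 0 ^+ mm 0%R * aeval (\sum_(g <- Gr) mact g 'X_[mm']) (dv v)).
    rewrite [in RHS]/aeval rmorph_sum big_distrr; apply: eq_bigr => g _.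
    by rewrite XE gact0 gact_dv -aeval_mact.
  rewrite sE /aeval rmorph_sum big_distrr; apply: eq_bigr => -[z [[[a b] e] d]] _ /=.
  rewrite mevalZ !mevalM !mevalXn -!/(aeval _ _) cP cQ !exprMn -!exprM !exprD.
  ring.
apply: rep_sum => -[z [[[a b] e] d]] /ws /eqP W; apply: repZ.
(* On the cone P and Q have become powers of w. The total exponent of w is a multiple of m because
   the whole degree 3mn and the contributions of R and S are. *)
have [j jE] : exists j, (mm 0%R + 2 * a + m.+1 * b = m * j)%N.
  exists (3 * n - 2 * e - 3 * d)%N; rewrite !mulnBr; move: mE; rewrite mdeg_mm -W.
  by rewrite -(mulnA 2) -(mulnA 3) -(mulnA 3); rewrite !(mulnCA m); lia.
rewrite jE; apply: rep_mono; apply/eqP; rewrite -(eqn_pmul2l m_gt0); apply/eqP.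
rewrite !mulnDr -jE; move: mE; rewrite mdeg_mm -W; nia.
Qed.

Definition pull (q : {mpoly K[3]}) : {mpoly K[4]} :=
  q \mPo [tuple 'X_0 ^+ (3 * m); lift4 S; lift4 R * 'X_0 ^+ m].

Lemma aeval_pull q v : aeval (pull q) v = aeval q (Phi v).
Proof.
rewrite {1}/aeval /pull comp_mpoly_meval; apply: meval_eq => i.
rewrite (tnth_nth 0) mxE; case: i => -[|[|[|//]]] i3 /=.
- by rewrite mevalXn mevalXU.
- exact: aeval_lift4.
- by rewrite mevalM mevalXn mevalXU -/(aeval _ _) aeval_lift4.
Qed.

Lemma pull_homog q d : q \is d.-homog -> pull q \is (d * (3 * m)).-homog.
Proof.
move=> hq; apply: dhomog_comp => // i.
have X k : ('X_0 ^+ k : {mpoly K[4]}) \is k.-homog.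
  by have := dhomogMn k (@dhomog_var K 4 0); rewrite mul1n.
rewrite (tnth_nth 0); case: i => -[|[|[|//]]] i3 /=; [exact: X|exact: lift4_homog|].
by have := dhomogM (lift4_homog R_homog) (X m); rewrite (_ : 2 * m + m = 3 * m)%N //; lia.
Qed.

Lemma homogeneous_pull q : homogeneous q -> homogeneous (pull q).
Proof. by move=> [d /pull_homog hq]; exists (d * (3 * m))%N. Qed.

Definition cP : {mpoly K[4]} := lift4 P - r *: 'X_0 ^+ 2.
Definition cQ : {mpoly K[4]} := lift4 Q - t *: 'X_0 ^+ m.+1.
(** The locus of the homogenised equations contains the closure of the affine curve; [zclosure_affX]
    excludes further points at infinity. *)
Definition coneX : set (proj K 3) := [set x | vanishes_at cP x /\ vanishes_at cQ x].

Lemma homogeneous_cPQ : homogeneous cP /\ homogeneous cQ.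
Proof.
have X k : ('X_0 ^+ k : {mpoly K[4]}) \is k.-homog.
  by have := dhomogMn k (@dhomog_var K 4 0); rewrite mul1n.
split; [exists 2%N|exists m.+1].
  exact: rpredB (lift4_homog P_homog) (rpredZ _ (X 2%N)).
exact: rpredB (lift4_homog Q_homog) (rpredZ _ (X m.+1)).
Qed.

Lemma coneXP x v : hcoord x v -> coneX x <-> cone v.
Proof.
move=> xv; have [hP hQ] := homogeneous_cPQ.
have E p q k : aeval (lift4 p - q *: 'X_0 ^+ k) v = 0 <-> aeval p (dv v) = q * v 0 0 ^+ k.
  rewrite -aeval_lift4 /aeval mevalB mevalZ mevalXn mevalXU.
  by split=> [/eqP|->]; rewrite ?subrr // subr_eq0 => /eqP.
by rewrite /coneX /cone /= (vanishesP hP xv) (vanishesP hQ xv) /cP /cQ !E.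
Qed.

Lemma zclosed_coneX : zclosed coneX.
Proof.
have [hP hQ] := homogeneous_cPQ; exists [set p | p = cP \/ p = cQ]; first by move=> p [] ->.
by apply/seteqP; split=> x /= => [[h h'] p [] ->|h] //; split; apply: h; [left|right].
Qed.

(** [vpick] takes some representative; on the cone [phiP] removes the dependence on it by the
    homogeneity of [Phi]. *)
Definition phi (x : proj K 3) : proj K 2 := mkproj (Phi (vpick (sval x))).
Definition Gam : set 'M[K]_4 :=
  [set (block_mx 1%:M 0 0 g : 'M_(1 + 3)) | g in [set g | g \in Gr]].
Definition Y : set (proj K 2) := curveW c3 c2 c1 c0.

Lemma phiP x v : coneX x -> hcoord x v -> hcoord (phi x) (Phi v).
Proof.
move=> Xx xv; have xv0 : hcoord x (vpick (sval x)).
  split; last exact: memv_pick.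
  by rewrite vpick0 -dimv_eq0; have /eqP -> := svalP x.
have [c c0' ->] := hcoord_scale xv0 xv; rewrite PhiZ.
apply: hcoordZ; first exact: expf_neq0.
by apply/hcoord_mkproj/Phi_neq0; [apply/(coneXP xv0)|case: xv0].
Qed.

Lemma phi_Y x : coneX x -> Y (phi x).
Proof.
move=> Xx; have [v xv] := hcoord_ex x; apply/(curveWP _ _ _ _ (phiP Xx xv)).
by apply: cone_cubic; apply/(coneXP xv).
Qed.

Lemma gact_neq0 g v : g \in Gr -> cone v -> v != 0 -> gact g v != 0.
Proof.
move=> gG cv v0; have := Phi_neq0 cv v0; rewrite -(Phi_gact v gG); apply: contra_neq => ->.
by rewrite -(scale0r 0) PhiZ expr0n muln_eq0 (eqn0Ngt m) m_gt0 /= scale0r.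
Qed.

Lemma same_orbitP x y v : coneX x -> hcoord x v ->
  same_orbit Gam x y <-> exists2 g, g \in Gr & hcoord y (gact g v).
Proof.
move=> Xx xv; have cv : cone v by apply/(coneXP xv).
have [v0 xE] := (hcoordP _ _).1 xv.
have L (M : 'M[K]_4) : (linfun (mulmx M) @: sval x)%VS = <[M *m v]>%VS.
  by rewrite xE limg_line lfunE.
split=> [[_ [g /= gG <-]]|[g gG /hcoordP [_ yE]]].
  by rewrite L => yE; exists g => //; apply/hcoordP; split=> //; apply: gact_neq0.
by exists (block_mx 1%:M 0 0 g : 'M_(1 + 3)); [exists g|rewrite L].
Qed.

Lemma phi_orbit x y v g : coneX x -> hcoord x v -> g \in Gr -> hcoord y (gact g v) ->
  coneX y /\ phi y = phi x.
Proof.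
move=> Xx xv gG yv; have Xy : coneX y.
  by apply/(coneXP yv)/cone_gact => //; apply/(coneXP xv).
split=> //; have := phiP Xy yv; rewrite Phi_gact // => h.
exact: hcoord_inj h (phiP Xx xv).
Qed.

(** The exponent 3m makes the degree a multiple of 3m, as [rotation_sum] requires; letting j vary
    provides all power sums for [power_sums0]. *)
Lemma sum_pow f d j : f \is d.-homog ->
  rep (d * j.+1) (fun v => \sum_(g <- Gr) (aeval f (gact g v) ^+ (3 * m)) ^+ j.+1).
Proof.
move=> hf; apply: (@rep_ext _ _ (fun v => \sum_(g <- Gr) aeval ((f ^+ (3 * m)) ^+ j.+1) (gact g v))).
  by move=> v _; apply: eq_bigr => g _; rewrite [in RHS]/aeval !mevalXn.
apply: rotation_sum; have := dhomogMn j.+1 (dhomogMn (3 * m) hf).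
by rewrite (_ : d * (3 * m) * j.+1 = 3 * m * (d * j.+1))%N //; lia.
Qed.

Lemma sum_pow_eq0 f v g : (forall j, \sum_(g <- Gr) (aeval f (gact g v) ^+ (3 * m)) ^+ j.+1 = 0) ->
  g \in Gr -> aeval f (gact g v) = 0.
Proof.
move=> H gG; have := @power_sums0 K [seq aeval f (gact g v) ^+ (3 * m) | g <- Gr].
move=> /(_ _ _ (map_f _ gG)) => /(_ (fun j => _)) h.
have /eqP : aeval f (gact g v) ^+ (3 * m) = 0 by apply: h => j; rewrite big_map.
by rewrite expf_eq0 => /andP[_ /eqP].
Qed.

Definition affX : set (proj K 3) :=
  [set affine_pt u | u in [set u | aeval P u = r /\ aeval Q u = t]].

Lemma cone_affine u : aeval P u = r -> aeval Q u = t -> cone (cv 1 u).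
Proof. by move=> hP hQ; rewrite /cone dv_cv cv0 !expr1n !mulr1. Qed.

Lemma hcoord_cv u : hcoord (affine_pt u) (cv 1 u).
Proof. exact: hcoord_affine. Qed.

Lemma Phi_cv u : Phi (cv 1 u) = col3 1 (aeval S u) (aeval R u).
Proof. by rewrite /Phi dv_cv cv0 !expr1n mulr1. Qed.

Lemma gact1 v : gact 1%:M v = v.
Proof. by rewrite [v]cvE gact_cv mul1mx. Qed.

(** If p vanishes on the affine curve, the power sums of its values on orbits descend to forms
    vanishing on the affine part of the cubic, hence on its point at infinity too. So p vanishes on
    the whole cone. *)
Lemma zclosure_affX : zclosure affX = coneX.
Proof.
apply/seteqP; split.
  apply: zclosure_min; first exact: zclosed_coneX.
  by move=> _ [u [hP hQ] <-]; apply/(coneXP (hcoord_cv u))/cone_affine.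
move=> x Xx; apply/zclosureP => p hp pv; have [v xv] := hcoord_ex x.
apply/(vanishesP hp xv); rewrite -[v]gact1; apply: sum_pow_eq0 => // j.
have [d hd] := hp; have [q hq qE] := sum_pow j hd.
rewrite qE; last by apply/(coneXP xv).
apply: (@ptsW_curveW_vanishes K c3 c2 c1 c0 c3_neq0 q) (phi_Y Xx) _ (phiP Xx xv); first by exists (d * j.+1)%N.
move=> _ [w ww <-]; have [u [uP uQ uS uR]] := surj ww.
have hq' : homogeneous q by exists (d * j.+1)%N.
apply/(vanishesP hq' (hcoord_aff w)); rewrite -uS -uR -Phi_cv -qE; last exact: cone_affine.
apply: big1_seq => g /andP[_ gG].
have -> : aeval p (gact g (cv 1 u)) = 0; last by rewrite -exprM expr0n !muln_eq0 (eqn0Ngt m) m_gt0.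
have [iP iQ _ _] := Gr_inv gG; rewrite gact_cv; apply: pv (hcoord_cv _).
by exists (g *m u) => //=; rewrite -!aeval_mact iP iQ.
Qed.

Lemma phi_surj y : Y y -> exists2 x, coneX x & phi x = y.
Proof.
move=> Yy; have [[w ww <-]|yv] := curveW_cases c3_neq0 Yy.
  have [u [uP uQ uS uR]] := surj ww; exists (affine_pt u).
    by apply/(coneXP (hcoord_cv u))/cone_affine.
  have Xu : coneX (affine_pt u) by apply/(coneXP (hcoord_cv u))/cone_affine.
  have := phiP Xu (hcoord_cv u); rewrite Phi_cv uS uR => h.
  exact: hcoord_inj h (hcoord_aff w).
have [u u0 [uP uQ]] := inf.
have z0 : cv 0 u != 0.
  by apply: contra_neq u0 => e; rewrite -(dv_cv 0 u) e; apply/colP => i; rewrite !mxE.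
have cz : cone (cv 0 u) by rewrite /cone dv_cv cv0 !expr0n /= !mulr0.
have h := hcoord_mkproj z0; have Xh : coneX (mkproj (cv 0 u)) by apply/(coneXP h).
exists (mkproj (cv 0 u)) => //.
have := phiP Xh h; rewrite /Phi cv0 dv_cv !expr0n muln_eq0 (eqn0Ngt m) m_gt0 /= mulr0 => hh.
have S0 : aeval S u != 0.
  by case: hh => + _; rewrite col3_eq0 !mxE /= eqxx andbT.
apply/esym/(hcoord_inj yv); have := hcoordZ (invr_neq0 S0) hh.
by rewrite col3Z !mxE /= !mulr0 mulVf.
Qed.

(** Representatives of two points with the same image are rescaled until P, Q, R, S and w all agree;
    then [orbit_separation] applies. For w != 0 the scale is the ratio of the two values of w. *)
Lemma phi_fibre x y : coneX x -> coneX y -> phi x = phi y <-> same_orbit Gam x y.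
Proof.
move=> Xx Xy; have [v xv] := hcoord_ex x; have [v' yv'] := hcoord_ex y.
have cv1 : cone v by apply/(coneXP xv).
rewrite (same_orbitP _ Xx xv); split=> [e|[g gG yv]]; last by have [_ ->] := phi_orbit Xx xv gG yv.
have := phiP Xy yv'; rewrite -e => /(hcoord_scale (phiP Xx xv)) [c c_neq0 PE].
suff [l [g [l0 gG vE]]] : exists l g, [/\ l != 0, g \in Gr & l *: v' = gact g v].
  by exists g => //; rewrite -vE; apply: hcoordZ.
have cv' : cone v' by apply/(coneXP yv').
have [vn vn'] : v != 0 /\ v' != 0 by case: xv => ? _; case: yv' => ? _.
have PE0 i : Phi v' i 0 = c * Phi v i 0 by rewrite PE mxE.
have := PE0 0; rewrite !mxE /= => w3.
have := PE0 1; rewrite !mxE /= => S3.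
have := PE0 2; rewrite !mxE /= => R3.
have m3 : (0 < 3 * m)%N by rewrite muln_gt0.
have [w0|w0] := eqVneq (v 0 0) 0.
  have w0' : v' 0 0 = 0.
    by move/eqP: w3; rewrite w0 expr0n eqn0Ngt m3 mulr0 expf_eq0 m3 => /eqP.
  have main (z : 'cV[K]_4) : cone z -> z != 0 -> z 0 0 = 0 -> [/\ aeval P (dv z) = 0, aeval Q (dv z) = 0,
      aeval S (dv z) ^+ 2 = c3 * aeval R (dv z) ^+ 3, aeval S (dv z) != 0 & aeval R (dv z) != 0].
    move=> cz z0 zw; have [zP zQ] := cz; have := rel zP zQ; move: zP zQ.
    rewrite zw !expr0n (eqn0Ngt m) m_gt0 !(expr0n, mulr0, mul0r, addr0) /= => zP zQ zS.
    have S0 : aeval S (dv z) != 0.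
      have := Phi_neq0 cz z0; rewrite col3_eq0 !mxE /= zw !expr0n (eqn0Ngt m) m_gt0 mulr0 eqxx andbT.
      by rewrite muln_eq0 (eqn0Ngt m) m_gt0 /= eqxx.
    split=> //; apply: contraNneq S0 => R0; move/eqP: zS.
    by rewrite R0 expr0n mulr0 expf_eq0.
  have [vP vQ vS S0 R0] := main v cv1 vn w0; have [vP' vQ' vS' S0' R0'] := main v' cv' vn' w0'.
  (* The cusp S^2 = c3 R^3 is parametrised by tau = S / R, with R = tau^2 / c3 and S = tau^3 / c3;
     [mu] is the ratio of the two parameters. *)
  pose mu := (aeval S (dv v) / aeval R (dv v)) / (aeval S (dv v') / aeval R (dv v')).
  have mu0 : mu != 0 by rewrite !mulf_neq0 ?invr_eq0 // mulf_neq0 ?invr_eq0.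
  have mu3 : mu ^+ 3 * aeval S (dv v') = aeval S (dv v).
    apply: (mulfI c3_neq0); rewrite /mu !expr_div_n.
    have -> : aeval R (dv v) ^+ 3 = aeval S (dv v) ^+ 2 / c3 by rewrite vS mulrC mulKf.
    have -> : aeval R (dv v') ^+ 3 = aeval S (dv v') ^+ 2 / c3 by rewrite vS' mulrC mulKf.
    by field; rewrite S0 S0' c3_neq0.
  have mu2 : mu ^+ 2 * aeval R (dv v') = aeval R (dv v).
    rewrite /mu !expr_div_n vS vS'; field; by rewrite R0 R0' c3_neq0.
  (* R and S have degrees 2m and 3m, so scaling by l multiplies them by mu^2 and mu^3. *)
  pose l := m.-root mu; have lm : l ^+ m = mu by rewrite /l rootCK.
  have l0 : l != 0 by apply: contraNneq mu0 => l0; rewrite -lm l0 expr0n eqn0Ngt m_gt0.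
  have dvZ : dv (l *: v') = l *: dv v' by apply/colP => i; rewrite !mxE.
  have [g gG gE] : exists2 g, g \in Gr & l *: dv v' = g *m dv v.
    apply: orbit_separation.
    - by rewrite (dhomog_eval _ _ P_homog) vP vP' mulr0.
    - by rewrite (dhomog_eval _ _ Q_homog) vQ vQ' mulr0.
    - by rewrite (dhomog_eval _ _ R_homog) mulnC exprM lm.
    - by rewrite (dhomog_eval _ _ S_homog) mulnC exprM lm.
  exists l, g; split=> //; rewrite [LHS]cvE dvZ gE [in RHS](cvE v) gact_cv; congr cv.
  by rewrite !mxE w0 w0' mulr0.
have w0' : v' 0 0 != 0.
  by have : v' 0 0 ^+ (3 * m) != 0; [rewrite w3 mulf_neq0 // expf_neq0|rewrite expf_eq0 m3].
pose l := v 0 0 / v' 0 0; have l0 : l != 0 by rewrite mulf_neq0 ?invr_eq0.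
have dvZ : dv (l *: v') = l *: dv v' by apply/colP => i; rewrite !mxE.
have lw : l * v' 0 0 = v 0 0 by rewrite /l divfK.
have lc : l ^+ (3 * m) * c = 1.
  apply: (mulIf (expf_neq0 (3 * m) w0)); rewrite -mulrA -w3 -exprMn lw mul1r //.
have [vP vQ] := cv1; have [vP' vQ'] := cv'.
have [g gG gE] : exists2 g, g \in Gr & l *: dv v' = g *m dv v.
  apply: orbit_separation.
  - by rewrite (dhomog_eval _ _ P_homog) vP vP' mulrCA -exprMn lw.
  - by rewrite (dhomog_eval _ _ Q_homog) vQ vQ' mulrCA -exprMn lw.
  - rewrite (dhomog_eval _ _ R_homog); apply: (mulIf (expf_neq0 m w0)).
    have lwm : v 0 0 ^+ m = l ^+ m * v' 0 0 ^+ m by rewrite -exprMn lw.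
    transitivity (l ^+ (2 * m) * aeval R (dv v') * (l ^+ m * v' 0 0 ^+ m)); first by congr (_ * _).
    have lE : l ^+ (2 * m) * l ^+ m = l ^+ (3 * m) by rewrite -exprD -mulSnr.
    rewrite mulrACA.
    rewrite lE.
    by rewrite R3 mulrA lc mul1r.
  - by rewrite (dhomog_eval _ _ S_homog) S3 mulrA lc mul1r.
exists l, g; split=> //; rewrite [LHS]cvE dvZ gE [in RHS](cvE v) gact_cv; congr cv.
by rewrite !mxE.
Qed.

Lemma pull_closed A : zclosed A ->
  exists2 A', zclosed A' & forall x, coneX x -> A' x <-> A (phi x).
Proof.
move=> [I hI ->]; exists [set x | forall p, (pull @` I) p -> vanishes_at p x].
  by exists (pull @` I) => // _ [q /hI hq <-]; apply: homogeneous_pull.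
move=> x Xx; have [v xv] := hcoord_ex x; have yv := phiP Xx xv.
split=> /= H q => [Iq|[q' Iq' <-]].
  have := H _ (ex_intro2 _ _ q Iq erefl) _ xv; rewrite aeval_pull => e.
  exact/(vanishesP (hI _ Iq) yv).
apply/(vanishesP (homogeneous_pull (hI _ Iq')) xv); rewrite aeval_pull.
exact: H Iq' _ yv.
Qed.

Lemma zopen_preim V : zopen_in Y V -> zopen_in coneX (coneX `&` phi @^-1` V).
Proof.
move=> [A cA ->]; have [A' cA' A'E] := pull_closed cA; exists A' => //.
apply/seteqP; split=> x /= [Xx]; first by move=> [_ nA]; split=> // /(A'E _ Xx).
by move=> nA; split=> //; split; [exact: phi_Y|move/(A'E _ Xx)].
Qed.

Lemma phi_morphism : morphism_on coneX Y phi.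
Proof.
split; [exact: phi_Y|exact: zopen_preim|].
move=> V f oV fV x [Xx Vx]; have [W [[B cB WE] Wx] [d [a [b [ha hb H]]]]] := fV _ Vx.
have [B' cB' B'E] := pull_closed cB.
exists ((coneX `&` phi @^-1` V) `\` B'); first split.
- by exists B'.
- by split=> // /(B'E _ Xx) Bx; move: Wx; rewrite WE => -[].
exists (d * (3 * m))%N, (pull a), (pull b); split; [exact: pull_homog|exact: pull_homog|].
move=> y v [[Xy Vy] nB'] yv; rewrite !aeval_pull; apply: H (phiP Xy yv).
by rewrite WE; split=> // /(B'E _ Xy).
Qed.

(** The complement of V is cut out by the forms to which the power sums of equations of A descend:
    all of them vanish at phi x exactly when the equations vanish on the orbit of x. *)
Lemma phi_topology V : V `<=` Y -> zopen_in coneX (coneX `&` phi @^-1` V) -> zopen_in Y V.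
Proof.
move=> VY [A [I hI AE] UE].
pose J : set {mpoly K[3]} := [set q | exists p d j, [/\ I p, p \is d.-homog, q \is (d * j.+1).-homog &
  forall v, cone v -> \sum_(g <- Gr) (aeval p (gact g v) ^+ (3 * m)) ^+ j.+1 = aeval q (Phi v)]].
have hJ : J `<=` @homogeneous K 3 by move=> q [p [d [j [_ _ hq _]]]]; exists (d * j.+1)%N.
exists [set y | forall q, J q -> vanishes_at q y]; first by exists J.
have key x : coneX x -> A x <-> forall q, J q -> vanishes_at q (phi x).
  move=> Xx; have [v xv] := hcoord_ex x; have cv : cone v by apply/(coneXP xv).
  split=> [Ax q Jq|H].
    apply/(vanishesP (hJ _ Jq) (phiP Xx xv)); case: Jq => p [d [j [Ip hp _ <- //]]].
    apply: big1_seq => g /andP[_ gG].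
    (* Inside the cone A is a union of orbits: a translate outside A would map into V, and then x
       would lie in the preimage of V, outside A. *)
    have -> : aeval p (gact g v) = 0; last by rewrite -exprM expr0n !muln_eq0 (eqn0Ngt m) m_gt0.
    have gv := hcoord_mkproj (gact_neq0 gG cv (proj1 xv)).
    have [Xg pg] := phi_orbit Xx xv gG gv.
    suff : A (mkproj (gact g v)) by rewrite AE => /(_ _ Ip _ gv).
    apply: contrapT => nA; have [_] : (coneX `\` A) (mkproj (gact g v)) by [].
    have : (coneX `&` phi @^-1` V) (mkproj (gact g v)) by rewrite UE.
    rewrite /= pg => -[_ Vx]; have : (coneX `&` phi @^-1` V) x by [].
    by rewrite UE => -[].
  rewrite AE => p Ip; apply/(vanishesP (hI _ Ip) xv); rewrite -[v]gact1.
  apply: sum_pow_eq0 => // j; have [d hd] := hI _ Ip; have [q hq qE] := sum_pow j hd.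
  by rewrite qE //; apply: (H q) (phiP Xx xv); exists p, d, j.
apply/seteqP; split=> y.
  move=> Vy; have Yy := VY _ Vy; split=> //; have [x Xx e] := phi_surj Yy.
  rewrite -e => /(key _ Xx) Ax; have : (coneX `&` phi @^-1` V) x by split=> //=; rewrite e.
  by rewrite UE => -[].
move=> [Yy nA]; have [x Xx e] := phi_surj Yy.
have : (coneX `\` A) x by split=> // /(key _ Xx) h; apply: nA; rewrite -e.
by rewrite -UE => -[_ /=]; rewrite e.
Qed.

(* After multiplication by a form that vanishes where g = a / b is not known, a = g b holds on the
   whole preimage U of V. With N = 3m, the rotation sums of a b^(N - 1) b^(N j) and of b^(N (j + 1))
   then descend with quotient g, and by power_sums0 some denominator is nonzero at x. *)
Lemma phi_descent V g : zopen_in Y V -> regular_on (coneX `&` phi @^-1` V) g ->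
  (forall x y, (coneX `&` phi @^-1` V) x -> (coneX `&` phi @^-1` V) y -> same_orbit Gam x y -> g x = g y) ->
  exists2 f, regular_on V f & forall x, (coneX `&` phi @^-1` V) x -> g x = f (phi x).
Proof.
move=> oV rg ginv; set U := coneX `&` phi @^-1` V.
have VY : V `<=` Y by case: oV => A _ -> y [].
(* A set-theoretic section of [phi]. As g is constant on orbits, [g \o ch] does not depend on it;
   the work is to show that this function is regular. *)
have [ch chP] : exists ch, forall y, Y y -> coneX (ch y) /\ phi (ch y) = y.
  suff : forall y, exists x, Y y -> coneX x /\ phi x = y by move=> /choice [ch chP]; exists ch.
  move=> y; have [/phi_surj [x Xx e]|nY] := pselect (Y y); first by exists x.
  by exists (affine_pt 0).
have gE x : U x -> g x = g (ch (phi x)).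
  move=> Ux; have [Xx Vx] := Ux; have [Xc e] := chP _ (VY _ Vx).
  by apply: ginv => //; [split=> //=; rewrite e|apply/phi_fibre].
exists (g \o ch) => // y Vy; have [Xx e] := chP _ (VY _ Vy); set x := ch y in Xx e.
have Ux : U x by split=> //=; rewrite e.
have [W [[B [I hI BE] WE] Wx] [d [a [b [ha hb abE]]]]] := rg x Ux.
have [v xv] := hcoord_ex x; have cv : cone v by apply/(coneXP xv).
have [p Ip pv] : exists2 p, I p & aeval p v != 0.
  apply: contrapT => /forall2NP H; move: Wx; rewrite WE => -[_]; apply; rewrite BE => p Ip.
  by apply/(vanishesP (hI _ Ip) xv); case: (H p) => // /negP/negPn/eqP.
have [d' hp] := hI _ Ip.
have Wp z w : U z -> hcoord z w -> aeval p w != 0 -> W z.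
  move=> Uz zw pw; rewrite WE; split=> //; rewrite BE => /(_ _ Ip _ zw) /eqP.
  by rewrite (negbTE pw).
pose a' := a * p; pose b' := b * p; pose D := (d + d')%N.
have ha' : a' \is D.-homog by apply: dhomogM.
have hb' : b' \is D.-homog by apply: dhomogM.
have b'v : aeval b' v != 0.
  by rewrite /aeval mevalM mulf_neq0 //; case: (abE _ _ Wx xv).
have a'b' z w : U z -> hcoord z w -> aeval a' w = g z * aeval b' w.
  move=> Uz zw; rewrite /aeval !mevalM -!/(aeval _ _).
  have [->|pw] := eqVneq (aeval p w) 0; first by rewrite !mulr0.
  by have [b0 ->] := abE _ _ (Wp _ _ Uz zw pw) zw; rewrite mulrA divfK.
clearbody a' b'.
have m3 : (0 < 3 * m)%N by rewrite muln_gt0.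
pose b2 := b' ^+ (3 * m); pose a2 := a' * b' ^+ (3 * m).-1.
have [j Dj] : exists j, \sum_(h <- Gr) (aeval b' (gact h v) ^+ (3 * m)) ^+ j.+1 != 0.
  apply: contrapT => /forallNP H; case/negP: b'v; rewrite -[v]gact1; apply/eqP.
  by apply: sum_pow_eq0 => // j; apply/eqP/negPn/negP/H.
have [qD hqD qDE] := sum_pow j hb'.
have [qN hqN qNE] : rep (D * j.+1) (fun v => \sum_(h <- Gr) aeval (a2 * b2 ^+ j) (gact h v)).
  apply: rotation_sum; have := dhomogM (dhomogM ha' (dhomogMn (3 * m).-1 hb')) (dhomogMn j (dhomogMn (3 * m) hb')).
  by rewrite -mulnS prednK // -mulnS mulnAC [(_ * (3 * m))%N]mulnC.
have ND z w : U z -> hcoord z w -> aeval qN (Phi w) = g z * aeval qD (Phi w).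
  move=> Uz zw; have [Xz Vz] := Uz; have cw : cone w by apply/(coneXP zw).
  rewrite -qNE // -qDE // mulr_sumr; apply: eq_big_seq => h hG.
  have hw := hcoord_mkproj (gact_neq0 hG cw (proj1 zw)).
  have [Xh ph] := phi_orbit Xz zw hG hw.
  have Uh : U (mkproj (gact h w)) by split=> //=; rewrite ph.
  have -> : g z = g (mkproj (gact h w)) by apply: ginv => //; apply/phi_fibre.
  rewrite /aeval /a2 /b2 !mevalM !mevalXn -!/(aeval _ _) (a'b' _ _ Uh hw) -!mulrA; congr (_ * _).
  by rewrite mulrA -exprS prednK // exprS.
have Xv := phiP Xx xv; rewrite e in Xv.
exists (V `\` [set z | vanishes_at qD z]); first split.
- by exists [set z | vanishes_at qD z] => //; apply: zclosed_hyper; exists (D * j.+1)%N.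
- by split=> // /(_ _ Xv); rewrite -qDE // => /eqP; rewrite (negbTE Dj).
exists (D * j.+1)%N, qN, qD; split=> // z w [Vz nD] zw.
have hD : homogeneous qD by exists (D * j.+1)%N.
have qDw : aeval qD w != 0 by apply/eqP => /(vanishesP hD zw) /nD.
split=> //=; have [Xc ce] := chP _ (VY _ Vz); have [u cu] := hcoord_ex (ch z).
have Uc : U (ch z) by split=> //=; rewrite ce.
have := phiP Xc cu; rewrite ce => /(hcoord_scale zw) [c c_neq0 PE].
have := ND _ _ Uc cu; rewrite PE (dhomog_eval _ _ hqN) (dhomog_eval _ _ hqD) mulrCA.
move/(mulfI (expf_neq0 (D * j.+1) c_neq0)) => ->; by rewrite mulfK.
Qed.

Theorem phi_geometric_quotient : geometric_quotient Gam (zclosure affX) Y phi /\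
  forall u, aeval P u = r -> aeval Q u = t ->
    phi (affine_pt u) = affine_pt (col2 (aeval S u) (aeval R u)).
Proof.
split=> [|u uP uQ]; last first.
  have Xu : coneX (affine_pt u) by apply/(coneXP (hcoord_cv u))/cone_affine.
  have := phiP Xu (hcoord_cv u); rewrite Phi_cv => h.
  exact: hcoord_inj h (hcoord_aff2 (aeval S u) (aeval R u)).
rewrite zclosure_affX; split.
- exact: phi_morphism.
- apply/seteqP; split=> y; first by move=> [x Xx <-]; apply: phi_Y.
  by move=> /phi_surj [x Xx e]; exists x.
- exact: phi_fibre.
- exact: phi_topology.
- exact: phi_descent.
Qed.

End Quotient.

(** * The relation between the invariants on the cone *)

Section Relation.
Variable K : numFieldType.
Implicit Type T : polyhedron.

Lemma mS_neq0 T : mS K T != 0.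
Proof.
suff [x [y [z S0]]] : exists x y z : K, invS T x y z != 0.
  by apply: contraNneq S0 => /(congr1 (fun p => aeval p (col3 x y z))); rewrite aeval_mS !mxE /aeval meval0 => ->.
case: T; [exists 0, 1, 2|exists 1, 2, 3|exists 0, 1, 1]; rewrite /invS.
- have -> : (0 ^+ 2 - 1 ^+ 2) * (1 ^+ 2 - 2 ^+ 2) * (2 ^+ 2 - 0 ^+ 2) = 12%:R :> K by ring.
  by rewrite pnatr_eq0.
- rewrite [X in X != 0](_ : _ = 720%:R); last by ring.
  by rewrite pnatr_eq0.
rewrite [X in X != 0](_ : _ = 152%:R); last by ring.
by rewrite pnatr_eq0.
Qed.

Definition rel3 T : K := match T with Tetrahedron => -4 | Octahedron => -27 | Icosahedron => -1 end.
Definition rel2 T (r t : K) : K := match T with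
  | Tetrahedron => r ^+ 2
  | Octahedron => r * (18 * t - 4 * r ^+ 2)
  | Icosahedron => r ^+ 2 * (4 * r ^+ 3 - 65 * t) end.
Definition rel1 T (r t : K) : K := match T with
  | Tetrahedron => 18 * r * t ^+ 2
  | Octahedron => t ^+ 2 * (r ^+ 2 - 4 * t)
  | Icosahedron => r * t * (720 * t ^+ 2 + 200 * r ^+ 6 - 795 * r ^+ 3 * t) end.
Definition rel0 T (r t : K) : K := match T with
  | Tetrahedron => - (4 * r ^+ 3 + 27 * t ^+ 2) * t ^+ 2
  | Octahedron => 0
  | Icosahedron => 500 * r ^+ 9 * t ^+ 2 - 2275 * r ^+ 6 * t ^+ 3
      + 3440 * r ^+ 3 * t ^+ 4 - 1728 * t ^+ 5 end.
Lemma rel3_neq0 T : rel3 T != 0.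
Proof. by case: T; rewrite /= oppr_eq0 ?pnatr_eq0 ?oner_eq0. Qed.

(** F has weighted degree 6m, so the coefficient of R^i has degree 2m (3 - i) and acquires the
    factor (w^m)^(2 (3 - i)). *)
Lemma relF_weighted T (r t w x : K) :
  relF T (r * w ^+ 2) (t * w ^+ (degm T).+1) x =
  rel3 T * x ^+ 3 + rel2 T r t * (w ^+ degm T) ^+ 2 * x ^+ 2
  + rel1 T r t * (w ^+ degm T) ^+ 4 * x + rel0 T r t * (w ^+ degm T) ^+ 6.
Proof. by case: T; rewrite /=; ring. Qed.

Lemma mS_rel T r t (u : 'cV[K]_3) w :
  aeval (mP K) u = r * w ^+ 2 -> aeval (mQ K T) u = t * w ^+ (degm T).+1 ->
  aeval (mS K T) u ^+ 2 = rel3 T * aeval (mR K T) u ^+ 3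
    + rel2 T r t * (w ^+ degm T) ^+ 2 * aeval (mR K T) u ^+ 2
    + rel1 T r t * (w ^+ degm T) ^+ 4 * aeval (mR K T) u + rel0 T r t * (w ^+ degm T) ^+ 6.
Proof.
move=> uP uQ; have := invS_sqr T (u 0 0) (u 1 0) (u 2 0).
rewrite aeval_mP in uP; rewrite aeval_mQ in uQ; rewrite uP uQ relF_weighted -(aeval_mS T u) -(aeval_mR T u).
exact.
Qed.

Lemma invariants_col3 T (x y z : K) : [/\ aeval (mP K) (col3 x y z) = invP x y z,
  aeval (mQ K T) (col3 x y z) = invQ T x y z, aeval (mR K T) (col3 x y z) = invR T x y z &
  aeval (mS K T) (col3 x y z) = invS T x y z].
Proof.
split; [rewrite aeval_mP|rewrite aeval_mQ|rewrite aeval_mR|rewrite aeval_mS]; by rewrite !mxE.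
Qed.

Lemma affineC_E T (r t : K) :
  affineC T r t = [set u | aeval (mP K) u = r /\ aeval (mQ K T) u = t].
Proof.
have E (u : 'cV[K]_3) : invP (u 0 0) (u 1 0) (u 2 0) = r /\ invQ T (u 0 0) (u 1 0) (u 2 0) = t <->
    aeval (mP K) u = r /\ aeval (mQ K T) u = t.
  by rewrite -(aeval_mP u) -(aeval_mQ T u).
by apply/seteqP; split=> u /E.
Qed.

Lemma quotient_coordsE T (u : 'cV[K]_3) :
  quotient_coords T u = col2 (aeval (mS K T) u) (aeval (mR K T) u).
Proof. by rewrite /quotient_coords -(aeval_mS T u) -(aeval_mR T u). Qed.

End Relation.

(** * Points with prescribed invariants *)

Section Fibres.
Variable K : numClosedFieldType.
Implicit Type T : polyhedron.

Lemma quadratic_roots (p q : K) : exists a b, a + b = p /\ a * b = q.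
Proof.
have h := sqrtCK (p ^+ 2 - 4 * q); move: (sqrtC _) h => d h.
exists ((p + d) / 2), ((p - d) / 2); split; first by field.
have -> : (p + d) / 2 * ((p - d) / 2) = (p ^+ 2 - d ^+ 2) / 4 by field.
by rewrite h; field.
Qed.

Lemma cubic_roots (e1 e2 e3 : K) : exists a b c,
  [/\ a + b + c = e1, a * b + b * c + a * c = e2 & a * b * c = e3].
Proof.
have [a] := @solve_monicpoly K 3 (nth 0 [:: e3; - e2; e1]) isT.
rewrite !big_ord_recr big_ord0 /= => aE.
have [b [c [s p]]] := quadratic_roots (e1 - a) (e2 - a * (e1 - a)).
exists a, b, c; split; first by rewrite -addrA s addrC subrK.
  by rewrite addrAC -mulrDr s p addrC subrK.
rewrite -mulrA p.
have -> : a * (e2 - a * (e1 - a)) = e2 * a - e1 * a ^+ 2 + a ^+ 3 by ring.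
rewrite aE; ring.
Qed.

(** With a = x + iy and b = x - iy one has ab = rho and a^5 + b^5 = 2c. So a^5 and b^5 are the roots
    of X^2 - 2cX + rho^5. *)
Lemma re5_surj (rho c : K) : exists x y, x ^+ 2 + y ^+ 2 = rho /\ re5 x y = c.
Proof.
suff [a [b [ab abc]]] : exists a b, a * b = rho /\ a ^+ 5 + b ^+ 5 = 2 * c.
  have i2 := sqrCi K; exists ((a + b) / 2), (- 'i * (a - b) / 2).
  have e : (- 'i * (a - b) / 2) ^+ 2 = - ((a - b) / 2) ^+ 2.
    by rewrite -mulrA exprMn sqrrN i2 mulN1r.
  split; first by rewrite e -ab; field.
  have -> : c = (a ^+ 5 + b ^+ 5) / 2 by rewrite abc; field.
  rewrite /re5 (_ : (- 'i * (a - b) / 2) ^+ 4 = (- 'i * (a - b) / 2) ^+ 2 ^+ 2); last by rewrite -exprM.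
  by rewrite e; field.
have r5 (z : K) : exists y, y ^+ 5 = z by exists (5.-root z); rewrite rootCK.
have [a [b [ab abc]]] := quadratic_roots (2 * c) (rho ^+ 5).
(* One fifth root y is chosen, and rho / y serves as the other, which makes the product exactly rho;
   this needs a nonzero root. If both roots are 0, then so are rho and c. *)
wlog a0 : a b ab abc / a != 0.
  move=> H; have [a0|a0] := eqVneq a 0; last exact: (H a b).
  have [b0|b0] := eqVneq b 0; last by apply: (H b a _ _ b0); [rewrite addrC|rewrite mulrC].
  move: ab abc; rewrite a0 b0 addr0 mulr0 => <- /esym/eqP.
  rewrite expf_eq0 => /eqP ->; exists 0, 0; by rewrite mulr0 expr0n addr0.
have [y ya] := r5 a; have y0 : y != 0 by apply: contraNneq a0 => y0; rewrite -ya y0 expr0n.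
exists y, (rho / y); split; first by rewrite mulrC divfK.
by rewrite expr_div_n ya -abc mulrAC mulfV // mul1r.
Qed.

(* R z^2 is a polynomial in P, Q and z^2, whence an equation for z^2 on a fibre. *)
Lemma icoR_sqr (A : comNzRingType) (z rho c : A) (P := rho + z ^+ 2) (Q := icoQ z rho c) (Z := z ^+ 2) :
  icoR z rho c * Z = Q ^+ 2 - 25 * P ^+ 2 * Q * Z + 125 * P ^+ 4 * Z ^+ 2 + 150 * P * Q * Z ^+ 2
    - 1250 * P ^+ 3 * Z ^+ 3 - 250 * Q * Z ^+ 3 + 4375 * P ^+ 2 * Z ^+ 4 - 6250 * P * Z ^+ 5 + 3125 * Z ^+ 6.
Proof. rewrite /Z /Q /P /icoQ /icoR; ring. Qed.

(** If all roots were 0, the polynomial would be a single monomial; but both its leading coefficient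
    3125 and its coefficient -6250 r of Z^5 are nonzero. A nonzero Z is needed because c is
    recovered from Q by dividing by z. *)
Lemma ico_root (r t s : K) : r != 0 -> exists2 Z : K, Z != 0 &
  s * Z = t ^+ 2 - 25 * r ^+ 2 * t * Z + 125 * r ^+ 4 * Z ^+ 2 + 150 * r * t * Z ^+ 2
    - 1250 * r ^+ 3 * Z ^+ 3 - 250 * t * Z ^+ 3 + 4375 * r ^+ 2 * Z ^+ 4 - 6250 * r * Z ^+ 5 + 3125 * Z ^+ 6.
Proof.
move=> r0; pose p : {poly K} := Poly [:: t ^+ 2; - (25 * r ^+ 2 * t + s); 125 * r ^+ 4 + 150 * r * t;
  - (1250 * r ^+ 3 + 250 * t); 4375 * r ^+ 2; - (6250 * r); 3125].
have [rs pE] := closed_field_poly_normal p.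
have [Z Zrs Z0] : exists2 Z, Z \in rs & Z != 0.
  apply: contrapT => /forall2NP H.
  have pX : p = lead_coef p *: 'X^(size rs).
    rewrite {1}pE; congr (_ *: _); rewrite (eq_big_seq (fun=> 'X)) => [|z zs]; last first.
      by case: (H z) => // /negP/negPn/eqP ->; rewrite subr0.
    by rewrite big_const_seq count_predT iter_mulr_1.
  have := congr1 (fun q : {poly K} => q`_6) pX; have := congr1 (fun q : {poly K} => q`_5) pX.
  rewrite !coefZ !coefXn !coef_Poly /=.
  case: (6%N =P size rs) => [<-|_]; last by rewrite mulr0 => _ /eqP; rewrite pnatr_eq0.
  by rewrite mulr0 => /eqP; rewrite oppr_eq0 mulf_eq0 pnatr_eq0 (negbTE r0).
exists Z => //; have : root p Z.
  rewrite pE rootZ ?root_prod_XsubC // lead_coef_eq0.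
  apply/eqP => /(congr1 (fun q : {poly K} => q`_6)) /eqP.
  by rewrite coef_Poly coef0 /= pnatr_eq0.
rewrite rootE horner_Poly /= => /eqP h; apply/eqP; rewrite -subr_eq0 -oppr_eq0; apply/eqP.
rewrite -[RHS]h; ring.
Qed.

(** For the tetrahedron and octahedron, the squares of the coordinates are the roots of a cubic; for
    the tetrahedron a sign change of x adjusts xyz to t. For the icosahedron z comes from
    [ico_root], then P and Q fix rho and c, and [re5_surj] gives x and y. *)
Lemma invPQR_surj T (r t s : K) : r != 0 ->
  exists x y z, [/\ invP x y z = r, invQ T x y z = t & invR T x y z = s].
Proof.
move=> r0; case: T.
- have [a [b [c [e1 e2 e3]]]] := cubic_roots r s (t ^+ 2).
  have := (sqrtCK a, sqrtCK b, sqrtCK c); move: (sqrtC a) (sqrtC b) (sqrtC c) => x y z [[xa yb] zc].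
  have : (x * y * z) ^+ 2 == t ^+ 2 by rewrite !exprMn xa yb zc e3.
  rewrite eqf_sqr => /orP[]/eqP xyz; [exists x, y, z|exists (- x), y, z];
    by rewrite /invP /invQ /invR ?sqrrN ?mulNr xyz ?opprK xa yb zc e1 e2.
- have [a [b [c [e1 e2 e3]]]] := cubic_roots r t s; exists (sqrtC a), (sqrtC b), (sqrtC c).
  by rewrite /invP /invQ /invR !sqrtCK.
have [Z Z0 ZE] := ico_root t s r0; have z2 := sqrtCK Z; move: (sqrtC Z) z2 => z z2.
have z0 : z != 0 by apply: contraNneq Z0 => z0; rewrite -z2 z0 expr0n.
pose rho := r - z ^+ 2; pose c := (- 5 * z ^+ 3 * rho + 5 * z * rho ^+ 2 + z ^+ 5 - t / z) / 2.
have [x [y [xy xyc]]] := re5_surj rho c.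
have Q : icoQ z rho c = t by rewrite /icoQ /c; field.
exists x, y, z; rewrite icoQE icoRE xy xyc /invP xy subrK; split=> //.
apply: (mulIf Z0); rewrite ZE; have := icoR_sqr z rho c.
have e : rho + z ^+ 2 = r by rewrite /rho subrK.
by rewrite /= e Q z2.
Qed.

(** A reflection of the group, used to correct the sign of S, which the relation determines only up
    to sign. *)
Lemma inv_reflect T (x y z : K) : exists x' y' z',
  [/\ invP x' y' z' = invP x y z, invQ T x' y' z' = invQ T x y z,
      invR T x' y' z' = invR T x y z & invS T x' y' z' = - invS T x y z].
Proof.
case: T; [exists y, x, z|exists y, x, z|exists x, (- y), z].
- by split; rewrite /invP /invQ /invR /invS; ring.
- by split; rewrite /invP /invQ /invR /invS; ring.
have r5 : re5 x (- y) = re5 x y by rewrite /re5; ring.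
have i5 : im5 x (- y) = - im5 x y by rewrite /im5; ring.
by rewrite /invP !icoQE !icoRE !icoSE sqrrN r5 i5 mulrN mulNr.
Qed.

Lemma inv_surj T (r t w s : K) : r != 0 -> w ^+ 2 = relF T r t s ->
  exists x y z, [/\ invP x y z = r, invQ T x y z = t, invS T x y z = w & invR T x y z = s].
Proof.
move=> r0 we; have [x [y [z [xP xQ xR]]]] := invPQR_surj T t s r0.
have : invS T x y z ^+ 2 == w ^+ 2 by rewrite invS_sqr xP xQ xR we.
rewrite eqf_sqr => /orP[]/eqP xS; first by exists x, y, z.
have [x' [y' [z' [e1 e2 e3 e4]]]] := inv_reflect T x y z; exists x', y', z'.
by rewrite e1 e2 e3 e4 xS opprK.
Qed.

(** For the octahedron the squares of the coordinates are the three cube roots of unity, whose first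
    two elementary symmetric functions vanish. *)
Lemma inv_infinity T : exists x y z : K,
  [/\ [|| x != 0, y != 0 | z != 0], invP x y z = 0 & invQ T x y z = 0].
Proof.
have i2 := sqrCi K; case: T.
- exists 0, 1, 'i; rewrite oner_neq0 orbT /invP /invQ expr0n expr1n i2 add0r subrr.
  by rewrite !mul0r.
- have [a [b [c [e1 e2 e3]]]] := cubic_roots 0 0 (1 : K).
  exists (sqrtC a), (sqrtC b), (sqrtC c); rewrite /invP /invQ !sqrtCK; split=> //.
  by rewrite sqrtC_eq0; apply/orP; left; apply: contra_eq_neq e3 => ->; rewrite !mul0r eq_sym oner_neq0.
exists 1, 'i, 0; rewrite oner_neq0 /invP /invQ expr1n i2 subrr expr0n add0r.
by rewrite !mul0r.
Qed.

Definition relW T (r t : K) : {poly K} := wf (rel3 K T) (rel2 T r t) (rel1 T r t) (rel0 T r t).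

Lemma relFE T (r t x : K) : relF T r t x = (relW T r t).[x].
Proof.
have := relF_weighted T r t 1 x; rewrite !expr1n !mulr1 => ->.
by rewrite /relW wfE.
Qed.

Lemma relF_rmorph (A B : comNzRingType) (f : {rmorphism A -> B}) T a b c :
  f (relF T a b c) = relF T (f a) (f b) (f c).
Proof. by case: T; rewrite /relF ?(rmorph_nat, rmorphB, rmorphD, rmorphM, rmorphN, rmorphXn). Qed.

Lemma relF_polyE T r t : relF T r%:P t%:P 'X = relW T r t.
Proof.
apply/eqP; rewrite -subr_eq0; apply/eqP/(poly_eval0 (oner_neq0 _)) => x _.
rewrite hornerD hornerN -relFE -[(relF _ _ _ _).[x]]/(horner_eval x _) relF_rmorph.
by rewrite /= /horner_eval !hornerC hornerX subrr.
Qed.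

Lemma discriminant_separable T (r t : K) : discriminant (relF T r%:P t%:P 'X) != 0 ->
  forall x, (relW T r t).[x] = 0 -> (relW T r t)^`().[x] != 0.
Proof.
rewrite relF_polyE => D x px; apply: contraNneq D => p'x.
rewrite /discriminant; suff /eqP -> : resultant (relW T r t) (relW T r t)^`() == 0 by rewrite mulr0 mul0r.
have p0 : relW T r t != 0.
  by rewrite -size_poly_gt0 (size_wf _ _ _ (rel3_neq0 K T)).
rewrite resultant_eq0 ltnNge; apply/negP => g1.
have : coprimep (relW T r t) (relW T r t)^`().
  by rewrite /coprimep eqn_leq g1 lt0n size_poly_eq0 gcdp_eq0 (negbTE p0).
by move/coprimep_root => /(_ x); rewrite rootE px eqxx => /(_ isT); rewrite p'x eqxx.
Qed.

Lemma mPQRS_surj T r t : r != 0 -> forall s x : K, s ^+ 2 = (relW T r t).[x] ->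
  exists u, [/\ aeval (mP K) u = r, aeval (mQ K T) u = t, aeval (mS K T) u = s & aeval (mR K T) u = x].
Proof.
move=> r0 s x; rewrite -relFE => /(inv_surj r0) [x1 [y1 [z1 [e1 e2 e3 e4]]]].
by have [f1 f2 f3 f4] := invariants_col3 T x1 y1 z1; exists (col3 x1 y1 z1); split;
  [exact: etrans f1 e1|exact: etrans f2 e2|exact: etrans f4 e3|exact: etrans f3 e4].
Qed.

Lemma mPQ_infinity T : exists2 u, u != 0 & aeval (mP K) u = 0 /\ aeval (mQ K T) u = 0.
Proof.
have [x [y [z [xyz e1 e2]]]] := inv_infinity T; exists (col3 x y z).
  by rewrite col3_eq0 !mxE /= !negb_and.
by have [f1 f2 _ _] := invariants_col3 T x y z; split; [exact: etrans f1 e1|exact: etrans f2 e2].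
Qed.

Lemma affineE_W T (r t : K) : affineE T r t = affineW (rel3 K T) (rel2 T r t) (rel1 T r t) (rel0 T r t).
Proof. by apply/seteqP; split=> w; rewrite /affineE /affineW /= relFE. Qed.

End Fibres.

Lemma ptsW_open (K : numClosedFieldType) (c3 c2 c1 c0 : K) : c3 != 0 ->
  zopen_in (curveW c3 c2 c1 c0) (ptsW c3 c2 c1 c0).
Proof.
move=> c3_neq0; exists [set x | vanishes_at 'X_0 x].
  by apply: zclosed_hyper; exists 1%N; apply: dhomog_var.
apply/seteqP; split=> x.
  move=> px; split; first exact: ptsW_curveW.
  case: px => w _ <- /(_ _ (hcoord_aff w)) /eqP.
  by rewrite /aeval mevalXU mxE /= oner_eq0.
move=> [Ex nx]; case: (curveW_cases c3_neq0 Ex) => // xv; case: nx => v /(hcoord_scale xv) [c _ ->].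
by rewrite /aeval mevalXU !mxE mulr0.
Qed.

(** * The rotation group and the final statement *)

Section RotationQuotient.
Variable R : realType.
Local Notation K := R[i].
Local Notation rc := (real_complex R).

Lemma mact_mS_rotation T g : rotation_group T g -> mact (map_mx rc g) (mS K T) = mS K T.
Proof. by move=> [gG gd]; have := mact_mS gG; rewrite gd rmorph1 scale1r. Qed.

Lemma map_rc_inj : injective (map_mx rc : 'M[R]_3 -> 'M[K]_3).
Proof. by move=> M N /matrixP e; apply/matrixP => i j; have := e i j; rewrite !mxE => /fmorph_inj. Qed.

End RotationQuotient.

Theorem mainTheorem2 (R : realType) (T : polyhedron) (r t : R[i])
    (r_neq0 : r != 0)
    (disc_neq0 : discriminant (relF T r%:P t%:P 'X) != 0) :
  [/\ smooth_projective_model [set affine_pt w | w in affineE T r t]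
                              (curveE T r t),
      nonsingular_plane_cubic (curveE T r t) &
      exists phi,
        geometric_quotient (@proj_rotation_group R T)
          (curveC T r t) (curveE T r t) phi /\
        forall u, affineC T r t u ->
          phi (affine_pt u) = affine_pt (quotient_coords T u)].
Proof.
have c3n := rel3_neq0 R[i] T; have sep := discriminant_separable disc_neq0.
have EE : curveE T r t = curveW (rel3 _ T) (rel2 T r t) (rel1 T r t) (rel0 T r t).
  by rewrite /curveE affineE_W -(zclosure_ptsW _ _ _ c3n).
have m_gt0 : (0 < degm T)%N by case: (T).
split.
- rewrite EE affineE_W; split.
    by split; [exact: curveW_projective|exact: curveW_tangent].
  by rewrite -(zclosure_ptsW _ _ _ c3n); apply: birational_affine; rewrite zclosure_ptsW //; apply: ptsW_open.
- rewrite EE; exists (cubic (rel3 _ T) (rel2 T r t) (rel1 T r t) (rel0 T r t)); split=> //.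
    exact: cubic_homog.
  exact: curveW_nonsingular.
(* The abstract quotient works with finite sums over a list of complex matrices; here the group,
   given as a set of real matrices, is put into that form. *)
have [Gs Gs_uniq GsP] := sym_finite R T.
pose rc := real_complex R; pose mGs := [seq map_mx rc g | g <- Gs].
have mG h : h \in mGs -> exists2 g, symmetry_group T g & h = map_mx rc g.
  by move=> /mapP [g /GsP gG ->]; exists g.
pose Gr := [seq h <- mGs | \det h == 1].
have GrP h : h \in Gr <-> exists2 g, rotation_group T g & h = map_mx rc g.
  rewrite mem_filter; split=> [/andP[/eqP hd /mG [g gG hE]]|[g [gG gd] ->]].
    exists g => //; split=> //=; apply: (fmorph_inj rc).
    by rewrite rmorph1 -hd hE det_map_mx.
  by rewrite det_map_mx gd rmorph1 eqxx map_f //; apply/GsP.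
have GamE : Gam Gr = @proj_rotation_group R T.
  apply/seteqP; split=> M /=.
    by move=> [h /= /GrP [g gG ->] <-]; exists g.
  by move=> [g gG <-]; exists (map_mx rc g) => //=; apply/GrP; exists g.
exists (phi (mR R[i] T) (mS R[i] T) (degm T)); rewrite -GamE EE.
have -> : curveC T r t = zclosure (affX (mP R[i]) (mQ R[i] T) r t) by rewrite /curveC affineC_E.
have [||||||||||||quo aff] := @phi_geometric_quotient R[i] Gr (mP R[i]) (mQ R[i] T) (mR R[i] T) (mS R[i] T) (degm T)
  r t (rel3 _ T) (rel2 T r t) (rel1 T r t) (rel0 T r t).
- exact: m_gt0.
- exact: mP_homog.
- exact: mQ_homog.
- exact: mR_homog.
- exact: mS_homog.
- apply/GrP; exists 1%:M; last by rewrite map_mx1.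
  by split; [exact: sym_1|rewrite /= det1].
- move=> _ /GrP [g [gG gd] ->]; have [iP iQ iR] := mact_invariants gG.
  have iS : mact (map_mx rc g) (mS R[i] T) = mS R[i] T by apply: mact_mS_rotation.
  split.
  + exact: iP.
  + exact: iQ.
  + exact: iR.
  + exact: iS.
- move=> k f hf; rewrite /Gr big_filter.
  apply: (@rotation_sum_rep _ mGs _ _ _ _ (jac_const R[i] T) (degm T).+1 (degm T)) => //.
  + by rewrite map_inj_uniq //; apply: map_rc_inj.
  + move=> _ _ /mG [g gG ->] /mG [h hG ->]; rewrite -map_mxM map_f //.
    by apply/GsP/sym_mul.
  + move=> _ /mG [g gG ->]; rewrite det_map_mx.
    by case: (sym_det gG) => ->; rewrite ?rmorphN rmorph1; [left|right].
  + exact: mP_homog.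
  + exact: mQ_homog.
  + exact: mR_homog.
  + exact: mS_homog.
  + by move=> _ /mG [g gG ->]; have [i _ _] := mact_invariants gG; exact: i.
  + by move=> _ /mG [g gG ->]; have [_ i _] := mact_invariants gG; exact: i.
  + by move=> _ /mG [g gG ->]; have [_ _ i] := mact_invariants gG; exact: i.
  + exact: jac_const_neq0.
  + exact: mS_neq0.
  + exact: jac_mPQR.
  + move=> h hs; apply: skew_div => g gG; rewrite (hs (map_mx rc g)) ?map_f ?det_map_mx //.
    exact/GsP.
- exact: mS_rel.
- exact: c3n.
- exact: mPQRS_surj.
- exact: mPQ_infinity.
split; first exact: quo.
by rewrite affineC_E => u [uP uQ]; rewrite quotient_coordsE; apply: aff.
Qed.
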